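(* Let $q:[t_0,t_1]\to M=\mathbb{R}^n$ be a minimizing strictly abnormal sub-Riemannian (SR) geodesic, corresponding to the control $u\in L^\infty([t_0,t_1],\mathbb{R}^k)$. Let $\varphi(t)=\Phi^{(1)}(t)^*\psi_0$ be a Pontryagin covector and $t_0=\tau_0<\tau_1<\dots<\tau_N=t_1$ a division of $[t_0,t_1]$ such that on each $[t_0',t_1']\subset(\tau_i,\tau_{i+1})$ there is a family of symmetric bilinear maps $\mathbf{\Phi}_2(t)$ on $T_{q(t)}M\times\mathbb{R}$, $t\in[t_0',t_1']$, satisfying (with $b^{(i)},c^{(i)}$ computed on $[t_0',t_1']$): (1) $-\mathbf{\Phi}_2(t)[(b,c),(b,c)]=\inf\{\langle b^{(2)}(t,\Delta u),\varphi(t)\rangle:\Delta u\in L^\infty([t_0',t_1'],\mathbb{R}^k),\ b^{(1)}(t,\Delta u)=b,\ c^{(1)}(t,\Delta u)=c\}$ for all attained values $(b,c)$; (2) $t\mapsto\mathbf{\Phi}_2(t)$ is of bounded variation; (3) $t\mapsto\langle b^{(2)}(t,\Delta u),\varphi(t)\rangle+\mathbf{\Phi}_2(t)[(b^{(1)}(t,\Delta u),c^{(1)}(t,\Delta u)),(b^{(1)}(t,\Delta u),c^{(1)}(t,\Delta u))]$ is non-decreasing for every $\Delta u\in L^\infty([t_0',t_1'],\mathbb{R}^k)$. Assume additionally that $q$ satisfies Monti's condition at time $t_1$ (for the characteristic optimal control problem defined by $\psi_0$). Then on each of the pieces, i.e. on each $[t_0',t_1']\subset(\tau_i,\tau_{i+1})$,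 the curve $q$ is either a 2-abnormal extremal or of class $C^2$.
   Context: Setting: $M=\mathbb{R}^n$, with $X_1,\dots,X_k$ smooth vector fields on $\mathbb{R}^n$, linearly independent at every point, spanning a distribution $\mathcal{D}$ and orthonormal for the SR metric. For $u\in L^\infty([t_0,t_1],\mathbb{R}^k)$ the SR trajectory is the absolutely continuous solution of $\dot q=\sum_iu_iX_i(q)$, $q(t_0)=q_0$, with energy $E^{[t_0,t]}[u]=\frac12\int_{t_0}^t\sum_iu_i^2$. It is a minimizing SR geodesic if it has least energy among all absolutely continuous curves on $[t_0,t_1]$ a.e. tangent to $\mathcal{D}$ with the same end-points. Extended end-point map: $\mathbf{End}^{[t_0,t]}[u]=(q(t),E^{[t_0,t]}[u])$. The $b^{(i)}(t,\Delta u)\in\mathbb{R}^n$, $c^{(i)}(t,\Delta u)\in\mathbb{R}$ are defined by $\mathbf{End}^{[t_0,t]}[u+s\Delta u]=(q(t),E^{[t_0,t]}[u])+s(b^{(1)},c^{(1)})+s^2(b^{(2)},c^{(2)})+o(s^2)$. On a sub-interval $[t_0',t_1']$ one uses initial time $t_0'$ and initial point $q(t_0')$. The trajectory is strictly abnormal if $\mathrm{Im}\,D_u\mathbf{End}^{[t_0,t_1]}=V\times\mathbb{R}$ for a proper subspace $V\subset T_{q(t_1)}M$. A Pontryagin covector is a nowhere-vanishing absolutely continuous curve $\varphi(t)\in T^*_{q(t)}M$ with $\langle X_i(q(t)),\varphi(t)\rangle=0$ for all $i,t$ and $\langle b,\dot\varphi(t)\rangle+\langle\sum_iu_i(t)D_{q(t)}X_i[b],\varphi(t)\rangle=0$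 for all $b$. 2-normal/2-abnormal: given $\varphi$ and $\mathbf{\Phi}_2$ as in the claim on a piece $[t_0',t_1']$, put $a_2(t)=\mathbf{\Phi}_2(t)[(0,1),(0,1)]$. The piece is a 2-normal extremal if $a_2(t)\ne0$ for every $t\in(t_0',t_1']$; otherwise it is a 2-abnormal extremal. Adapted coordinates along $q$: $\Phi^{(1)}(t):T_{q(t)}M\to\mathbb{R}^n$ are the linear isomorphisms with $\dot\Phi^{(1)}(t)[b]+\sum_iu_i(t)\Phi^{(1)}(t)[D_{q(t)}X_i[b]]=0$ for all $b$, $\Phi^{(1)}(t_0)=(\psi_1,\dots,\psi_n)$ a fixed basis of $T^*_{q_0}M$; $A(t)=\Phi^{(1)}(t)^{-1}$. $\Phi^{(2)}(t):T_{q(t)}M\times T_{q(t)}M\to\mathbb{R}^n$ are symmetric bilinear with $\dot\Phi^{(2)}(t)[b,b]+\sum_iu_i(t)\{\Phi^{(1)}(t)[D^2_{q(t)}X_i[b,b]]+2\Phi^{(2)}(t)[D_{q(t)}X_i[b],b]\}=0$, $\Phi^{(2)}(t_0)=0$. Put $Y_i^{(1)}(t)=\Phi^{(1)}(t)[X_i(q(t))]$ and $Y_i^{(2)}(t,v)=\Phi^{(1)}(t)[D_{q(t)}X_i[A(t)v]]+\Phi^{(2)}(t)[X_i(q(t)),A(t)v]$. (Every Pontryagin covector has the form $\Phi^{(1)}(t)^*\psi_0$ with $\psi_0\in(\mathbb{R}^n)^*$.) For $\Delta u\in L^\infty([t_0,\tau],\mathbb{R}^k)$ let $\mathbf{q}^{(1)}(t,\Delta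 u)=(q^{(1)},c^{(1)})(t,\Delta u)\in\mathbb{R}^{n+1}$ solve $\dot q^{(1)}=\sum_i\Delta u_iY_i^{(1)}(t)$, $\dot c^{(1)}=\sum_i\Delta u_iu_i$ with $\mathbf{q}^{(1)}(t_0)=\mathbf{0}$. The characteristic optimal control problem (OCP) for $\psi_0$ consists in minimizing $Q_{t_0,\tau}[\Delta u]=\int_{t_0}^\tau\sum_i\Delta u_i(t)\langle Y_i^{(2)}(t,q^{(1)}(t,\Delta u)),\psi_0\rangle dt$ over $\Delta u$ with $\mathbf{q}^{(1)}(\tau,\Delta u)=\mathbf{v}$; $\widehat Q_{t_0,\tau}(\mathbf{v})$ is the infimum, and $\mathrm{Sol}_{t_0,\tau}(\mathbf{0})=\{\Delta u: \mathbf{q}^{(1)}(\tau,\Delta u)=\mathbf{0},\ Q_{t_0,\tau}[\Delta u]=\widehat Q_{t_0,\tau}(\mathbf{0})\}$. Monti's condition at time $\tau$: $\mathrm{Sol}_{t_0,\tau}(\mathbf{0})$ has finite codimension in $L^\infty([t_0,\tau],\mathbb{R}^k)$. *)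

(* Defs.v *)
From HB Require Import structures.
From mathcomp Require Import all_boot all_order all_algebra.
From mathcomp Require Import all_classical all_reals all_analysis.

Set Implicit Arguments.
Unset Strict Implicit.
Unset Printing Implicit Defensive.

Import Order.TTheory GRing.Theory Num.Theory.
Import numFieldNormedType.Exports.

Local Open Scope classical_set_scope.
Local Open Scope ring_scope.

(* Tangent vectors of R^n are rows and covectors are columns, so that a linear
   map T_q M -> R^n is a matrix acting on the right and its adjoint acts on
   covectors by multiplication on the left. Curves and controls on an interval
   are functions on the whole of R; only their restriction to the interval
   matters. *)

Definition pairing {R : realType} {n : nat} (b : 'rV[R]_n) (p : 'cV[R]_n) : R :=
  (b *m p) ord0 ord0.

Fixpoint Ck {R : realType} {m n : nat} (r : nat) (f : 'rV[R]_m -> 'rV[R]_n)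
    : Prop :=
  if r is r'.+1 then
    (forall x, differentiable f x) /\
    (forall v : 'rV[R]_m, Ck r' (fun x => 'D_v f x))
  else continuous f.

Definition smooth {R : realType} {m n : nat} (f : 'rV[R]_m -> 'rV[R]_n) :=
  forall r, Ck r f.

Definition abs_continuous {R : realType} {V : normedModType R} (a b : R)
    (f : R -> V) : Prop :=
  forall e : R, 0 < e -> exists2 d : R, 0 < d &
    forall (m : nat) (x y : 'I_m -> R),
      (forall i, [/\ a <= x i, x i <= y i & y i <= b]) ->
      trivIset [set: 'I_m] (fun i => `]x i, y i[%classic) ->
      \sum_i (y i - x i) < d -> \sum_i `|f (y i) - f (x i)| < e.

Definition ae_on {R : realType} (a b : R) (P : R -> Prop) : Prop :=
  {ae @lebesgue_measure R, forall t, t \in `]a, b[ -> P t}.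

Definition Linfty {R : realType} {k : nat} (a b : R) (u : R -> 'rV[R]_k)
    : Prop :=
  forall j, (fun t : measurableTypeR R => u t ord0 j) \_ `[a, b]
              \in Lfun (@lebesgue_measure R) +oo%E.

(* One-sided derivatives at the end-points are encoded as continuous extensions
   of the derivatives from the interior. *)
Definition C2_on {R : realType} {V : normedModType R} (a b : R) (f : R -> V)
    : Prop :=
  {within `[a, b], continuous f} /\
  exists v w : R -> V,
    [/\ {within `[a, b], continuous v}, {within `[a, b], continuous w} &
        forall t : R, t \in `]a, b[ ->
          is_derive t 1 f (v t) /\ is_derive t 1 v (w t)].

Definition sym_bilinear {R : realType} {V W : lmodType R} (B : V -> V -> W)
    : Prop :=
  (forall x y, B x y = B y x) /\ (forall y, linear (B^~ y)).

Definition lin_subspace {R : realType} {V : lmodType R} (E S : set V) : Prop :=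
  [/\ S `<=` E, S 0 & forall (c : R) x y, S x -> S y -> S (c *: x + y)].

Definition finite_codim {R : realType} {V : lmodType R} (E S : set V) : Prop :=
  lin_subspace E S /\
  exists (d : nat) (w : 'I_d -> V), (forall i, E (w i)) /\
    forall x, E x -> exists c : 'I_d -> R, S (x - \sum_i c i *: w i).

(* For a control that is merely measurable this says that g is an absolutely
   continuous curve a.e. tangent to the distribution, v being the coordinates
   of its velocity in the orthonormal frame X. *)
Definition trajectory {R : realType} {n k : nat}
    (X : 'I_k -> 'rV[R]_n -> 'rV[R]_n) (a b : R) (v : R -> 'rV[R]_k)
    (g : R -> 'rV[R]_n) : Prop :=
  abs_continuous a b g /\
  ae_on a b (fun t => is_derive t 1 g (\sum_i v t ord0 i *: X i (g t))).

Definition energy {R : realType} {k : nat} (a b : R) (v : R -> 'rV[R]_k)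
    : \bar R :=
  ((2^-1)%:E *
   \int[@lebesgue_measure R]_(t in `[a, b]) (\sum_i (v t ord0 i) ^+ 2)%:E)%E.

Definition minimizing {R : realType} {n k : nat}
    (X : 'I_k -> 'rV[R]_n -> 'rV[R]_n) (a b : R) (u : R -> 'rV[R]_k)
    (q : R -> 'rV[R]_n) : Prop :=
  forall (v : R -> 'rV[R]_k) (g : R -> 'rV[R]_n),
    (forall j, measurable_fun (`[a, b] : set (measurableTypeR R))
                 (fun t => v t ord0 j)) ->
    trajectory X a b v g -> g a = q a -> g b = q b ->
    (energy a b u <= energy a b v)%E.

(* The extended end-point map End^{[a, t]}[u] with initial point q0; it takes
   a default value when the trajectory does not exist up to time t. *)
Definition End {R : realType} {n k : nat} (X : 'I_k -> 'rV[R]_n -> 'rV[R]_n)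
    (a : R) (q0 : 'rV[R]_n) (t : R) (u : R -> 'rV[R]_k) : 'rV[R]_n * R :=
  (get [set x | exists g, [/\ trajectory X a t u g, g a = q0 & g t = x]],
   fine (energy a t u)).

Definition End_expansion {R : realType} {n k : nat}
    (X : 'I_k -> 'rV[R]_n -> 'rV[R]_n) (a : R) (q0 : 'rV[R]_n)
    (u : R -> 'rV[R]_k) (t : R) (du : R -> 'rV[R]_k) (w1 w2 : 'rV[R]_n * R)
    : Prop :=
  (fun s : R => End X a q0 t (fun r => u r + s *: du r) - End X a q0 t u
                - s *: w1 - s ^+ 2 *: w2)
    =o_ (0 : R) (fun s : R => s ^+ 2).

Definition jets {R : realType} {n k : nat} (X : 'I_k -> 'rV[R]_n -> 'rV[R]_n)
    (a : R) (q0 : 'rV[R]_n) (u : R -> 'rV[R]_k) (t : R) (du : R -> 'rV[R]_k)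
    : ('rV[R]_n * R) * ('rV[R]_n * R) :=
  get [set w | End_expansion X a q0 u t du w.1 w.2].

(* (b^(1), c^(1))(t, du), which is also D_u End^{[a, t]} applied to du. *)
Definition jet1 {R : realType} {n k : nat} (X : 'I_k -> 'rV[R]_n -> 'rV[R]_n)
    (a : R) (q0 : 'rV[R]_n) (u : R -> 'rV[R]_k) (t : R) (du : R -> 'rV[R]_k)
    : 'rV[R]_n * R :=
  (jets X a q0 u t du).1.

(* (b^(2), c^(2))(t, du) *)
Definition jet2 {R : realType} {n k : nat} (X : 'I_k -> 'rV[R]_n -> 'rV[R]_n)
    (a : R) (q0 : 'rV[R]_n) (u : R -> 'rV[R]_k) (t : R) (du : R -> 'rV[R]_k)
    : 'rV[R]_n * R :=
  (jets X a q0 u t du).2.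

Definition strictly_abnormal {R : realType} {n k : nat}
    (X : 'I_k -> 'rV[R]_n -> 'rV[R]_n) (a b : R) (u : R -> 'rV[R]_k)
    (q : R -> 'rV[R]_n) : Prop :=
  exists V : {vspace 'rV[R]_n}, V != fullv /\
    jet1 X a (q a) u b @` Linfty a b = [set w | w.1 \in V].

Definition pontryagin_covector {R : realType} {n k : nat}
    (X : 'I_k -> 'rV[R]_n -> 'rV[R]_n) (a b : R) (u : R -> 'rV[R]_k)
    (q : R -> 'rV[R]_n) (phi : R -> 'cV[R]_n) : Prop :=
  [/\ abs_continuous a b phi,
      forall t, t \in `[a, b] -> phi t != 0,
      forall i t, t \in `[a, b] -> pairing (X i (q t)) (phi t) = 0 &
      ae_on a b (fun t => derivable phi t 1 /\
        forall v : 'rV[R]_n,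
          pairing v ('D_1 phi t) +
          pairing (\sum_i u t ord0 i *: 'D_v (X i) (q t)) (phi t) = 0)].

(* The infimum is taken in the extended reals, so the equality also says that
   it is finite. *)
Definition value_family {R : realType} {n k : nat}
    (X : 'I_k -> 'rV[R]_n -> 'rV[R]_n) (a b : R) (u : R -> 'rV[R]_k)
    (q : R -> 'rV[R]_n) (phi : R -> 'cV[R]_n)
    (B : R -> 'rV[R]_n * R -> 'rV[R]_n * R -> R) : Prop :=
  let j1 := jet1 X a (q a) u in
  let b2 := fun t du => (jet2 X a (q a) u t du).1 in
  [/\ forall t, t \in `[a, b] -> @sym_bilinear R _ R^o (B t),
      forall t w, t \in `[a, b] -> (j1 t @` Linfty a b) w ->
        (- B t w w)%:E =
        ereal_inf [set (pairing (b2 t du) (phi t))%:E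
                  | du in [set du | Linfty a b du /\ j1 t du = w]],
      forall x y, bounded_variation a b (fun t => B t x y) &
      forall du, Linfty a b du ->
        {in `[a, b] &, {homo (fun t => pairing (b2 t du) (phi t)
                                       + B t (j1 t du) (j1 t du))
                        : s t / s <= t}}].

Definition two_normal {R : realType} {n : nat} (a b : R)
    (B : R -> 'rV[R]_n * R -> 'rV[R]_n * R -> R) : Prop :=
  forall t, t \in `]a, b] -> B t (0, 1) (0, 1) != 0.

Definition two_abnormal {R : realType} {n : nat} (a b : R)
    (B : R -> 'rV[R]_n * R -> 'rV[R]_n * R -> R) : Prop :=
  ~ two_normal a b B.

(* Invertibility of Phi1 a says that its columns form a basis of T*_{q(a)} M. *)
Definition adapted1 {R : realType} {n k : nat}
    (X : 'I_k -> 'rV[R]_n -> 'rV[R]_n) (a b : R) (u : R -> 'rV[R]_k)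
    (q : R -> 'rV[R]_n) (Phi1 : R -> 'M[R]_n) : Prop :=
  [/\ forall t, t \in `[a, b] -> Phi1 t \in unitmx,
      abs_continuous a b Phi1 &
      ae_on a b (fun t => derivable Phi1 t 1 /\
        forall v : 'rV[R]_n,
          v *m 'D_1 Phi1 t +
          \sum_i u t ord0 i *: ('D_v (X i) (q t) *m Phi1 t) = 0)].

Definition adapted2 {R : realType} {n k : nat}
    (X : 'I_k -> 'rV[R]_n -> 'rV[R]_n) (a b : R) (u : R -> 'rV[R]_k)
    (q : R -> 'rV[R]_n) (Phi1 : R -> 'M[R]_n)
    (Phi2 : R -> 'rV[R]_n -> 'rV[R]_n -> 'rV[R]_n) : Prop :=
  [/\ forall t, t \in `[a, b] -> sym_bilinear (Phi2 t),
      forall v w, Phi2 a v w = 0,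
      forall v w, abs_continuous a b (fun t => Phi2 t v w) &
      forall v, ae_on a b (fun t =>
        derivable (fun s => Phi2 s v v) t 1 /\
        'D_1 (fun s => Phi2 s v v) t +
        \sum_i u t ord0 i *:
          ('D_v (fun x => 'D_v (X i) x) (q t) *m Phi1 t
           + Phi2 t ('D_v (X i) (q t)) v *+ 2) = 0)].

Definition Y1 {R : realType} {n k : nat} (X : 'I_k -> 'rV[R]_n -> 'rV[R]_n)
    (q : R -> 'rV[R]_n) (Phi1 : R -> 'M[R]_n) (i : 'I_k) (t : R) : 'rV[R]_n :=
  X i (q t) *m Phi1 t.

Definition Y2 {R : realType} {n k : nat} (X : 'I_k -> 'rV[R]_n -> 'rV[R]_n)
    (q : R -> 'rV[R]_n) (Phi1 : R -> 'M[R]_n)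
    (Phi2 : R -> 'rV[R]_n -> 'rV[R]_n -> 'rV[R]_n) (i : 'I_k) (t : R)
    (v : 'rV[R]_n) : 'rV[R]_n :=
  let Av := v *m invmx (Phi1 t) in
  'D_Av (X i) (q t) *m Phi1 t + Phi2 t (X i (q t)) Av.

Definition q1 {R : realType} {n k : nat} (X : 'I_k -> 'rV[R]_n -> 'rV[R]_n)
    (u : R -> 'rV[R]_k) (q : R -> 'rV[R]_n) (Phi1 : R -> 'M[R]_n) (a tau : R)
    (du : R -> 'rV[R]_k) : R -> 'rV[R]_n * R :=
  get [set z : R -> 'rV[R]_n * R |
    [/\ abs_continuous a tau z, z a = 0 &
        ae_on a tau (fun t => is_derive t 1 z
          (\sum_i du t ord0 i *: Y1 X q Phi1 i t,
           \sum_i du t ord0 i * u t ord0 i))]].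

Definition OCP_cost {R : realType} {n k : nat}
    (X : 'I_k -> 'rV[R]_n -> 'rV[R]_n) (u : R -> 'rV[R]_k)
    (q : R -> 'rV[R]_n) (Phi1 : R -> 'M[R]_n)
    (Phi2 : R -> 'rV[R]_n -> 'rV[R]_n -> 'rV[R]_n) (psi0 : 'cV[R]_n)
    (a tau : R) (du : R -> 'rV[R]_k) : R :=
  \int[@lebesgue_measure R]_(t in `[a, tau])
    (\sum_i du t ord0 i *
      pairing (Y2 X q Phi1 Phi2 i t (q1 X u q Phi1 a tau du t).1) psi0).

Definition OCP_adm {R : realType} {n k : nat}
    (X : 'I_k -> 'rV[R]_n -> 'rV[R]_n) (u : R -> 'rV[R]_k)
    (q : R -> 'rV[R]_n) (Phi1 : R -> 'M[R]_n) (a tau : R) (v : 'rV[R]_n * R)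
    : set (R -> 'rV[R]_k) :=
  [set du | Linfty a tau du /\ q1 X u q Phi1 a tau du tau = v].

Definition OCP_value {R : realType} {n k : nat}
    (X : 'I_k -> 'rV[R]_n -> 'rV[R]_n) (u : R -> 'rV[R]_k)
    (q : R -> 'rV[R]_n) (Phi1 : R -> 'M[R]_n)
    (Phi2 : R -> 'rV[R]_n -> 'rV[R]_n -> 'rV[R]_n) (psi0 : 'cV[R]_n)
    (a tau : R) (v : 'rV[R]_n * R) : \bar R :=
  ereal_inf [set (OCP_cost X u q Phi1 Phi2 psi0 a tau du)%:E
            | du in OCP_adm X u q Phi1 a tau v].

Definition Sol0 {R : realType} {n k : nat}
    (X : 'I_k -> 'rV[R]_n -> 'rV[R]_n) (u : R -> 'rV[R]_k)
    (q : R -> 'rV[R]_n) (Phi1 : R -> 'M[R]_n)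
    (Phi2 : R -> 'rV[R]_n -> 'rV[R]_n -> 'rV[R]_n) (psi0 : 'cV[R]_n)
    (a tau : R) : set (R -> 'rV[R]_k) :=
  [set du | OCP_adm X u q Phi1 a tau 0 du /\
            (OCP_cost X u q Phi1 Phi2 psi0 a tau du)%:E =
            OCP_value X u q Phi1 Phi2 psi0 a tau 0].

(* Controls are functions rather than a.e.-classes; this does not change the
   codimension, since Sol0 is stable under modification on null sets. *)
Definition monti_condition {R : realType} {n k : nat}
    (X : 'I_k -> 'rV[R]_n -> 'rV[R]_n) (u : R -> 'rV[R]_k)
    (q : R -> 'rV[R]_n) (Phi1 : R -> 'M[R]_n)
    (Phi2 : R -> 'rV[R]_n -> 'rV[R]_n -> 'rV[R]_n) (psi0 : 'cV[R]_n)
    (a tau : R) : Prop :=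
  finite_codim (Linfty a tau) (Sol0 X u q Phi1 Phi2 psi0 a tau).

Definition division {R : realType} (a b : R) (N : nat) (tau : nat -> R)
    : Prop :=
  [/\ tau 0 = a, tau N = b & forall i, (i < N)%N -> tau i < tau i.+1].

Definition piece {R : realType} (N : nat) (tau : nat -> R) (a b : R) : Prop :=
  a < b /\ exists2 i, (i < N)%N & tau i < a /\ b < tau i.+1.

(* Main.v *)
Require Import Defs.
From HB Require Import structures.
From mathcomp Require Import all_boot all_order all_algebra.
From mathcomp Require Import all_classical all_reals all_analysis.
From mathcomp Require Import measurable_realfun ess_sup_inf ring lra.

Set Implicit Arguments.
Unset Strict Implicit.
Unset Printing Implicit Defensive.

Import Order.TTheory GRing.Theory Num.Theory.
Import numFieldNormedType.Exports.

Local Open Scope classical_set_scope.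
Local Open Scope ring_scope.

(* Write beta for the bilinear form with beta(v, v) = Q_{t0, t1}[v]. In adapted coordinates,
   extension by zero of a control v on [a, b] identifies (b1, c1)(b, v) with the end-point
   (q1, c1)(t1) of the characteristic problem, and <b2(b, v), phi(b)> with beta(v, v) when
   b1(b, v) = 0. Monti's condition says that beta is positive semidefinite on the kernel of
   (q1, c1)(t1) and that its null vectors there have finite codimension. Let C be the controls
   which are continuous on [a, b] and vanish outside. If c1 is a combination of the components
   of q1 on C, then u_i = <Y1_i, p> a.e. on [a, b]. Otherwise some e in C has
   (q1, c1)(e) = (0, 1); finiteness of the infimum in (1) and a finite Gram-Schmidt process make
   e orthogonal, for beta, to the kernel of (q1, c1) in C. Then beta(e, .) + beta(., e) is a
   combination lam c1 + <q1, p> on C. It is also the integral of v_i H_i for a continuous H (an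
   adjoint state), so H_i = lam u_i + <Y1_i, p> a.e. on [a, b]. If lam = 0 then e is optimal
   with value 0, and a_2(b) = 0. If lam <> 0 then u agrees a.e. with a continuous control; this
   makes q, Phi1, Phi2, H of class C^1, hence u is C^1 and q is C^2. *)

(** * Linear algebra *)

Section linear_algebra.
Context {R : realType} {V : lmodType R}.
Implicit Types (E K : set V) (f T : V -> R) (x y w : V).

(** The controls in C serve two opposite needs. They are rich enough for an identity between linear
    functionals to become a pointwise identity almost everywhere, and regular enough for H to gain a
    continuous derivative: the derivative of the adjoint state contains e itself, so an e that is
    only essentially bounded would in general leave H merely Lipschitz. Finite codimension keeps e
    in C, since the correction of e is a finite linear combination of elements of C and no
    completion is taken. The curves are only absolutely continuous and their equations hold almost
    everywhere; every comparison of such curves rests on one monotonicity theorem. The jets and the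
    end-point map are specified by choice, so their values are pinned down by existence and
    uniqueness for the perturbed system, with a remainder of order s^3. If lam = 0, the pointwise
    identity for H makes e orthogonal to every bounded competitor with end-point (0, 1), not only to
    continuous ones. The difference of such a competitor and e lies in the kernel, where the cost is
    nonnegative; this is why e is optimal. *)

Definition linear_on E f := forall (c : R) x y, E x -> E y -> f (c *: x + y) = c * f x + f y.

(** Subsets, and linearity relative to a subset, take the place of subspaces as types: the
    functionals in play are integrals, and their additivity is established only on essentially
    bounded controls. *)
Definition lin_closed E := E 0 /\ forall (c : R) x y, E x -> E y -> E (c *: x + y).

Lemma lin_closedZ E (c : R) x : lin_closed E -> E x -> E (c *: x).
Proof. by move=> [E0 EL] Ex; rewrite -[c *: x]addr0; exact: EL. Qed.

Lemma lin_closedB E (c : R) x y : lin_closed E -> E x -> E y -> E (x - c *: y).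
Proof. by move=> [E0 EL] Ex Ey; rewrite addrC -scaleNr; exact: EL. Qed.

Lemma linear_on0 E f : lin_closed E -> linear_on E f -> f 0 = 0.
Proof.
by move=> [E0 _] lf; have := lf (-1) 0 0 E0 E0; rewrite scaler0 addr0 mulN1r addNr.
Qed.

Lemma linear_onZ E f (c : R) x : lin_closed E -> linear_on E f -> E x -> f (c *: x) = c * f x.
Proof.
move=> cE lf Ex; rewrite -[c *: x]addr0 lf//; last by case: cE.
by rewrite (linear_on0 cE lf) addr0.
Qed.

Lemma linear_onB E f (c : R) x y : linear_on E f -> E x -> E y ->
  f (x - c *: y) = f x - c * f y.
Proof. by move=> lf Ex Ey; rewrite addrC -scaleNr lf// mulNr addrC. Qed.

Lemma linear_on_sum E f (I : Type) (s : seq I) (c : I -> R) (w : I -> V) :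
  lin_closed E -> linear_on E f -> (forall i, E (w i)) ->
  E (\sum_(i <- s) c i *: w i) /\
  f (\sum_(i <- s) c i *: w i) = \sum_(i <- s) c i * f (w i).
Proof.
move=> cE lf Ew; elim: s => [|i s [IH1 IH2]].
  by rewrite !big_nil (linear_on0 cE lf); case: cE.
by rewrite !big_cons lf// IH2; split=> //; case: cE => _; exact.
Qed.

Lemma sub_linear_on E K f : K `<=` E -> linear_on E f -> linear_on K f.
Proof. by move=> KE lf c x y Kx Ky; apply: lf; exact: KE. Qed.

Lemma lin_closed_ker E f : lin_closed E -> linear_on E f ->
  lin_closed (E `&` [set x | f x = 0]).
Proof.
move=> cE lf; have [E0 EL] := cE; split; first by split=> //=; exact: linear_on0 cE lf.
by move=> c x y [Ex /= fx] [Ey /= fy]; split; [exact: EL|rewrite /= lf// fx fy mulr0 addr0].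
Qed.

Lemma kernel_combination m E (f : 'I_m -> V -> R) T : lin_closed E ->
  (forall i, linear_on E (f i)) -> linear_on E T ->
  (forall x, E x -> (forall i, f i x = 0) -> T x = 0) ->
  exists p : 'I_m -> R, forall x, E x -> T x = \sum_i p i * f i x.
Proof.
elim: m => [|m IHm] in E f T *; move=> cE lf lT kerT.
  by exists (fun _ => 0) => x Ex; rewrite big_ord0; apply: kerT => // -[].
pose E' := E `&` [set x | f ord0 x = 0].
have E'E : E' `<=` E by move=> x [].
have [p pE] : exists p : 'I_m -> R, forall x, E' x -> T x = \sum_i p i * f (lift ord0 i) x.
  apply: IHm.
  - exact: lin_closed_ker.
  - by move=> i; exact: sub_linear_on (lf _).
  - exact: sub_linear_on lT.
  move=> x [Ex fx] h; apply: kerT => // i; case: (unliftP ord0 i) => [j ->|->//].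
  exact: h.
have [[z [Ez fz]]|h] := pselect (exists z, E z /\ f ord0 z != 0); last first.
  exists (fun i => if unlift ord0 i is Some j then p j else 0) => x Ex.
  rewrite big_ord_recl unlift_none mul0r add0r pE.
    by apply: eq_bigr => i _; rewrite liftK.
  split=> //=; apply/eqP/negP => /negP fx; apply: h; by exists x.
(* The coefficient for which both sides agree at [z]; they already agree on the kernel of [f ord0],
   and [z] spans a complement. *)
pose s := (T z - \sum_i p i * f (lift ord0 i) z) / f ord0 z.
exists (fun i => if unlift ord0 i is Some j then p j else s) => x Ex.
pose c := f ord0 x / f ord0 z.
have E'x : E' (x - c *: z).
  by split; [exact: lin_closedB|rewrite /= (linear_onB c (lf _)) // /c divfK// subrr].
have := pE _ E'x; rewrite (linear_onB c lT)// => /eqP; rewrite subr_eq => /eqP ->.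
rewrite big_ord_recl unlift_none.
under [X in _ = _ + X]eq_bigr do rewrite liftK.
have -> : \sum_i p i * f (lift ord0 i) (x - c *: z) =
    \sum_i p i * f (lift ord0 i) x - c * \sum_i p i * f (lift ord0 i) z.
  rewrite mulr_sumr -sumrB; apply: eq_bigr => i _.
  by rewrite (linear_onB c (lf _))// mulrBr mulrCA.
rewrite /s /c.
move: (\sum_i _) (\sum_i _) => A B; by field.
Qed.

(** * Orthogonal correction for a semidefinite form with few independent non-null directions *)

Section semidefinite.
Context (E : set V) (cE : lin_closed E) (Q : V -> V -> R).
Context (symQ : forall x y, Q x y = Q y x) (linQ : forall y, E y -> linear_on E (Q^~ y)).

Let linQr y : E y -> linear_on E (Q y).
Proof. by move=> Ey c x x' Ex Ex'; rewrite !(symQ y); exact: linQ. Qed.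

(* Gram-Schmidt: each step splits off a vector of positive length, and the hypothesis on
   d.+1 vectors bounds the number of steps. *)
Lemma orthogonal_correction d K e : K `<=` E -> lin_closed K -> E e ->
  (forall x, K x -> 0 <= Q x x) ->
  (forall x, K x -> Q x x = 0 -> Q e x = 0) ->
  (forall x : 'I_d.+1 -> V, (forall i, K (x i)) ->
    exists c : 'I_d.+1 -> R, (exists i, c i != 0) /\
      let s := \sum_i c i *: x i in Q s s = 0) ->
  exists2 w, K w & forall x, K x -> Q (e - w) x = 0.
Proof.
elim: d => [|d IHd] in K *; move=> KE cK Ee Q0 eQ dep.
  exists 0; first by case: cK.
  move=> x Kx; rewrite subr0; apply: eQ => //.
  (* For d = 0 the hypothesis says that some nonzero multiple of [x] is null, so [x] itself is
     null. *)
  have [c [[i ci]]] := dep (fun _ => x) (fun _ => Kx).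
  rewrite big_ord1 /= (ord1 i) in ci *.
  rewrite (linear_onZ _ cE (linQ _)) ?(linear_onZ _ cE (linQr _)); last 4 first.
  - exact: KE.
  - exact: KE.
  - by apply: lin_closedZ => //; exact: KE.
  - exact: KE.
  by move=> /eqP; rewrite !mulf_eq0 (negbTE ci)/= => /eqP.
have [[x [Kx eqx]]|h] := pselect (exists x, K x /\ Q e x != 0); last first.
  exists 0; first by case: cK.
  move=> x Kx; rewrite subr0; apply/eqP/negP => /negP ex; apply: h; by exists x.
have Qxx : Q x x != 0 by apply: contra_neq eqx => /eQ; exact.
have Ex := KE x Kx.
pose K' := K `&` [set y | Q y x = 0].
have K'K : K' `<=` K by move=> y [].
have cK' : lin_closed K' by apply: lin_closed_ker => //; exact: sub_linear_on (linQ Ex).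
have [w [Kw wx] wP] : exists2 w, K' w & forall y, K' y -> Q (e - w) y = 0.
  apply: IHd => //.
  - by move=> y /K'K/KE.
  - by move=> y /K'K; exact: Q0.
  - by move=> y /K'K; exact: eQ.
  (* The vector [x] is put in front of the family [y]. As [x] has positive length and is orthogonal
     to [K'], its coefficient in a null combination must vanish, and a null combination of [y]
     remains. *)
  move=> y K'y; pose x' i := if unlift ord0 i is Some j then y j else x.
  have Kx' i : K (x' i) by rewrite /x'; case: unliftP => [j _|_//]; exact: K'K.
  have [c [[i ci] /=]] := dep x' Kx'.
  have -> : \sum_i c i *: x' i = c ord0 *: x + \sum_i c (lift ord0 i) *: y i.
    rewrite big_ord_recl /x' unlift_none; congr (_ + _).
    by apply: eq_bigr => j _; rewrite liftK.
  have [K's _] := linear_on_sum (index_enum _) (fun i => c (lift ord0 i)) cK'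
    (sub_linear_on (fun z (hz : K' z) => KE z (K'K z hz)) (linQ Ex)) K'y.
  set s := \sum_i _ in K's *.
  have [Ks /= sx] := K's; have Es := KE s Ks.
  have Ecs : E (c ord0 *: x + s) by case: cE => _; exact.
  rewrite (linQ Ecs (c ord0) Ex Es) (linQr Ex (c ord0) Ex Es) (linQr Es (c ord0) Ex Es).
  rewrite (symQ x s) sx mulr0 add0r addr0 mulrA => h.
  have h0 : c ord0 = 0.
    apply/eqP/negP => /negP c0; have : 0 < c ord0 * c ord0 * Q x x + Q s s.
      apply: ltr_wpDr; first exact: Q0.
      by rewrite mulr_gt0 ?lt_def ?Qxx ?Q0// mulf_neq0//= -expr2 sqr_ge0.
    by rewrite h ltxx.
  exists (fun i => c (lift ord0 i)); split; last by move: h; rewrite h0 !mul0r add0r.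
  case: (unliftP ord0 i) ci => [j ->|->]; last by rewrite h0 eqxx.
  by exists j.
(* The Fourier coefficient of [e] along [x]; the vector [w] contributes nothing to it, being
   orthogonal to [x]. *)
pose m := Q e x / Q x x.
have Ew := KE w Kw.
exists (m *: x + w); first by case: cK => _; exact.
have Eew : E (e - w) by rewrite -[w]scale1r; exact: lin_closedB.
have eE y : E y -> Q (e - (m *: x + w)) y = Q (e - w) y - m * Q x y.
  by move=> Ey; rewrite -(linear_onB m (linQ Ey) Eew Ex) opprD addrCA addrC.
have ewx : Q (e - w) x = Q e x.
  by have := linear_onB 1 (linQ Ex) Ee Ew; rewrite scale1r mul1r wx subr0.
move=> y Ky; have Ey := KE y Ky.
pose r := Q y x / Q x x.
have K'y : K' (y - r *: x).
  split; first exact: lin_closedB.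
  by rewrite /= (linear_onB r (linQ Ex))// /r divfK// subrr.
have := wP _ K'y; rewrite (linear_onB r (linQr Eew))// ewx => /eqP.
rewrite subr_eq0 => /eqP h.
by rewrite eE// h /m /r (symQ x y); field.
Qed.

End semidefinite.

(** Modulo [S], any d.+1 vectors are combinations of the d vectors [w]. Their coefficient matrix has
    more rows than columns, and a nonzero row of its left kernel gives [c]. *)
Lemma finite_codim_dependent E S : finite_codim E S ->
  exists d, forall x : 'I_d.+1 -> V, (forall i, E (x i)) ->
    exists c : 'I_d.+1 -> R, (exists i, c i != 0) /\ S (\sum_i c i *: x i).
Proof.
move=> [[_ S0 SL] [d [w [_ wP]]]]; exists d => x Ex.
pose A := \matrix_(i < d.+1, j < d) sval (cid (wP (x i) (Ex i))) j.
have : kermx A != 0.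
  rewrite kermx_eq0 /row_free; apply/negP => /eqP rA.
  by have := rank_leq_col A; rewrite rA ltnn.
move=> /matrix0Pn [i0 [j0 cj]].
pose c j := kermx A i0 j; exists c; split; first by exists j0.
have cA j : \sum_i c i * A i j = 0.
  have := congr1 (fun M : 'M[R]_(_, _) => M i0 j) (mulmx_ker A); rewrite !mxE => h.
  by rewrite -[RHS]h; apply: eq_bigr => i _.
have -> : \sum_i c i *: x i = \sum_i c i *: (x i - \sum_j A i j *: w j).
  under [RHS]eq_bigr do rewrite scalerBr scaler_sumr.
  rewrite sumrB exchange_big/= [X in _ - X]big1 ?subr0// => j _.
  under eq_bigr do rewrite scalerA.
  by rewrite -scaler_suml cA scale0r.
elim: (index_enum _) => [|i s IHs]; first by rewrite big_nil.
rewrite big_cons; apply: SL => //.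
have := svalP (cid (wP (x i) (Ex i))).
by under [X in _ -> S (_ - X)]eq_bigr do rewrite mxE.
Qed.

End linear_algebra.

(** * Absolutely continuous curves and their almost everywhere derivatives *)

(** Let c be the supremum of the points reached from a. A reached point just left of c, glued to a
    local interval around c, shows that c and all points slightly beyond it are reached, so c = b.
    Local intervals have to contain the point t, which is all that a derivative at t can control. *)
Lemma itv_induction {R : realType} (P : R -> R -> Prop) (a b : R) : a <= b ->
  (forall x y z, x <= y -> y <= z -> P x y -> P y z -> P x z) ->
  (forall t, a <= t <= b -> exists2 d : R, 0 < d &
     forall x y, a <= x -> x <= t -> t <= y -> y <= b ->
       t - d < x -> y < t + d -> P x y) ->
  P a b.
Proof.
move=> ab Ptr Ploc.
pose S := [set t | a <= t <= b /\ P a t].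
have Pxx t : a <= t <= b -> P t t.
  move=> tab; have [d d0] := Ploc _ tab.
  by case/andP: tab => at_ tb; apply => //; lra.
have Sa : S a by split; [rewrite lexx|apply: Pxx; rewrite lexx].
have hS : has_sup S.
  by split; [exists a|exists b => t [/andP[_]]].
pose c := sup S.
have ac : a <= c by apply: ub_le_sup => //; case: hS.
have cb : c <= b by apply: ge_sup; [exists a|move=> t [/andP[_]]].
have [d d0 dP] := Ploc c (introT andP (conj ac cb)).
have [t [/andP[at_ tb] Pat] ct] := sup_adherent d0 hS.
have tc : t <= c by apply: ub_le_sup; [case: hS|split; rewrite ?at_ ?tb].
have key y : c <= y -> y <= b -> y < c + d -> P a y.
  move=> cy yb ycd; apply: (Ptr _ t) => //; first exact: le_trans tc cy.
  exact: dP.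
have [cb'|bc] := ltP c b; last first.
  have -> : b = c by apply/eqP; rewrite eq_le bc cb.
  by apply: key => //; lra.
pose y := Num.min b (c + d / 2).
have cy : c < y by rewrite lt_min cb'/=; lra.
have yb : y <= b by rewrite ge_min lexx.
have : y <= c.
  apply: ub_le_sup; first by case: hS.
  split; first by rewrite yb (le_trans ac (ltW cy)).
  apply: key => //; first exact: ltW.
  by rewrite gt_min; apply/orP; right; lra.
by rewrite leNgt cy.
Qed.

Section ac_monotone.
Context {R : realType}.
Notation mu := (@lebesgue_measure R).

(** Listing the intervals from left to right makes two chains that meet at a point concatenate, as
    the transitivity in [itv_induction] demands. *)
Let chain (s : seq (R * R)) :=
  pairwise (fun p p' => p.2 <= p'.1) s.

Let chain_in (U : set R) (x y : R) (s : seq (R * R)) :=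
  chain s /\ (forall p, p \in s ->
    [/\ x <= p.1, p.1 <= p.2, p.2 <= y & `]p.1, p.2[%classic `<=` U]).

Let chain_cat U x y z s s' : x <= y -> y <= z ->
  chain_in U x y s -> chain_in U y z s' -> chain_in U x z (s ++ s').
Proof.
move=> xy yz [cs sP] [cs' s'P]; split.
  rewrite /chain pairwise_cat; apply/and3P; split => //.
  apply/allrelP => p p' ps p's'; have [_ _ py _] := sP _ ps.
  by have [yp' _ _ _] := s'P _ p's'; exact: le_trans yp'.
move=> p; rewrite mem_cat => /orP[/sP|/s'P] [h1 h2 h3 h4]; split => //.
- exact: le_trans yz.
- exact: le_trans h1.
Qed.

Let nthi (s : seq (R * R)) (i : 'I_(size s)) := nth (0, 0) s i.

Let chain_triv U x y s : chain_in U x y s ->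
  trivIset [set: 'I_(size s)]
    (fun i => `](nthi i).1, (nthi i).2[%classic).
Proof.
move=> [/pairwiseP-/(_ (0, 0)) cs _].
have lt_triv (i j : 'I_(size s)) : (i < j)%N ->
    `](nthi i).1, (nthi i).2[%classic `&` `](nthi j).1, (nthi j).2[%classic = set0.
  move=> ij; apply/seteqP; split => // t /=; rewrite !in_itv/= => -[/andP[_ h1] /andP[h2 _]].
  have /= h3 := cs i j (ltn_ord i) (ltn_ord j) ij.
  by have := lt_trans (lt_le_trans h1 h3) h2; rewrite ltxx.
apply/trivIsetP => i j _ _ ij; have [lij|lji|eij] := ltngtP i j.
- exact: lt_triv.
- by rewrite setIC; exact: lt_triv.
- by case/eqP: ij; apply: val_inj.
Qed.

Let chain_measure U x y s (d : R) : measurable U -> (mu U < d%:E)%E ->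
  chain_in U x y s -> \sum_(i < size s) ((nthi i).2 - (nthi i).1) < d.
Proof.
move=> mU Ud cs; rewrite -lte_fin; apply: le_lt_trans Ud.
have tr := chain_triv cs.
have pin (i : 'I_(size s)) := cs.2 (nthi i) (mem_nth _ (ltn_ord i)).
rewrite -sumEFin.
under eq_bigr do rewrite EFinB.
pose F := (fun i : 'I_(size s) => `](nthi i).1, (nthi i).2[%classic : set R).
rewrite (eq_bigr (mu \o F)); last first.
  move=> i _ /=; rewrite lebesgue_measure_itv/= lte_fin.
  case: ltP => // h; have [_ h1 _ _] := pin i.
  have -> : (nthi i).1 = (nthi i).2 by apply/eqP; rewrite eq_le h h1.
  by rewrite -EFinB subrr.
have mF i : measurable (F i) by exact: measurable_itv.
rewrite -(measure_bigsetU_ord mu predT mF tr).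
apply: le_measure; rewrite ?inE//; first by apply: bigsetU_measurable => i _; exact: mF.
apply: (big_ind (fun B => B `<=` U)) => // [B B' BU B'U t [/BU|/B'U]//|i _].
by have [_ _ _] := pin i.
Qed.

Lemma abs_continuousS {V : normedModType R} (a b c d : R) (f : R -> V) :
  a <= c -> d <= b -> abs_continuous a b f -> abs_continuous c d f.
Proof.
move=> ac db acf e e0; have [r r0 rP] := acf e e0; exists r => // m x y xy.
move=> tr sd; apply: rP tr sd => i; have [h1 h2 h3] := xy i; split => //.
- exact: le_trans h1.
- exact: le_trans db.
Qed.

Lemma ae_onS (a b c d : R) (P : R -> Prop) :
  a <= c -> d <= b -> ae_on a b P -> ae_on c d P.
Proof.
rewrite /ae_on => ac db; apply: filterS; first exact: (ae_filter_ringOfSetsType mu).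
move=> t Pt tcd; apply: Pt.
move: tcd; rewrite !in_itv/= => /andP[h1 h2]; apply/andP; split.
- exact: le_lt_trans h1.
- exact: lt_le_trans db.
Qed.

(** Cutting at t turns both halves of the increment into difference quotients based at t. This is
    why x and y lie on opposite sides of t. *)
Let straddle (f : R -> R) (t l e : R) : is_derive t 1 f l -> 0 <= l -> 0 < e ->
  exists2 d, 0 < d & forall x y, x <= t -> t <= y -> t - d < x -> y < t + d ->
    - (e * (y - x)) <= f y - f x.
Proof.
move=> [df fl] l0 e0.
have := df; rewrite /derivable => /cvgrPdist_lt; rewrite -/(derive f t 1) fl.
move=> /(_ e e0) -[d /= d0 dP].
exists d => // x y xt ty tdx ytd.
have H h : `|h| < d -> h != 0 -> - e < h^-1 * (f (h + t) - f t).
  move=> hd h0; have := dP h; rewrite /ball_ /= sub0r normrN => /(_ hd h0).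
  rewrite /GRing.scale /= mulr1 ltr_distl => /andP[_ h1].
  by rewrite -(ltrD2r e) addNr; exact: le_lt_trans h1.
have Hy : - (e * (y - t)) <= f y - f t.
  have [<-|yt] := eqVneq t y; first by rewrite !subrr mulr0 oppr0.
  have yt' : 0 < y - t by rewrite subr_gt0 lt_neqAle yt ty.
  have := H (y - t); rewrite gtr0_norm// subrK => /(_ ltac:(lra) ltac:(lra)).
  rewrite mulrC ltr_pdivlMr// mulNr; exact: ltW.
have Hx : - (e * (t - x)) <= f t - f x.
  have [->|xt'] := eqVneq x t; first by rewrite !subrr mulr0 oppr0.
  have yt' : x - t < 0 by rewrite subr_lt0 lt_neqAle xt' xt.
  have := H (x - t); rewrite ltr0_norm// subrK => /(_ ltac:(lra) ltac:(lra)).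
  rewrite mulrC ltr_ndivlMr// mulNr; lra.
lra.
Qed.

(* Real induction: off the exceptional null set the sign of the derivative controls f locally,
   while the points of that set are passed inside an open cover of small measure, where absolute
   continuity bounds the total variation of f. *)
Lemma ac_ae_homo (a b : R) (f : R -> R) : a <= b -> abs_continuous a b f ->
  ae_on a b (fun t => exists2 l, is_derive t 1 f l & 0 <= l) -> f a <= f b.
Proof.
move=> ab acf [A [mA A0 subA]].
suff H (e : R) : 0 < e -> - (e * (b - a)) - e <= f b - f a.
  rewrite -subr_ge0; apply/ler_addgt0Pl => e e0.
  have ba : 0 < b - a + 1 by lra.
  have := H (e / (b - a + 1)); rewrite divr_gt0// => /(_ isT).
  have -> : - (e / (b - a + 1) * (b - a)) - e / (b - a + 1) = - e.
    by field; lra.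
  lra.
move=> e0; have [d d0 dP] := acf e e0.
(* The derivative is known on the open interval only, so the end-points are treated as
   exceptional. *)
pose A' := A `|` [set a] `|` [set b].
have mA' : measurable A' by apply: measurableU => //; exact: measurableU.
have A'0 : mu A' = 0%E.
  rewrite !measureU0//;
    [exact: lebesgue_measure_set1|exact: measurableU|exact: lebesgue_measure_set1].
have [U [oU A'U]] := lebesgue_regularity_outer mA'
    (eq_ind_r (fun x => (x < +oo)%E) (ltry 0) A'0) d0.
have mU : measurable U by exact: open_measurable.
move=> UA'd; have Ud : (mu U < d%:E)%E.
  apply: le_lt_trans UA'd; rewrite -[in X in (X <= _)%E](setDUK A'U).
  have mUA' := measurableD mU mA'.
  have add0 (x y : \bar R) : (x = 0 -> x + y = y)%E by move=> ->; rewrite add0e.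
  by have := measureU2 mu mA' mUA'; rewrite (add0 _ _ A'0).
(* The lower bound carries two errors: the slope error e times the length, and the variation of [f]
   along a chain inside [U]. The second is added up only at the end, where absolute continuity makes
   it smaller than e. *)
pose P x y := exists2 s, chain_in U x y s &
  - (e * (y - x)) - \sum_(i < size s) `|f (nthi i).2 - f (nthi i).1| <= f y - f x.
have [s cs] : P a b; last first.
  apply: le_trans; rewrite lerD2l lerN2; apply/ltW/dP.
  - move=> i; have [h1 h2 h3 _] := cs.2 (nthi i) (mem_nth _ (ltn_ord i)).
    by split.
  - exact: chain_triv cs.
  - exact: chain_measure cs.
apply: itv_induction => //.
- move=> x y z xy yz [s cs sP] [s' cs' s'P]; exists (s ++ s'); first exact: (chain_cat xy yz).
  have sumE (r : seq (R * R)) : \sum_(i < size r) `|f (nthi i).2 - f (nthi i).1|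
      = \sum_(p <- r) `|f p.2 - f p.1|.
    by rewrite (big_nth (0, 0)) big_mkord.
  rewrite !sumE in sP s'P *; rewrite big_cat/=; lra.
- move=> t tab; have [A't|nA't] := pselect (A' t).
    have /open_nbhs_nbhs/nbhs_ballP[r/= r0 rU] : open_nbhs t U by split=> //; exact: A'U.
    exists r => // x y ax xt ty yb trx ytr; exists [:: (x, y)]; last first.
      rewrite big_ord1/= /nthi/=.
      have : 0 <= e * (y - x) by rewrite mulr_ge0 ?(ltW e0)//; lra.
      have := ler_norm (- (f y - f x)); rewrite normrN; lra.
    split => // p; rewrite inE => /eqP -> /=; split => //; first exact: le_trans ty.
    move=> z/=; rewrite in_itv/= => /andP[xz zy]; apply: rU.
    by rewrite /ball/= ltr_distl; apply/andP; split; lra.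
  have tab' : t \in `]a, b[.
    rewrite in_itv/= !lt_neqAle; case/andP: tab => -> ->; rewrite !andbT.
    by apply/andP; split; apply/negP => /eqP tE; apply: nA't; [left; right|right].
  have [l fl l0] : exists2 l, is_derive t 1 f l & 0 <= l.
    by apply: contrapT => h; apply: nA't; left; left; apply: subA => /= /(_ tab').
  have [r r0 rP] := straddle fl l0 e0; exists r => // x y ax xt ty yb trx ytr.
  exists [::]; last by rewrite big_ord0 subr0; exact: rP.
  by split.
Qed.

End ac_monotone.

Section ae_on_theory.
Context {R : realType}.
Implicit Types (a b : R) (P Q S : R -> Prop).

Lemma ae_onT a b P : (forall t, a < t < b -> P t) -> ae_on a b P.
Proof.
by move=> h; rewrite /ae_on; apply: aeW => t; rewrite in_itv/=; exact: h.
Qed.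

Lemma ae_on1 a b P Q : (forall t, a < t < b -> P t -> Q t) ->
  ae_on a b P -> ae_on a b Q.
Proof.
rewrite /ae_on => h; apply: filterS; first exact: (ae_filter_ringOfSetsType lebesgue_measure).
by move=> t Pt tab; apply: h (Pt tab); rewrite in_itv/= in tab.
Qed.

Lemma ae_on2 a b P Q S : (forall t, a < t < b -> P t -> Q t -> S t) ->
  ae_on a b P -> ae_on a b Q -> ae_on a b S.
Proof.
rewrite /ae_on => h; apply: filterS2; first exact: (ae_filter_ringOfSetsType lebesgue_measure).
by move=> t Pt Qt tab; apply: h (Pt tab) (Qt tab); rewrite in_itv/= in tab.
Qed.

Lemma ae_on_forall (I : finType) a b (P : I -> R -> Prop) :
  (forall i, ae_on a b (P i)) -> ae_on a b (fun t => forall i, P i t).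
Proof.
move=> h; suff H (s : seq I) : ae_on a b (fun t => forall i, i \in s -> P i t).
  by apply: ae_on1 (H (enum I)) => t _ Pt i; apply: Pt; rewrite mem_enum.
elim: s => [|i s IHs]; first exact: ae_onT.
apply: ae_on2 (h i) IHs => t _ Pit Pst j; rewrite inE => /orP[/eqP->//|].
exact: Pst.
Qed.

End ae_on_theory.

(** * Derivatives of vector-valued curves by components *)

Section is_derive_components.
Context {R : realType}.

(* Rewriting with [mxE] at a directional derivative makes the unifier unfold
   the limit, hence these specialized forms. *)
Lemma addmxE (m n : nat) (A B : 'M[R]_(m, n)) i j : (A + B) i j = A i j + B i j.
Proof. by rewrite mxE. Qed.

Lemma oppmxE (m n : nat) (A : 'M[R]_(m, n)) i j : (- A) i j = - A i j.
Proof. by rewrite mxE. Qed.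

Lemma scalemxE (m n : nat) (c : R) (A : 'M[R]_(m, n)) i j : (c *: A) i j = c * A i j.
Proof. by rewrite mxE. Qed.

Lemma is_derive_mxP {V : normedModType R} (m n : nat) (f : V -> 'M[R]_(m, n))
    (x v : V) (d : 'M[R]_(m, n)) :
  is_derive x v f d <-> forall i j, is_derive x v (fun y => f y i j) (d i j).
Proof.
split.
  move=> [df fd] i j; split; first exact: (derivable_mxP f x v).1.
  by rewrite -fd derive_mx// mxE.
move=> h; have df : derivable f x v.
  by apply/derivable_mxP => i j; have [] := h i j.
split=> //; rewrite derive_mx//; apply/matrixP => i j; rewrite mxE.
by have [] := h i j.
Qed.

Lemma is_derive_fst {U V W : normedModType R} (f : U -> V * W) (x v : U) d :
  is_derive x v f d -> is_derive x v (fun y => (f y).1) d.1.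
Proof.
move=> [df fd].
have : (fun h => (h^-1 *: ((f \o shift x) (h *: v) - f x)).1) @ 0^' --> d.1.
  apply: (@cvg_comp _ _ _ (fun h => h^-1 *: ((f \o shift x) (h *: v) - f x)) fst);
    last exact: (@cvg_fst _ _ (nbhs d.1) (nbhs d.2)).
  by rewrite -fd.
move=> cvf; split; first by apply/cvg_ex; exists d.1.
by apply/cvg_lim.
Qed.

Lemma is_derive_snd {U V W : normedModType R} (f : U -> V * W) (x v : U) d :
  is_derive x v f d -> is_derive x v (fun y => (f y).2) d.2.
Proof.
move=> [df fd].
have : (fun h => (h^-1 *: ((f \o shift x) (h *: v) - f x)).2) @ 0^' --> d.2.
  apply: (@cvg_comp _ _ _ (fun h => h^-1 *: ((f \o shift x) (h *: v) - f x)) snd);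
    last exact: (@cvg_snd _ _ (nbhs d.1) (nbhs d.2)).
  by rewrite -fd.
move=> cvf; split; first by apply/cvg_ex; exists d.2.
by apply/cvg_lim.
Qed.

Lemma is_derive_pair {U V W : normedModType R} (f : U -> V) (g : U -> W)
    (x v : U) d e :
  is_derive x v f d -> is_derive x v g e ->
  is_derive x v (fun y => (f y, g y)) (d, e).
Proof.
move=> [df fd] [dg gd].
have : (fun h => h^-1 *: (((fun y => (f y, g y)) \o shift x) (h *: v) - (f x, g x)))
    @ 0^' --> (d, e).
  have := cvg_pair df dg; rewrite -fd -gd; exact.
move=> cvf; split; first by apply/cvg_ex; exists (d, e).
exact/cvg_lim.
Qed.

Lemma is_derive1D {V : normedModType R} (f g : R -> V) t d e :
  is_derive t (1 : R) f d -> is_derive t (1 : R) g e ->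
  is_derive t (1 : R) (fun s => f s + g s) (d + e).
Proof. by move=> h1 h2; exact: (@is_deriveD _ _ _ f g t 1 d e). Qed.

Lemma is_derive1B {V : normedModType R} (f g : R -> V) t d e :
  is_derive t (1 : R) f d -> is_derive t (1 : R) g e ->
  is_derive t (1 : R) (fun s => f s - g s) (d - e).
Proof. by move=> h1 h2; exact: (@is_deriveB _ _ _ f g t 1 d e). Qed.

Lemma is_derive1M (f g : R -> R) t d e :
  is_derive t (1 : R) f d -> is_derive t (1 : R) g e ->
  is_derive t (1 : R) (fun s => f s * g s) (d * g t + f t * e).
Proof.
move=> h1 h2; apply: (@is_derive_eq _ _ _ (f * g) t 1 _ (f t *: e + g t *: d)).
by rewrite /GRing.scale/= addrC [g t * d]mulrC.
Qed.

Lemma is_derive1Z {V : normedModType R} (c : R) (f : R -> V) t d :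
  is_derive t (1 : R) f d -> is_derive t (1 : R) (fun s => c *: f s) (c *: d).
Proof. by move=> h1; exact: (@is_deriveZ _ _ _ f c t 1 d). Qed.

Lemma is_derive1_sum {V : normedModType R} n (f : 'I_n -> R -> V) t d :
  (forall i, is_derive t (1 : R) (f i) (d i)) ->
  is_derive t (1 : R) (fun s => \sum_i f i s) (\sum_i d i).
Proof.
move=> h; have -> : (fun s => \sum_i f i s) = \sum_i f i.
  by apply/funext => s; rewrite fct_sumE.
exact: is_derive_sum.
Qed.

Lemma is_derive1_cst {V : normedModType R} (c : V) (t : R) :
  is_derive t (1 : R) (fun _ => c) 0.
Proof. exact: is_derive_cst. Qed.

End is_derive_components.

(** * Calculus of absolutely continuous curves with a prescribed derivative *)

Section acd_theory.
Context {R : realType}.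

(** Letting [g] mention [f] expresses a differential equation in the sense of Caratheodory; with
    [g t] equal to [\sum_i u t 0 i *: X i (f t)] this is [trajectory]. *)
Definition acd {V : normedModType R} (a b : R) (f g : R -> V) : Prop :=
  abs_continuous a b f /\ ae_on a b (fun t => is_derive t 1 f (g t)).

Lemma acdS {V : normedModType R} (a b c d : R) (f g : R -> V) :
  a <= c -> d <= b -> acd a b f g -> acd c d f g.
Proof.
move=> ac db [h1 h2]; split; first exact: abs_continuousS h1.
exact: ae_onS h2.
Qed.

Lemma acd_ae {V : normedModType R} (a b : R) (f g g' : R -> V) :
  ae_on a b (fun t => g t = g' t) -> acd a b f g -> acd a b f g'.
Proof.
by move=> gg [h1 h2]; split=> //; apply: ae_on2 gg h2 => t _ <-.
Qed.

Lemma acd_eq {V : normedModType R} (a b : R) (f f' g : R -> V) :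
  (forall t, a <= t <= b -> f t = f' t) -> acd a b f g -> acd a b f' g.
Proof.
move=> ff [h1 h2]; split.
  move=> e e0; have [d d0 dP] := h1 e e0; exists d => // m x y xy tr sd.
  rewrite (eq_bigr (fun i => `|f (y i) - f (x i)|)); first exact: dP.
  by move=> i _; have [h3 h4 h5] := xy i; rewrite !ff//; apply/andP; split=> //;
    [exact: le_trans h5|exact: le_trans h4].
apply: ae_on1 h2 => t tab; apply: near_eq_is_derive.
have : \forall s \near t, s \in `]a, b[ by apply: near_in_itvoo; rewrite in_itv.
apply: filterS => s; rewrite in_itv/= => /andP[as_ sb].
by rewrite ff// (ltW as_) (ltW sb).
Qed.

Lemma abs_continuous_dist {V : normedModType R} (a b : R) (f : R -> V) (e : R) :
  abs_continuous a b f -> 0 < e -> exists2 d : R, 0 < d &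
  forall x y, a <= x <= b -> a <= y <= b -> `|x - y| < d -> `|f x - f y| < e.
Proof.
move=> acf e0; have [d d0 dP] := acf e e0; exists d => //.
have H x y : a <= x -> x <= y -> y <= b -> y - x < d -> `|f y - f x| < e.
  move=> ax xy yb yx; have := dP 1%N (fun _ => x) (fun _ => y).
  rewrite !big_ord1; apply => //.
  by apply/trivIsetP => i j _ _; rewrite !ord1 eqxx.
move=> x y /andP[ax xb] /andP[ay yb] xyd; have [xy|yx] := leP x y.
  by rewrite distrC; apply: H => //; rewrite distrC ger0_norm ?subr_ge0// in xyd.
by apply: H => //; [exact: ltW|rewrite gtr0_norm ?subr_gt0// in xyd].
Qed.

Lemma within_continuous_dist {V : normedModType R} (a b : R) (f : R -> V) :
  (forall x, a <= x <= b -> forall e : R, 0 < e -> exists2 d : R, 0 < d &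
    forall y, a <= y <= b -> `|x - y| < d -> `|f x - f y| < e) ->
  {within `[a, b], continuous f}.
Proof.
move=> H; apply/subspace_continuousP => x; rewrite /= in_itv/= => xab.
apply/cvgrPdist_lt => e e0; have [d d0 dP] := H x xab e e0.
rewrite near_withinE; apply/nbhs_ballP; exists d => // y xy.
by rewrite /= in_itv/= => yab; exact: dP.
Qed.

Lemma abs_continuous_within {V : normedModType R} (a b : R) (f : R -> V) :
  abs_continuous a b f -> {within `[a, b], continuous f}.
Proof.
move=> acf; apply: within_continuous_dist => x xab e e0.
have [d d0 dP] := abs_continuous_dist acf e0; exists d => // y yab; exact: dP.
Qed.

Lemma within_bounded (a b : R) (f : R -> R) :
  {within `[a, b], continuous f} ->
  exists2 M : R, 0 <= M & forall t, a <= t <= b -> `|f t| <= M.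
Proof.
move=> cf; have [ab|ba] := leP a b; last first.
  exists 0 => // t /andP[h1 h2]; move: (le_trans h1 h2); rewrite leNgt ba//.
have cf' : {within `[a, b], continuous (fun t => `|f t|)}.
  by move=> x; apply: cvg_norm; exact: cf.
have [c cab cP] := EVT_max ab cf'; exists `|f c| => // t tab; exact: cP.
Qed.

Lemma abs_continuous_bounded (a b : R) (f : R -> R) : abs_continuous a b f ->
  exists2 M : R, 0 <= M & forall t, a <= t <= b -> `|f t| <= M.
Proof. by move=> /abs_continuous_within/within_bounded. Qed.

Lemma abs_continuousD {V : normedModType R} (a b : R) (f g : R -> V) :
  abs_continuous a b f -> abs_continuous a b g ->
  abs_continuous a b (fun t => f t + g t).
Proof.
move=> hf hg e e0; have e20 : 0 < e / 2 by rewrite divr_gt0.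
have [d d0 dP] := hf _ e20; have [d' d'0 d'P] := hg _ e20.
exists (Num.min d d'); first by rewrite lt_min d0.
move=> m x y xy tr; rewrite lt_min => /andP[s1 s2].
rewrite (splitr e); apply: le_lt_trans (ltrD (dP m x y xy tr s1) (d'P m x y xy tr s2)).
rewrite -big_split/=; apply: ler_sum => i _.
by rewrite opprD addrACA ler_normD.
Qed.

Lemma abs_continuousM (a b : R) (f g : R -> R) :
  abs_continuous a b f -> abs_continuous a b g ->
  abs_continuous a b (fun t => f t * g t).
Proof.
move=> hf hg e e0.
have [M M0 fM] := abs_continuous_bounded hf.
have [N N0 gN] := abs_continuous_bounded hg.
have M1 : 0 < M + N + 1 by rewrite ltr_wpDl// addr_ge0.
pose r := e / 2 / (M + N + 1).
have r0 : 0 < r by rewrite !divr_gt0.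
have [d d0 dP] := hf _ r0; have [d' d'0 d'P] := hg _ r0.
exists (Num.min d d'); first by rewrite lt_min d0.
move=> m x y xy tr; rewrite lt_min => /andP[s1 s2].
apply: (@le_lt_trans _ _ (\sum_i (N * `|f (y i) - f (x i)| + M * `|g (y i) - g (x i)|))).
  apply: ler_sum => i _; have [h1 h2 h3] := xy i.
  have -> : f (y i) * g (y i) - f (x i) * g (x i) =
    g (y i) * (f (y i) - f (x i)) + f (x i) * (g (y i) - g (x i)) by ring.
  rewrite (le_trans (ler_normD _ _))// !normrM lerD// ler_wpM2r//.
    by apply: gN; rewrite h3 (le_trans h1).
  by apply: fM; rewrite h1 (le_trans h2).
rewrite big_split/= -!mulr_sumr.
have S1 := dP m x y xy tr s1; have S2 := d'P m x y xy tr s2.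
apply: (@le_lt_trans _ _ ((M + N) * r)).
  by rewrite mulrDl addrC lerD// ler_wpM2l// ltW.
have rE : (M + N + 1) * r = e / 2 by rewrite /r mulrC divfK// gt_eqF.
lra.
Qed.

Lemma abs_continuous_cst {V : normedModType R} (a b : R) (c : V) :
  abs_continuous a b (fun _ => c).
Proof.
move=> e e0; exists 1 => // m x y _ _ _; rewrite big1// => i _.
by rewrite subrr normr0.
Qed.

Lemma abs_continuous_le {V W : normedModType R} (a b : R) (f : R -> V)
    (g : R -> W) :
  (forall x y, a <= x <= b -> a <= y <= b ->
    `|f y - f x| <= `|g y - g x|) ->
  abs_continuous a b g -> abs_continuous a b f.
Proof.
move=> fg hg e e0; have [d d0 dP] := hg _ e0; exists d => // m x y xy tr s1.
apply: le_lt_trans (dP m x y xy tr s1); apply: ler_sum => i _.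
have [h1 h2 h3] := xy i.
by apply: fg; rewrite ?h1 ?h3/= ?andbT; [exact: le_trans h3|exact: le_trans h2].
Qed.

Lemma abs_continuous_sum {V : normedModType R} (a b : R) (I : eqType)
    (s : seq I) (f : I -> R -> V) :
  (forall i, abs_continuous a b (f i)) ->
  abs_continuous a b (fun t => \sum_(i <- s) f i t).
Proof.
move=> h; elim: s => [|i s IHs].
  under [X in abs_continuous _ _ X]eq_fun do rewrite big_nil.
  exact: abs_continuous_cst.
under [X in abs_continuous _ _ X]eq_fun do rewrite big_cons.
exact: (abs_continuousD (h i) IHs).
Qed.

Lemma norm_mx_coord (m n : nat) (A : 'M[R]_(m, n)) i j : `|A i j| <= `|A|.
Proof.
rewrite [leRHS]/Num.Def.normr/= mx_normrE.
exact: (@le_bigmax _ _ _ _ (fun ij => `|A ij.1 ij.2|) (i, j)).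
Qed.

Lemma norm_mx_le_sum (m n : nat) (A : 'M[R]_(m, n)) :
  `|A| <= \sum_(i < m) \sum_(j < n) `|A i j|.
Proof.
rewrite [leLHS]/Num.Def.normr/= mx_normrE; apply: bigmax_le => /=.
  by apply: sumr_ge0 => i _; apply: sumr_ge0.
move=> [i j] _ /=; rewrite (bigD1 i)//= (bigD1 j)//= -addrA lerDl addr_ge0//.
  by apply: sumr_ge0.
by apply: sumr_ge0 => i' _; apply: sumr_ge0.
Qed.

Lemma abs_continuous_mxP (a b : R) (m n : nat) (f : R -> 'M[R]_(m, n)) :
  abs_continuous a b f <-> forall i j, abs_continuous a b (fun t => f t i j).
Proof.
split.
  move=> hf i j; apply: abs_continuous_le hf => x y _ _.
  by have := norm_mx_coord (f y - f x) i j; rewrite !mxE.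
move=> h.
have H (s : seq ('I_m * 'I_n)) : forall e : R, 0 < e -> exists2 d : R, 0 < d &
    forall (N : nat) (x y : 'I_N -> R),
      (forall i, [/\ a <= x i, x i <= y i & y i <= b]) ->
      trivIset [set: 'I_N] (fun i => `]x i, y i[%classic) ->
      \sum_i (y i - x i) < d ->
      \sum_i \sum_(p <- s) `|f (y i) p.1 p.2 - f (x i) p.1 p.2| < e.
  elim: s => [|p s IHs] e e0.
    by exists 1 => // N x y _ _ _; rewrite big1// => i _; rewrite big_nil.
  have e20 : 0 < e / 2 by rewrite divr_gt0.
  have [d d0 dP] := IHs _ e20; have [d' d'0 d'P] := h p.1 p.2 _ e20.
  exists (Num.min d d'); first by rewrite lt_min d0.
  move=> N x y xy tr; rewrite lt_min => /andP[s1 s2].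
  under eq_bigr do rewrite big_cons.
  rewrite big_split/= (splitr e) ltrD//; [exact: d'P|exact: dP].
move=> e e0; have [d d0 dP] := H (index_enum ('I_m * 'I_n)%type) e e0.
exists d => // N x y xy tr s1; apply: le_lt_trans (dP N x y xy tr s1).
apply: ler_sum => i _; apply: le_trans (norm_mx_le_sum _) _.
rewrite pair_bigA/=; apply: ler_sum => p _.
by rewrite !mxE.
Qed.

Lemma acd_mxP (a b : R) (m n : nat) (f g : R -> 'M[R]_(m, n)) :
  acd a b f g <-> forall i j, acd a b (fun t => f t i j) (fun t => g t i j).
Proof.
split.
  move=> [/abs_continuous_mxP h1 h2] i j; split=> //.
  by apply: ae_on1 h2 => t _ /is_derive_mxP; exact.
move=> h; split; first by apply/abs_continuous_mxP => i j; have [] := h i j.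
have : ae_on a b (fun t => forall p : 'I_m * 'I_n,
    is_derive t (1 : R) (fun s => f s p.1 p.2) (g t p.1 p.2)).
  by apply: ae_on_forall => p; have [] := h p.1 p.2.
by apply: ae_on1 => t _ ht; apply/is_derive_mxP => i j; exact: (ht (i, j)).
Qed.

Lemma acd_rVP (a b : R) (n : nat) (f g : R -> 'rV[R]_n) :
  acd a b f g <-> forall j, acd a b (fun t => f t 0 j) (fun t => g t 0 j).
Proof.
split=> [/acd_mxP h j|h]; first exact: h.
by apply/acd_mxP => i j; rewrite (ord1 i).
Qed.

Lemma acd_pairP {V W : normedModType R} (a b : R) (f g : R -> V * W) :
  acd a b f g <-> acd a b (fun t => (f t).1) (fun t => (g t).1) /\
                  acd a b (fun t => (f t).2) (fun t => (g t).2).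
Proof.
split.
  move=> [h1 h2]; split; split.
  - apply: abs_continuous_le h1 => x y _ _.
    by rewrite [leRHS]prod_normE/= le_max lexx.
  - by apply: ae_on1 h2 => t _ /is_derive_fst.
  - apply: abs_continuous_le h1 => x y _ _.
    by rewrite [leRHS]prod_normE/= le_max lexx orbT.
  - by apply: ae_on1 h2 => t _ /is_derive_snd.
move=> [[h1 h2] [h3 h4]]; split.
  move=> e e0; have e20 : 0 < e / 2 by rewrite divr_gt0.
  have [d d0 dP] := h1 _ e20; have [d' d'0 d'P] := h3 _ e20.
  exists (Num.min d d'); first by rewrite lt_min d0.
  move=> m x y xy tr; rewrite lt_min => /andP[s1 s2].
  rewrite (splitr e); apply: le_lt_trans (ltrD (dP m x y xy tr s1) (d'P m x y xy tr s2)).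
  rewrite -big_split/=; apply: ler_sum => i _.
  by rewrite [leLHS]prod_normE/= ge_max lerDl lerDr !normr_ge0.
apply: ae_on2 h2 h4 => t _ d1 d2.
have := is_derive_pair d1 d2; rewrite -surjective_pairing.
by congr is_derive; apply/funext => s; rewrite -surjective_pairing.
Qed.

Lemma acdD {V : normedModType R} (a b : R) (f g df dg : R -> V) :
  acd a b f df -> acd a b g dg ->
  acd a b (fun t => f t + g t) (fun t => df t + dg t).
Proof.
move=> [h1 h2] [h3 h4]; split; first exact: abs_continuousD.
by apply: ae_on2 h2 h4 => t _; exact: is_derive1D.
Qed.

Lemma acdM (a b : R) (f g df dg : R -> R) :
  acd a b f df -> acd a b g dg ->
  acd a b (fun t => f t * g t) (fun t => df t * g t + f t * dg t).
Proof.
move=> [h1 h2] [h3 h4]; split; first exact: abs_continuousM.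
by apply: ae_on2 h2 h4 => t _; exact: is_derive1M.
Qed.

Lemma acd_cst {V : normedModType R} (a b : R) (c : V) :
  acd a b (fun _ => c) (fun _ => 0).
Proof.
split; first exact: abs_continuous_cst.
by apply: ae_onT => t _; exact: is_derive1_cst.
Qed.

Lemma acdZ (a b c : R) (f df : R -> R) : acd a b f df ->
  acd a b (fun t => c * f t) (fun t => c * df t).
Proof.
move=> h; apply: acd_ae (acdM (acd_cst a b c) h).
by apply: ae_onT => t _; rewrite mul0r add0r.
Qed.

Lemma acdB (a b : R) (f g df dg : R -> R) :
  acd a b f df -> acd a b g dg ->
  acd a b (fun t => f t - g t) (fun t => df t - dg t).
Proof.
move=> hf hg; have := acdD hf (acdZ (- 1) hg).
by under eq_fun do rewrite mulN1r; under [X in acd _ _ _ X]eq_fun do rewrite mulN1r.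
Qed.

Lemma acd_sum (a b : R) (n : nat) (f df : 'I_n -> R -> R) :
  (forall i, acd a b (f i) (df i)) ->
  acd a b (fun t => \sum_i f i t) (fun t => \sum_i df i t).
Proof.
move=> h; split; first by apply: abs_continuous_sum => i; have [] := h i.
have : ae_on a b (fun t => forall i, is_derive t (1 : R) (f i) (df i t)).
  by apply: ae_on_forall => i; have [] := h i.
by apply: ae_on1 => t _ ht; exact: is_derive1_sum.
Qed.

Lemma acd_homo (a b : R) (f df : R -> R) : acd a b f df ->
  ae_on a b (fun t => 0 <= df t) ->
  forall s t, a <= s -> s <= t -> t <= b -> f s <= f t.
Proof.
move=> [h1 h2] h3 s t as_ st tb; apply: ac_ae_homo => //.
  exact: abs_continuousS h1.
by apply: (ae_onS as_ tb); apply: ae_on2 h2 h3 => x _; exists (df x).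
Qed.

(** The monotonicity theorem applied to both differences. Later identities between curves,
    primitives and choice-defined solutions are proved by comparing derivatives through this
    lemma. *)
Lemma acd_unique (a b : R) (f h df dh : R -> R) :
  acd a b f df -> acd a b h dh -> ae_on a b (fun t => df t = dh t) ->
  f a = h a -> forall t, a <= t <= b -> f t = h t.
Proof.
move=> hf hh fh fha t /andP[at_ tb].
have H (f' h' df' dh' : R -> R) : acd a b f' df' -> acd a b h' dh' ->
    ae_on a b (fun t => df' t = dh' t) -> f' a - h' a <= f' t - h' t.
  move=> hf' hh' fh'; apply: (acd_homo (acdB hf' hh')) => //.
  by apply: ae_on1 fh' => s _ ->; rewrite subrr.
have h1 := H _ _ _ _ hf hh fh.
have h2 := H _ _ _ _ hh hf (ae_on1 (fun t _ => @esym _ _ _) fh).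
lra.
Qed.

End acd_theory.

(** * Essentially bounded functions *)

Section essentially_bounded.
Context {R : realType}.
Notation mu := (@lebesgue_measure R).
Notation RT := (measurableTypeR R).

Definition Linf (a b : R) (r : R -> R) : Prop :=
  measurable_fun (`[a, b] : set RT) r /\
  exists2 M : R, 0 <= M & ae_on a b (fun t => `|r t| <= M).

(** A representative that is bounded at every point of the line. Any [Linf] function agrees with one
    almost everywhere on its interval, by truncating the extension by zero at the essential
    bound. *)
Definition mbounded (r : R -> R) : Prop :=
  measurable_fun (setT : set RT) r /\ exists2 M : R, 0 <= M & forall t, `|r t| <= M.

Lemma mbounded_Linf a b r : mbounded r -> Linf a b r.
Proof.
move=> [mr [M M0 rM]]; split; first exact: measurable_funTS.
by exists M => //; apply: ae_onT => t _.
Qed.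

Lemma Linf_mbounded a b r : Linf a b r ->
  exists2 r', mbounded r' & ae_on a b (fun t => r t = r' t).
Proof.
move=> [mr [M M0 rM]].
pose r' t := Num.max (- M) (Num.min M ((r \_ `[a, b]) t)).
have mr' : measurable_fun (setT : set RT) (r \_ `[a, b]).
  by apply/(measurable_restrictT _ _).1.
exists r'.
  split; first by apply: measurable_maxr => //; exact: measurable_minr.
  exists M => // t; rewrite ler_norml /r' le_max lexx/= ge_max ge_min lexx andbT.
  lra.
apply: ae_on1 rM => t tab; rewrite ler_norml => /andP[h1 h2].
rewrite /r' patchE ifT; last by case/andP: tab => ta tb; rewrite inE/= in_itv/= !ltW.
by rewrite (min_idPr h2) (max_idPr h1).
Qed.

Lemma mboundedD r r' : mbounded r -> mbounded r' -> mbounded (fun t => r t + r' t).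
Proof.
move=> [mr [M M0 rM]] [mr' [M' M'0 rM']]; split; first exact: measurable_funD.
exists (M + M'); first exact: addr_ge0.
by move=> t; rewrite (le_trans (ler_normD _ _))// lerD.
Qed.

Lemma mboundedM r r' : mbounded r -> mbounded r' -> mbounded (fun t => r t * r' t).
Proof.
move=> [mr [M M0 rM]] [mr' [M' M'0 rM']]; split; first exact: measurable_funM.
exists (M * M'); first exact: mulr_ge0.
by move=> t; rewrite normrM ler_pM.
Qed.

Lemma mbounded_cst c : mbounded (fun _ => c).
Proof. by split; [exact: measurable_cst|exists `|c|]. Qed.

Lemma Linf_ext a b r r' : (forall t, a <= t <= b -> r t = r' t) ->
  Linf a b r -> Linf a b r'.
Proof.
move=> rr [mr [M M0 rM]]; split.
  apply: eq_measurable_fun mr => t; rewrite inE/= in_itv/=; exact: rr.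
exists M => //; apply: ae_on1 rM => t /andP[ta tb].
by rewrite rr// !ltW.
Qed.

Lemma LinfD a b r r' : Linf a b r -> Linf a b r' -> Linf a b (fun t => r t + r' t).
Proof.
move=> [mr [M M0 rM]] [mr' [M' M'0 rM']]; split; first exact: measurable_funD.
exists (M + M'); first exact: addr_ge0.
by apply: ae_on2 rM rM' => t _ h1 h2; rewrite (le_trans (ler_normD _ _))// lerD.
Qed.

Lemma LinfM a b r r' : Linf a b r -> Linf a b r' -> Linf a b (fun t => r t * r' t).
Proof.
move=> [mr [M M0 rM]] [mr' [M' M'0 rM']]; split; first exact: measurable_funM.
exists (M * M'); first exact: mulr_ge0.
by apply: ae_on2 rM rM' => t _ h1 h2; rewrite normrM ler_pM.
Qed.

Lemma Linf_cst a b c : Linf a b (fun _ => c).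
Proof. exact/mbounded_Linf/mbounded_cst. Qed.

Lemma Linf_sum a b (I : eqType) (s : seq I) (r : I -> R -> R) :
  (forall i, Linf a b (r i)) -> Linf a b (fun t => \sum_(i <- s) r i t).
Proof.
move=> h; elim: s => [|i s IHs].
  by apply: Linf_ext (Linf_cst a b 0) => t _; rewrite big_nil.
by apply: Linf_ext (LinfD (h i) IHs) => t _; rewrite big_cons.
Qed.

Lemma LinfS a b c d r : a <= c -> d <= b -> Linf a b r -> Linf c d r.
Proof.
move=> ac db [mr [M M0 rM]]; split.
  apply: measurable_funS mr => // t; rewrite /= !in_itv/= => /andP[ct td].
  by rewrite (le_trans ac ct) (le_trans td db).
by exists M => //; exact: ae_onS rM.
Qed.

Lemma Linf_within a b r : {within `[a, b], continuous r} -> Linf a b r.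
Proof.
move=> cr; split; first exact: subspace_continuous_measurable_fun.
have [M M0 rM] := within_bounded cr; exists M => //.
by apply: ae_onT => t /andP[ta tb]; apply: rM; rewrite !ltW.
Qed.

Lemma ae_on_cc a b (P : R -> Prop) : ae_on a b P ->
  \forall t \ae mu, t \in `[a, b] -> P t.
Proof.
move=> h.
have hpt (c : R) : mu.-negligible [set c].
  by exists [set c]; split=> //; exact: lebesgue_measure_set1.
have : mu.-negligible ((~` [set t | t \in `]a, b[ -> P t]) `|` ([set a] `|` [set b])).
  by do 2! apply: negligibleU => //.
apply: negligibleS => t /= /not_implyP[tab nP].
have [->|ta] := eqVneq t a; first by right; left.
have [->|tb] := eqVneq t b; first by right; right.
left => /= hP; apply/nP/hP; move: tab; rewrite !in_itv/= !lt_neqAle => /andP[-> ->].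
by rewrite eq_sym ta tb.
Qed.

Lemma ae_on_ae_eq a b (r r' : R -> R) : ae_on a b (fun t => r t = r' t) ->
  ae_eq mu `[a, b]%classic (EFin \o r) (EFin \o r').
Proof.
move=> /ae_on_cc; apply: filterS; first exact: (ae_filter_ringOfSetsType mu).
by move=> t h tab /=; rewrite h.
Qed.

Lemma Linf_integrable a b r : Linf a b r -> mu.-integrable `[a, b] (EFin \o r).
Proof.
move=> lr; have [r' [mr' [M M0 rM]] rr] := Linf_mbounded lr.
have [mr _] := lr.
have ir' : mu.-integrable `[a, b] (EFin \o r').
  apply: measurable_bounded_integrable => //.
  - rewrite /= lebesgue_measure_itv/=; case: ifP => _; exact: ltry.
  - exact: measurable_funTS.
  - exists M; split; first exact: num_real.
    by move=> N MN t _; apply: le_trans (rM t) (ltW MN).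
apply/integrableP; split; first exact/measurable_EFinP.
have /integrableP[_] := ir'.
rewrite (@ae_eq_integral _ _ _ mu `[a, b]%classic (fun x => `|(EFin \o r) x|)%E
    (fun x => `|(EFin \o r') x|)%E)//.
- by apply/measurable_EFinP/measurableT_comp => //; exact: measurable_funTS.
- exact/measurable_EFinP/measurableT_comp.
- move: rr => /ae_on_cc; apply: filterS; first exact: (ae_filter_ringOfSetsType mu).
  by move=> t /= h /h ->.
Qed.

Lemma eq_Rintegral_ae a b r r' : Linf a b r -> Linf a b r' ->
  ae_on a b (fun t => r t = r' t) ->
  \int[mu]_(t in `[a, b]) r t = \int[mu]_(t in `[a, b]) r' t.
Proof.
move=> [mr _] [mr' _] rr; congr fine; apply: ae_eq_integral => //.
- exact/measurable_EFinP.
- exact/measurable_EFinP.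
- exact: ae_on_ae_eq.
Qed.

Lemma lipschitz_abs_continuous {V : normedModType R} (a b M : R) (f : R -> V) :
  0 <= M ->
  (forall x y, a <= x -> x <= y -> y <= b -> `|f y - f x| <= M * (y - x)) ->
  abs_continuous a b f.
Proof.
move=> M0 H; have M1 : 0 < M + 1 by rewrite ltr_wpDl.
move=> e e0; exists (e / (M + 1)); first by rewrite divr_gt0.
move=> m x y xy tr s1.
apply: (@le_lt_trans _ _ (M * \sum_i (y i - x i))).
  by rewrite mulr_sumr; apply: ler_sum => i _; have [h1 h2 h3] := xy i; exact: H.
have S0 : 0 <= \sum_i (y i - x i).
  by apply: sumr_ge0 => i _; have [h1 h2 h3] := xy i; rewrite subr_ge0.
move: s1; rewrite ltr_pdivlMr// mulrDr mulr1 mulrC; lra.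
Qed.

Definition primitive (a : R) (r : R -> R) (t : R) : R :=
  \int[mu]_(x in `[a, t]) r x.

Lemma primitive_start a r : primitive a r a = 0.
Proof. by rewrite /primitive set_itv1 Rintegral_set1. Qed.

(** The pointwise bound makes the primitive Lipschitz and [r] locally integrable on the line, so
    that differentiation of the integral almost everywhere applies. *)
Lemma primitive_acd a b r : mbounded r -> acd a b (primitive a r) r.
Proof.
move=> mr; have lr c d : Linf c d r by exact: mbounded_Linf.
have ir c d := Linf_integrable (lr c d).
have [mr' [M M0 rM]] := mr.
split.
  apply: (lipschitz_abs_continuous M0) => x y ax xy yb.
  rewrite /primitive Rintegral_itvB; [|exact: ir|by rewrite bnd_simp|by rewrite bnd_simp].
  rewrite Rintegral_itv_obnd_cbnd; last first.
    by apply: integrableS (ir x y) => //; exact: subset_itv_oc_cc.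
  apply: le_trans (le_normr_Rintegral _ (ir x y)) _ => //.
  have -> : M * (y - x) = \int[mu]_(t in `[x, y]) (cst M) t.
    rewrite Rintegral_cst//= lebesgue_measure_itv/= lte_fin.
    case: ltP => //= yx; have -> : x = y by apply/eqP; rewrite eq_le xy yx.
    by rewrite subrr mulr0.
  apply: le_Rintegral => //.
  - apply: (Linf_integrable (r := fun t => `|r t|)); apply: mbounded_Linf.
    split; first exact: measurableT_comp.
    by exists M => // t; rewrite normr_id.
  - exact: (Linf_integrable (Linf_cst x y M)).
have locr : locally_integrable [set: R] r.
  split => //; first exact: openT.
  move=> K _ cK.
  have /integrableP[_] : mu.-integrable K (EFin \o r).
    apply: measurable_bounded_integrable => //; first exact: compact_measurable.
    - exact: compact_finite_measure.
    - exact: measurable_funTS.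
    - exists M; split; first exact: num_real.
      by move=> N MN t _; apply: le_trans (rM t) (ltW MN).
  exact.
have := FTC1 (a := BLeft a) (ir a) locr.
rewrite /ae_on; apply: filterS; first exact: (ae_filter_ringOfSetsType mu).
move=> t h; rewrite in_itv/= => /andP[at_ _].
have [] : derivable (primitive a r) t 1 /\ (primitive a r)^`()%classic t = r t.
  by apply: h; rewrite lte_fin.
by rewrite derive1E; exact: DeriveDef.
Qed.

(** [F] minus its initial value and the primitive of a bounded representative of [f] have the same
    derivative and the same start. *)
Lemma Rintegral_acd a b (F f : R -> R) : a <= b -> Linf a b f -> acd a b F f ->
  \int[mu]_(t in `[a, b]) f t = F b - F a.
Proof.
move=> ab lf hF; have [r mr fr] := Linf_mbounded lf.
rewrite (eq_Rintegral_ae lf (mbounded_Linf a b mr) fr).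
have := acd_unique (acdD hF (acd_cst a b (- F a))) (primitive_acd a b mr).
rewrite primitive_start subrr => /(_ _ erefl b) -> //; last by rewrite ab lexx.
by apply: ae_on1 fr => t _ ->; rewrite addr0.
Qed.

Lemma primitive_Linf a b r : Linf a b r -> acd a b (primitive a r) r.
Proof.
move=> lr; have [r' mr' rr] := Linf_mbounded lr.
have := acd_ae (ae_on1 (fun t _ => @esym _ _ _) rr) (primitive_acd a b mr').
apply: acd_eq => t /andP[at_ tb]; apply: eq_Rintegral_ae.
- exact: mbounded_Linf.
- exact: LinfS lr.
- by apply: ae_on1 (ae_onS _ tb rr) => // s _ ->.
Qed.

Lemma Linf_restrict a b c d r : a <= c -> d <= b -> Linf c d r ->
  Linf a b (fun t => if t \in `[c, d] then r t else 0).
Proof.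
move=> ac db lr; have [mr [M M0 rM]] := lr; split.
  apply: measurable_funTS.
  rewrite [X in measurable_fun _ X](_ : _ = r \_ `[c, d]);
    first by apply/(measurable_restrictT _ _).1.
  by apply/funext => t; rewrite patchE mem_setE.
exists M => //; rewrite /ae_on.
move: rM => /ae_on_cc; apply: filterS; first exact: (ae_filter_ringOfSetsType mu).
by move=> t rM _; case: ifPn => // _; rewrite normr0.
Qed.

Lemma LinftyP (k : nat) (a b : R) (u : R -> 'rV[R]_k) :
  Linfty a b u <-> forall j, Linf a b (fun t => u t 0 j).
Proof.
(* The norm with infinite exponent is an essential supremum only on a space of positive measure. *)
have muT : (0 < mu setT)%E.
  by rewrite -(set_itvNyy R) lebesgue_measure_itv/= addye// lt0y.
split=> [h j|h j].
  have := h j; rewrite inE /Lfun/= => /andP[].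
  rewrite inE/= => mf; rewrite inE/= => /= fin; split.
    apply/(measurable_restrictT _ _).2 => //.
  move: fin; rewrite /finite_norm unlock muT => /ess_supr_bounded => -[M MP].
  exists (Num.max 0 M); first by rewrite le_max lexx.
  rewrite /ae_on; apply: filterS MP => t /= tM tab.
  rewrite le_max; apply/orP; right; apply: le_trans tM.
  rewrite patchE ifT// inE/= in_itv/=.
  by move: tab; rewrite in_itv/= => /andP[/ltW -> /ltW ->].
have [mf [M M0 fM]] := h j.
rewrite inE/=; apply/andP; split.
  by rewrite inE/=; apply/(measurable_restrictT _ _).1.
rewrite inE/= /finite_norm unlock muT.
apply: (@le_lt_trans _ _ M%:E); last exact: ltry.
apply/ess_supP; move: fM => /ae_on_cc.
apply: filterS; first exact: (ae_filter_ringOfSetsType mu).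
move=> t tM /=; rewrite patchE lee_fin; case: ifPn => [|_]; last by rewrite normr0.
by rewrite inE/=; exact: tM.
Qed.

End essentially_bounded.

(** * Linear growth estimates and Picard iteration *)

Section picard.
Context {R : realType}.

Lemma C1_acd (a b : R) (f g : R -> R) : (forall t, is_derive t (1 : R) f (g t)) ->
  {within `[a, b], continuous g} -> acd a b f g.
Proof.
move=> df cg; split; last by apply: ae_onT => t _.
have [M M0 gM] := within_bounded cg.
apply: (lipschitz_abs_continuous M0) => x y ax xy yb.
have [//|c cxy ->] := @MVT_segment _ f g x y xy (fun t _ => df t).
  apply: derivable_within_continuous => t _; have [] := df t; exact.
rewrite normrM (ger0_norm (x := y - x)) ?subr_ge0// ler_wpM2r ?subr_ge0//.
move: cxy; rewrite in_itv/= => /andP[xc cy]; apply: gM.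
by rewrite (le_trans ax xc) (le_trans cy yb).
Qed.

Lemma acd_affine (a b c d : R) : acd a b (fun t => c * t + d) (fun _ => c).
Proof.
apply: C1_acd; last by move=> x; exact: cvg_cst.
move=> t; apply: (is_derive_eq (is_derive1D
    (is_derive1Z c (is_derive_id t 1)) (is_derive1_cst d t))).
by rewrite addr0 /GRing.scale/= mulr1.
Qed.

Lemma acd_exp (a b k c d : R) :
  acd a b (fun t => d * expR (k * (t - c))) (fun t => k * (d * expR (k * (t - c)))).
Proof.
have cE : continuous (fun t => expR (k * (t - c))).
  move=> t; apply: (@continuous_comp _ _ _ (fun t => k * (t - c)) expR).
    apply: cvgM; first exact: cvg_cst.
    by apply: cvgB; [exact: cvg_id|exact: cvg_cst].
  exact: continuous_expR.
apply: C1_acd; last first.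
  apply: continuous_subspaceT => t; apply: cvgM; first exact: cvg_cst.
  by apply: cvgM; [exact: cvg_cst|exact: cE].
move=> t; have d1 : is_derive t (1 : R) (fun t => k * (t - c)) k.
  apply: (is_derive_eq (is_derive1Z k (is_derive1B (is_derive_id t 1) (is_derive1_cst c t)))).
  by rewrite subr0 /GRing.scale/= mulr1.
have d2 : is_derive t (1 : R) (fun t => expR (k * (t - c))) (k * expR (k * (t - c))).
  have := @is_derive1_comp _ (@expR R) (fun t => k * (t - c)) t _ _ (is_derive_expR _) d1.
  by rewrite mulrC.
by apply: (is_derive_eq (is_derive1Z d d2)); rewrite /GRing.scale/= mulrCA.
Qed.

(** Majorant principle: both [H - F] and [H + F] are non-decreasing. It replaces integral estimates
    in the Picard iteration. *)
Lemma acd_bound (a b : R) (F f H h : R -> R) :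
  acd a b F f -> acd a b H h -> `|F a| <= H a ->
  ae_on a b (fun t => `|f t| <= h t) ->
  forall t, a <= t <= b -> `|F t| <= H t.
Proof.
move=> hF hH FHa fh t /andP[at_ tb].
move: FHa; rewrite !ler_norml => /andP[h1 h2].
have := acd_homo (acdB hH hF) (ae_on1 _ fh) (lexx a) at_ tb.
have := acd_homo (acdD hH hF) (ae_on1 _ fh) (lexx a) at_ tb.
move=> H1 H2.
have {}H1 : H a + F a <= H t + F t.
  by apply: H1 => s _; rewrite ler_norml => /andP[? ?]; lra.
have {}H2 : H a - F a <= H t - F t.
  by apply: H2 => s _; rewrite ler_norml => /andP[? ?]; lra.
apply/andP; split; lra.
Qed.

(** The tail of the increments from m on sums to 2 D / 2^m, so the intervals of this radius around
    [u m] are nested; their lower ends have the wanted limit as supremum. *)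
Lemma geometric_limit (u : nat -> R) (D : R) :
  (forall m, `|u m.+1 - u m| <= D / 2 ^+ m) ->
  exists y, forall m, `|u m - y| <= 2 * D / 2 ^+ m.
Proof.
move=> uD.
have e2 m : 2 * D / 2 ^+ m.+1 = D / 2 ^+ m.
  by rewrite exprS invfM; field; rewrite expf_neq0//; lra.
pose l m := u m - 2 * D / 2 ^+ m; pose r m := u m + 2 * D / 2 ^+ m.
have D0 m : 0 <= D / 2 ^+ m by apply: le_trans (uD m).
have step m : l m <= l m.+1 /\ r m.+1 <= r m.
  rewrite /l /r e2; have := uD m; rewrite ler_norml => /andP[h1 h2].
  by split; lra.
have lm m p : l m <= l (m + p)%N.
  elim: p => [|p IHp]; first by rewrite addn0.
  by rewrite addnS; apply: le_trans IHp _; have [] := step (m + p)%N.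
have rm m p : r (m + p)%N <= r m.
  elim: p => [|p IHp]; first by rewrite addn0.
  by rewrite addnS; apply: le_trans IHp; have [] := step (m + p)%N.
have lr m p : l m <= r p.
  apply: (le_trans (lm m p)); apply: (@le_trans _ _ (r (m + p)%N)).
    by rewrite /l /r; have := D0 (m + p)%N; lra.
  by rewrite addnC.
exists (sup (range l)) => m.
have lsup : l m <= sup (range l).
  by apply: ub_le_sup; [exists (r 0%N) => _ [p _ <-]|exists m].
have supr : sup (range l) <= r m.
  by apply: ge_sup; [exists (l 0%N), 0%N|move=> _ [p _ <-]].
move: lsup supr; rewrite /l /r ler_norml => h1 h2; apply/andP; split; lra.
Qed.

Lemma geometric_small (D e : R) : 0 < e -> exists m : nat, D / 2 ^+ m < e.
Proof.
move=> e0; pose m := (Num.truncn (`|D| / e)).+1.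
have h1 : `|D| / e < m%:R by rewrite /m truncnS_gt.
exists m; rewrite ltr_pdivrMr ?exprn_gt0//.
apply: (le_lt_trans (ler_norm D)).
have h2 : (m%:R : R) <= 2 ^+ m by rewrite -natrX ler_nat ltnW// ltn_expl.
move: h1; rewrite ltr_pdivrMr// mulrC => h1; apply: lt_le_trans h1 _.
by rewrite ler_wpM2l// ltW.
Qed.

Lemma acd_within (a b : R) (F f : R -> R) : acd a b F f -> {within `[a, b], continuous F}.
Proof. by case=> /abs_continuous_within. Qed.

(** Measured against an exponential weight, each Picard step halves the distance between iterates,
    so they converge on the whole interval without a smallness condition. Regularity in time is
    asked only along continuous curves, since the field depends on a control that is merely
    measurable. *)
Lemma picard_exists (n : nat) (a b L : R) (f : R -> 'rV[R]_n -> 'rV[R]_n)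
    (x0 : 'rV[R]_n) : a <= b -> 0 <= L ->
  (forall x : R -> 'rV[R]_n,
    (forall j, {within `[a, b], continuous (fun t => x t 0 j)}) ->
    forall j, Linf a b (fun t => f t (x t) 0 j)) ->
  (forall t x y j, a <= t <= b -> `|f t x 0 j - f t y 0 j| <= L * \sum_i `|x 0 i - y 0 i|) ->
  exists x, acd a b x (fun t => f t (x t)) /\ x a = x0.
Proof.
move=> ab L0 fm fL.
pose nxt (x : R -> 'rV[R]_n) : R -> 'rV[R]_n := fun t =>
  \row_j (x0 0 j + primitive a (fun s => f s (x s) 0 j) t).
pose cts (x : R -> 'rV[R]_n) := forall j, {within `[a, b], continuous (fun t => x t 0 j)}.
have nxt_acd x j : cts x -> acd a b (fun t => nxt x t 0 j) (fun t => f t (x t) 0 j).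
  move=> cx; have := acdD (acd_cst a b (x0 0 j)) (primitive_Linf (fm x cx j)).
  move=> h; apply: acd_ae (acd_eq _ h) => [|t _]; last by rewrite mxE.
  by apply: ae_onT => t _; rewrite add0r.
have nxt_cts x : cts x -> cts (nxt x).
  by move=> cx j; apply: acd_within (nxt_acd _ _ cx).
have nxt_a x : nxt x a = x0.
  by apply/rowP => j; rewrite mxE primitive_start addr0.
pose X m := iter m nxt (fun _ => x0).
have Xcts m : cts (X m).
  by elim: m => [|m IHm]; [move=> j x; exact: cvg_cst|exact: nxt_cts].
have Xa m : X m a = x0 by case: m => [//|m]; rewrite /X iterS nxt_a.
(* Integrating [expR (K * (t - a))] gains a factor 1 / K, and K is at least twice the Lipschitz
   constant n L of the field in the maximum norm: the product is at most 1 / 2. *)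
pose K := 2 * (n%:R * L + 1).
have nL0 : 0 <= n%:R * L by rewrite mulr_ge0.
have K0 : 0 <= K by rewrite /K; lra.
have [C C0 CP] : exists2 C : R, 0 <= C & forall j t, a <= t <= b ->
    `|X 1%N t 0 j - X 0%N t 0 j| <= C.
  have H j : exists M, 0 <= M /\ forall t, a <= t <= b -> `|X 1%N t 0 j - X 0%N t 0 j| <= M.
    have [|M M0 MP] := @within_bounded R a b (fun t => X 1%N t 0 j - X 0%N t 0 j); last by exists M.
    by move=> t; apply: cvgB; [exact: Xcts|exact: Xcts].
  have [M MP] := choice H.
  exists (\sum_j M j) => [|j t tab]; first by apply: sumr_ge0 => j _; have [] := MP j.
  apply: le_trans (proj2 (MP j) t tab) _; rewrite (bigD1 j)//= lerDl.
  by apply: sumr_ge0 => i _; have [] := MP i.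
have step m : forall t, a <= t <= b -> forall j,
    `|X m.+1 t 0 j - X m t 0 j| <= C / 2 ^+ m * expR (K * (t - a)).
  elim: m => [|m IHm] t tab j.
    rewrite expr0 divr1; apply: (le_trans (CP j t tab)).
    have ta : 0 <= t - a by rewrite subr_ge0; case/andP: tab.
    by rewrite ler_peMr// -expR0 ler_expR mulr_ge0.
  have hF := acdB (nxt_acd (X m.+1) j (Xcts _)) (nxt_acd (X m) j (Xcts _)).
  have hH := acd_exp a b K a (C / 2 ^+ m.+1).
  apply: (acd_bound hF hH _ _ tab).
    by rewrite !nxt_a !subrr normr0 mulr0 expR0 mulr1 divr_ge0// exprn_ge0.
  apply: ae_onT => s /andP[as_ sb]; have sab : a <= s <= b by rewrite !ltW.
  apply: (le_trans (fL _ _ _ _ sab)).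
  apply: (@le_trans _ _ (L * (\sum_(i < n) C / 2 ^+ m * expR (K * (s - a))))).
    by rewrite ler_wpM2l//; apply: ler_sum => i _; exact: IHm.
  rewrite sumr_const card_ord -(mulr_natl _ n).
  have E0 : 0 <= C / 2 ^+ m * expR (K * (s - a)).
    by rewrite mulr_ge0 ?expR_ge0// divr_ge0// exprn_ge0.
  have -> : C / 2 ^+ m.+1 * expR (K * (s - a)) = C / 2 ^+ m * expR (K * (s - a)) / 2.
    by rewrite exprS invfM; ring.
  set E := C / 2 ^+ m * _ in E0 *.
  rewrite /K; have : 0 <= n%:R * L * E by rewrite mulr_ge0.
  lra.
pose D := C * expR (K * (b - a)).
have step' m t : a <= t <= b -> forall j, `|X m.+1 t 0 j - X m t 0 j| <= D / 2 ^+ m.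
  move=> tab j; apply: (le_trans (step m t tab j)).
  rewrite /D mulrAC ler_wpM2r ?invr_ge0 ?exprn_ge0// ler_wpM2l// ler_expR.
  by rewrite ler_wpM2l// lerB//; case/andP: tab.
have HY t : exists y : 'rV[R]_n, a <= t <= b -> forall j m, `|X m t 0 j - y 0 j| <= 2 * D / 2 ^+ m.
  have [tab|] := boolP (a <= t <= b); last by exists 0.
  have Hj j : exists y, forall m, `|X m t 0 j - y| <= 2 * D / 2 ^+ m.
    by apply: geometric_limit => m; exact: step'.
  have [y yP] := choice Hj; exists (\row_j y j) => _ j m; rewrite mxE; exact: yP.
have [Y YP] := choice HY.
have Ycts : cts Y.
  move=> j; apply: within_continuous_dist => t tab e e0.
  have e30 : 0 < e / 3 by lra.
  have [m mP] := geometric_small (2 * D) e30.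
  have := Xcts m j; move/subspace_continuousP => /(_ t) /=; rewrite in_itv/= => /(_ tab).
  move/cvgrPdist_lt => /(_ _ e30); rewrite near_withinE => /nbhs_ballP[d /= d0 dP].
  exists d => // s sab ts; have := dP s ts; rewrite /= in_itv/= => /(_ sab) h.
  have h1 := YP t tab j m; have h2 := YP s sab j m.
  have -> : Y t 0 j - Y s 0 j =
      - (X m t 0 j - Y t 0 j) + (X m t 0 j - X m s 0 j) + (X m s 0 j - Y s 0 j) by ring.
  apply: (le_lt_trans (ler_normD _ _)); apply: (le_lt_trans (lerD (ler_normD _ _) (lexx _))).
  rewrite normrN; lra.
exists Y; split; last first.
  apply/rowP => j; apply/eqP; rewrite -subr_eq0 -normr_eq0 eq_le normr_ge0 andbT.
  apply/ler_addgt0Pl => e e0; rewrite addr0.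
  have [m mP] := geometric_small (2 * D) e0.
  by have := YP a (ltac:(by rewrite lexx)) j m; rewrite Xa distrC; lra.
apply/acd_rVP => j.
apply: acd_eq (nxt_acd Y j Ycts) => t tab.
apply/eqP; rewrite -subr_eq0 -normr_eq0 eq_le normr_ge0 andbT.
apply/ler_addgt0Pl => e e0; rewrite addr0.
have c0 : 0 <= n%:R * L * (b - a) by rewrite mulr_ge0// subr_ge0.
(* The first summand bounds the distance from [nxt Y] to [nxt (X m)], which is [X m.+1], and the
   second the distance from [X m.+1] to [Y]. *)
have [m mP] := geometric_small (2 * D * (n%:R * L * (b - a)) + 2 * D) e0.
have D0 : 0 <= 2 * D / 2 ^+ m by rewrite divr_ge0 ?exprn_ge0// !mulr_ge0 ?expR_ge0.
have hF := acdB (nxt_acd Y j Ycts) (nxt_acd (X m) j (Xcts m)).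
have hH := acd_affine a b (n%:R * L * (2 * D / 2 ^+ m)) (- (n%:R * L * (2 * D / 2 ^+ m)) * a).
have Hb := acd_bound hF hH _ _ tab.
have {}Hb : `|nxt Y t 0 j - nxt (X m) t 0 j| <=
    n%:R * L * (2 * D / 2 ^+ m) * t + - (n%:R * L * (2 * D / 2 ^+ m)) * a.
  apply: Hb.
    by rewrite !nxt_a subrr normr0 mulNr subrr.
  apply: ae_onT => s /andP[as_ sb]; have sab : a <= s <= b by rewrite !ltW.
  apply: (le_trans (fL _ _ _ _ sab)).
  apply: (@le_trans _ _ (L * (\sum_(i < n) 2 * D / 2 ^+ m))).
    by rewrite ler_wpM2l//; apply: ler_sum => i _; rewrite distrC; exact: YP.
  set E := 2 * D / 2 ^+ m; rewrite sumr_const card_ord -(mulr_natl _ n).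
  by rewrite le_eqVlt; apply/orP; left; apply/eqP; ring.
have H2 := YP t tab j m.+1.
have H3 : 2 * D / 2 ^+ m.+1 <= 2 * D / 2 ^+ m.
  by have -> : 2 * D / 2 ^+ m.+1 = 2 * D / 2 ^+ m / 2; [rewrite exprS invfM; ring|lra].
have -> : nxt Y t 0 j - Y t 0 j =
  (nxt Y t 0 j - nxt (X m) t 0 j) + (X m.+1 t 0 j - Y t 0 j) by rewrite addrA subrK.
apply: (le_trans (ler_normD _ _)); apply: (le_trans (lerD Hb (le_trans H2 H3))).
apply: le_trans (ltW mP).
have -> : (2 * D * (n%:R * L * (b - a)) + 2 * D) / 2 ^+ m =
  n%:R * L * (2 * D / 2 ^+ m) * (b - a) + 2 * D / 2 ^+ m by rewrite mulrDl; ring.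
rewrite mulNr -mulrBr lerD2r ler_wpM2l ?mulr_ge0// lerB//.
by case/andP: tab.
Qed.

End picard.

(** * Smooth vector fields *)

Section smooth_fields.
Context {R : realType}.

(** Directional derivatives are expanded along the standard basis, and the sum norm of the direction
    is what such an expansion produces. *)
Definition norm1 {n : nat} (h : 'rV[R]_n) : R := \sum_a `|h 0 a|.

Lemma norm1_ge0 n (h : 'rV[R]_n) : 0 <= norm1 h.
Proof. exact: sumr_ge0. Qed.

Lemma norm1D n (h k : 'rV[R]_n) : norm1 (h + k) <= norm1 h + norm1 k.
Proof.
rewrite /norm1 -big_split/=; apply: ler_sum => a _.
by rewrite mxE ler_normD.
Qed.

Lemma norm1Z n c (h : 'rV[R]_n) : norm1 (c *: h) = `|c| * norm1 h.
Proof. by rewrite /norm1 mulr_sumr; apply: eq_bigr => a _; rewrite mxE normrM. Qed.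

Lemma coord_norm1 n (h : 'rV[R]_n) a : `|h 0 a| <= norm1 h.
Proof. by rewrite /norm1 (bigD1 a)//= lerDl; exact: sumr_ge0. Qed.

Section one_field.
Context {n m : nat}.
Implicit Types (F : 'rV[R]_n -> 'rV[R]_m) (h k x : 'rV[R]_n).

Lemma smooth_differentiable F : smooth F -> forall x, differentiable F x.
Proof. by move=> /(_ 1%N)[]. Qed.

Lemma smooth_derive F v : smooth F -> smooth (fun x => 'D_v F x).
Proof. by move=> sF r; have [_] := sF r.+1; exact. Qed.

Lemma smooth_continuous F : smooth F -> continuous F.
Proof. exact (fun sF => sF 0%N). Qed.

Lemma smooth_derivable F x v : smooth F -> derivable F x v.
Proof. by move=> /smooth_differentiable/(_ x)/diff_derivable. Qed.

Lemma derive_dirD F x h k : smooth F -> 'D_(h + k) F x = 'D_h F x + 'D_k F x.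
Proof.
by move=> /smooth_differentiable dF; rewrite !deriveEjacobian// mulmxDl.
Qed.

Lemma derive_dirZ F x c h : smooth F -> 'D_(c *: h) F x = c *: 'D_h F x.
Proof.
by move=> /smooth_differentiable dF; rewrite !deriveEjacobian// scalemxAl.
Qed.

Lemma derive_basis F x h : smooth F ->
  'D_h F x = \sum_a h 0 a *: 'D_(delta_mx 0 a) F x.
Proof.
move=> /smooth_differentiable dF; rewrite deriveEjacobian//.
rewrite [in LHS](row_sum_delta h) mulmx_suml.
by apply: eq_bigr => a _; rewrite -scalemxAl deriveEjacobian.
Qed.

Lemma derive_comb (I : finType) (c : I -> R) (G : I -> 'rV[R]_n -> 'rV[R]_m) x v :
  (forall i, smooth (G i)) ->
  'D_v (fun y => \sum_i c i *: G i y) x = \sum_i c i *: 'D_v (G i) x.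
Proof.
move=> sG; suff H (s : seq I) : is_derive x v (fun y => \sum_(i <- s) c i *: G i y)
    (\sum_(i <- s) c i *: 'D_v (G i) x).
  by have [] := H (index_enum I).
elim: s => [|i s IHs].
  rewrite big_nil [X in is_derive _ _ X](_ : _ = cst 0); last first.
    by apply/funext => y; rewrite big_nil.
  exact: is_derive_cst.
rewrite big_cons [X in is_derive _ _ X](_ : _ =
    (c i \*: G i) + (fun y => \sum_(j <- s) c j *: G j y)); last first.
  by apply/funext => y; rewrite big_cons.
apply: is_deriveD; apply: is_deriveZ; apply: derivableP.
exact: smooth_derivable.
Qed.

Lemma chain_rule F (g : R -> 'rV[R]_n) t d : smooth F -> is_derive t (1 : R) g d ->
  is_derive t (1 : R) (fun s => F (g s)) ('D_d F (g t)).
Proof.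
move=> sF [dg gd].
have dg' : differentiable g t by apply/derivable1_diffP.
have dF := smooth_differentiable sF (g t).
have dFg : differentiable (F \o g) t by apply: differentiable_comp.
split; first exact/derivable1_diffP.
rewrite -[LHS]/('D_1 (F \o g) t) deriveE// diff_comp//= deriveE//.
by rewrite -gd deriveE.
Qed.

Lemma line_derive F x h t : smooth F ->
  is_derive t (1 : R) (fun s => F (x + s *: h)) ('D_h F (x + t *: h)).
Proof.
move=> sF; apply: chain_rule => //.
apply: (is_derive_eq (is_derive1D (is_derive1_cst x t) _)); last exact: add0r.
have -> : (fun s : R => s *: h) = ( *:%R^~ h) by [].
have dh : differentiable ( *:%R^~ h : R -> _) t by [].
split; first exact/derivable1_diffP.
by rewrite deriveE// diff_val scale1r.
Qed.

(** Taylor estimates along a segment need only repeated derivatives in one direction, so multilinear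
    higher derivatives are avoided. *)
Fixpoint iterD h r F : 'rV[R]_n -> 'rV[R]_m :=
  if r is r'.+1 then iterD h r' (fun x => 'D_h F x) else F.

Lemma iterDS h r F : iterD h r.+1 F = (fun x => 'D_h (iterD h r F) x).
Proof. by elim: r F => [//|r IHr] F; rewrite -[LHS]/(iterD h r.+1 _) IHr. Qed.

Lemma smooth_iterD h r F : smooth F -> smooth (iterD h r F).
Proof. by elim: r F => [//|r IHr] F sF; apply: IHr; exact: smooth_derive. Qed.

Lemma iterD_comb h r (I : finType) (c : I -> R) (G : I -> 'rV[R]_n -> 'rV[R]_m) :
  (forall i, smooth (G i)) ->
  iterD h r (fun y => \sum_i c i *: G i y) = (fun y => \sum_i c i *: iterD h r (G i) y).
Proof.
elim: r G => [//|r IHr] G sG /=.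
have -> : (fun x => 'D_h (fun y => \sum_i c i *: G i y) x) =
    (fun x => \sum_i c i *: 'D_h (G i) x).
  by apply/funext => x; exact: derive_comb.
by apply: IHr => i; exact: smooth_derive.
Qed.

Lemma smooth_bounded F (M : R) : smooth F ->
  exists2 C : R, 0 <= C & forall x, `|x| <= M -> forall j, `|F x 0 j| <= C.
Proof.
move=> /smooth_continuous cF.
have cB : compact [set x : 'rV[R]_n | `|x| <= M].
  apply: bounded_closed_compact.
    by exists M; split; [exact: num_real|move=> N MN x /= /le_trans; apply; exact: ltW].
  have -> : [set x : 'rV[R]_n | `|x| <= M] = (fun x => `|x|) @^-1` [set y | y <= M] by [].
  by apply: closed_comp => [x _|]; [exact: norm_continuous|exact: closed_le].
have /compact_bounded[N [_ NP]] := continuous_compact (continuous_subspaceT cF) cB.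
exists (Num.max 0 (N + 1)); first by rewrite le_max lexx.
move=> x xM j; apply: (le_trans (norm_mx_coord _ _ _)).
rewrite le_max; apply/orP; right; apply: (NP (N + 1)); first by rewrite ltrDl.
by exists x.
Qed.

(** The constant has to be uniform in the direction: the innermost derivative is expanded along the
    basis, and the induction hypothesis bounds the finitely many fields that appear. *)
Lemma iterD_bounded F r (M : R) : smooth F ->
  exists2 C : R, 0 <= C & forall h x, `|x| <= M -> forall j,
    `|iterD h r F x 0 j| <= C * norm1 h ^+ r.
Proof.
elim: r F => [|r IHr] F sF.
  have [C C0 CP] := smooth_bounded M sF; exists C => // h x xM j.
  by rewrite expr0 mulr1 CP.
have H a : exists C : R, 0 <= C /\ forall h x, `|x| <= M -> forall j,
    `|iterD h r (fun y => 'D_(delta_mx 0 a) F y) x 0 j| <= C * norm1 h ^+ r.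
  by have [C C0 CP] := IHr _ (smooth_derive (delta_mx 0 a) sF); exists C.
have [C CP] := choice H.
have C0 a : 0 <= C a by have [] := CP a.
exists (\sum_a C a) => [|h x xM j]; first exact: sumr_ge0.
rewrite /=.
have -> : (fun x => 'D_h F x) = (fun x => \sum_a h 0 a *: 'D_(delta_mx 0 a) F x).
  by apply/funext => y; exact: derive_basis.
rewrite iterD_comb; last by move=> a; exact: smooth_derive.
rewrite summxE mulr_suml; apply: (le_trans (ler_norm_sum _ _ _)).
apply: ler_sum => a _; rewrite scalemxE normrM exprS mulrCA ler_pM//.
  exact: coord_norm1.
by have [_] := CP a; exact.
Qed.

Let bound_from_derive (f f' : R -> R) (C : R) :
  (forall t, is_derive t (1 : R) f (f' t)) -> f 0 = 0 ->
  (forall t, 0 <= t <= 1 -> `|f' t| <= C) -> forall t, 0 <= t <= 1 -> `|f t| <= C.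
Proof.
move=> df f0 fC t /andP[t0 t1].
have [//|c ct e] := @MVT_segment _ f f' 0 t t0 (fun t _ => df t).
  apply: derivable_within_continuous => s _; have [] := df s; exact.
move: e; rewrite f0 !subr0 => ->; move: ct; rewrite in_itv/= => /andP[c0 ct].
rewrite normrM (ger0_norm t0); apply: (@le_trans _ _ (`|f' c| * 1)).
  by rewrite ler_wpM2l.
by rewrite mulr1 fC// c0 (le_trans ct).
Qed.

(** Three mean value bounds in a row. The constant C in place of C / 6 is harmless, as only the
    order of the remainder matters. *)
Let taylor1d (f f1 f2 f3 : R -> R) (C : R) :
  (forall t, is_derive t (1 : R) f (f1 t)) ->
  (forall t, is_derive t (1 : R) f1 (f2 t)) ->
  (forall t, is_derive t (1 : R) f2 (f3 t)) ->
  (forall t, 0 <= t <= 1 -> `|f3 t| <= C) ->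
  `|f 1 - f 0 - f1 0 - f2 0 / 2| <= C.
Proof.
move=> d0 d1 d2 f3C.
have b2 := bound_from_derive (f := fun t => f2 t - f2 0) (f' := f3) _ _ f3C.
have {}b2 : forall t, 0 <= t <= 1 -> `|f2 t - f2 0| <= C.
  apply: b2; last by rewrite subrr.
  move=> t; apply: (is_derive_eq (is_derive1B (d2 t) (is_derive1_cst _ t))).
  by rewrite subr0.
have b1 : forall t, 0 <= t <= 1 -> `|f1 t - f1 0 - t * f2 0| <= C.
  apply: (bound_from_derive (f' := fun t => f2 t - f2 0)) => //.
    move=> t; apply: (is_derive_eq (is_derive1B
      (is_derive1B (d1 t) (is_derive1_cst _ t))
      (is_derive1M (is_derive_id t 1) (is_derive1_cst (f2 0) t)))).
    by rewrite /=; ring.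
  by ring.
have b0 : forall t, 0 <= t <= 1 -> `|f t - f 0 - t * f1 0 - t * t * (f2 0 / 2)| <= C.
  apply: (bound_from_derive (f' := fun t => f1 t - f1 0 - t * f2 0)) => //.
    move=> t; apply: (is_derive_eq (is_derive1B (is_derive1B
      (is_derive1B (d0 t) (is_derive1_cst _ t))
      (is_derive1M (is_derive_id t 1) (is_derive1_cst (f1 0) t)))
      (is_derive1M (is_derive1M (is_derive_id t 1) (is_derive_id t 1))
         (is_derive1_cst (f2 0 / 2) t)))).
    by rewrite /=; field.
  by ring.
by have := b0 1; rewrite lexx ler01 !mul1r => /(_ isT).
Qed.

Let segment_ball x h M t : 0 <= t <= 1 -> `|x| <= M -> `|x + h| <= M ->
  `|x + t *: h| <= M.
Proof.
move=> /andP[t0 t1] xM xhM.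
have -> : x + t *: h = (1 - t) *: x + t *: (x + h).
  by rewrite scalerDr scalerBl scale1r addrA subrK.
apply: (le_trans (ler_normD _ _)); rewrite !normrZ (ger0_norm t0).
rewrite (ger0_norm (x := 1 - t)) ?subr_ge0//.
have h1 : (1 - t) * `|x| <= (1 - t) * M by rewrite ler_wpM2l// subr_ge0.
have h2 : t * `|x + h| <= t * M by rewrite ler_wpM2l.
lra.
Qed.

Lemma smooth_lipschitz F (M : R) : smooth F ->
  exists2 C : R, 0 <= C & forall x y, `|x| <= M -> `|y| <= M -> forall j,
    `|F y 0 j - F x 0 j| <= C * norm1 (y - x).
Proof.
move=> sF; have [C C0 CP] := iterD_bounded 1 M sF; exists C => // x y xM yM j.
have := bound_from_derive (f := fun t => F (x + t *: (y - x)) 0 j - F x 0 j)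
  (f' := fun t => 'D_(y - x) F (x + t *: (y - x)) 0 j) (C := C * norm1 (y - x)).
have xy : x + (y - x) = y by rewrite addrC subrK.
move=> H; have := H _ _ _ 1; rewrite scale1r xy lexx ler01; apply => //.
- move=> t; apply: (is_derive_eq (is_derive1B _ (is_derive1_cst _ t))); last exact: subr0.
  exact: (is_derive_mxP _ _ _ _).1 (line_derive x (y - x) t sF) 0 j.
- by rewrite scale0r addr0 subrr.
- move=> t t01; have yM' : `|x + (y - x)| <= M by rewrite xy.
  by have := CP (y - x) _ (segment_ball t01 xM yM') j; rewrite expr1; exact.
Qed.

Lemma smooth_taylor F (M : R) : smooth F ->
  exists2 C : R, 0 <= C & forall x h, `|x| <= M -> `|x + h| <= M -> forall j,
    `|F (x + h) 0 j - F x 0 j - 'D_h F x 0 j - 'D_h (fun y => 'D_h F y) x 0 j / 2|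
      <= C * norm1 h ^+ 3.
Proof.
move=> sF; have [C C0 CP] := iterD_bounded 3 M sF; exists C => // x h xM xhM j.
have ld r t : is_derive t (1 : R) (fun s => iterD h r F (x + s *: h) 0 j)
    (iterD h r.+1 F (x + t *: h) 0 j).
  rewrite iterDS.
  exact: (is_derive_mxP _ _ _ _).1 (line_derive x h t (smooth_iterD h r sF)) 0 j.
have := @taylor1d _ _ _ _ (C * norm1 h ^+ 3) (ld 0%N) (ld 1%N) (ld 2%N).
rewrite !scale1r !scale0r !addr0 /=; apply => t t01.
exact: CP (segment_ball t01 xM xhM) j.
Qed.

Lemma derive2_basis F x h k : smooth F ->
  'D_k (fun y => 'D_h F y) x = \sum_b \sum_a (k 0 b * h 0 a) *:
    'D_(delta_mx 0 b) (fun y => 'D_(delta_mx 0 a) F y) x.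
Proof.
move=> sF; rewrite derive_basis; last exact: smooth_derive.
apply: eq_bigr => b _.
have -> : (fun y => 'D_h F y) = (fun y => \sum_a h 0 a *: 'D_(delta_mx 0 a) F y).
  by apply/funext => y; exact: derive_basis.
rewrite derive_comb; last by move=> a; exact: smooth_derive.
by rewrite scaler_sumr; apply: eq_bigr => a _; rewrite scalerA.
Qed.

End one_field.
End smooth_fields.

(** * Expansion of the end-point map *)

Section perturbation.
Context {R : realType}.

Lemma cvg_rV {T : Type} (F : set_system T) {FF : Filter F} (n : nat)
    (x : T -> 'rV[R]_n) (l : 'rV[R]_n) :
  (forall j, (fun t => x t 0 j) @ F --> l 0 j) -> x @ F --> l.
Proof.
move=> h; apply/cvgrPdist_le => e e0.
have : \forall t \near F, forall j, `|l 0 j - x t 0 j| <= e.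
  by apply: filter_forall => j; exact: (cvgrPdist_le _ _).1 (h j) e e0.
apply: filterS => t ht; rewrite [leLHS]/Num.Def.normr/= mx_normrE.
by apply: bigmax_le => [|[i j] _ /=]; rewrite ?(ltW e0)// (ord1 i) !mxE.
Qed.

Lemma smooth_within (n m : nat) (F : 'rV[R]_n -> 'rV[R]_m) (a b : R)
    (x : R -> 'rV[R]_n) : smooth F ->
  (forall j, {within `[a, b], continuous (fun t => x t 0 j)}) ->
  forall j, {within `[a, b], continuous (fun t => F (x t) 0 j)}.
Proof.
move=> sF cx j t.
have cxt : {for t, continuous (x : subspace `[a, b] -> _)}.
  by apply: cvg_rV => i; exact: cx.
apply: (@continuous_comp _ _ _ (fun t : subspace `[a, b] => F (x t)) (fun y : 'rV[R]_m => y 0 j)).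
  by apply: (@continuous_comp _ _ _ (x : subspace `[a, b] -> _) F) => //; exact: smooth_continuous.
exact: coord_continuous.
Qed.

Lemma norm_rV_le (n : nat) (x : 'rV[R]_n) (M : R) : 0 <= M ->
  (`|x| <= M) <-> (forall j, `|x 0 j| <= M).
Proof.
move=> M0; split=> [xM j|h]; first exact: le_trans (norm_mx_coord x 0 j) xM.
rewrite [leLHS]/Num.Def.normr/= mx_normrE.
by apply: bigmax_le => // -[i j] _ /=; rewrite (ord1 i).
Qed.

(** Composing with this truncation of the coordinates makes a smooth field globally Lipschitz.
    Solutions of the truncated equation are then shown to stay where the truncation is the
    identity. *)
Definition clamp {n : nat} (M : R) (x : 'rV[R]_n) : 'rV[R]_n :=
  \row_j Num.max (- M) (Num.min M (x 0 j)).

Lemma clamp_norm n M (x : 'rV[R]_n) : 0 <= M -> `|clamp M x| <= M.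
Proof.
move=> M0; apply/norm_rV_le => // j.
rewrite mxE ler_norml le_max lexx/= ge_max ge_min lexx andbT; lra.
Qed.

Lemma clamp_id n M (x : 'rV[R]_n) : `|x| <= M -> clamp M x = x.
Proof.
move=> xM; apply/rowP => j; rewrite mxE.
have := le_trans (norm_mx_coord x 0 j) xM; rewrite ler_norml => /andP[h1 h2].
by rewrite (min_idPr h2) (max_idPr h1).
Qed.

Lemma clamp_lipschitz n M (x y : 'rV[R]_n) :
  norm1 (clamp M x - clamp M y) <= norm1 (x - y).
Proof.
apply: ler_sum => j _; rewrite !mxE; move: (x 0 j) (y 0 j) => {x y} x y.
have min_lip (s t : R) : `|Num.min M s - Num.min M t| <= `|s - t|.
  rewrite /Num.min; case: ltP => h1; case: ltP => h2; rewrite ?subrr ?normr0//.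
  - by rewrite ger0_norm; [rewrite ger0_norm; lra|lra].
  - by rewrite ler0_norm; [rewrite ler0_norm; lra|lra].
have max_lip (s t : R) : `|Num.max (- M) s - Num.max (- M) t| <= `|s - t|.
  rewrite /Num.max; case: ltP => h1; case: ltP => h2; rewrite ?subrr ?normr0//.
  - by rewrite ger0_norm; [rewrite ger0_norm; lra|lra].
  - by rewrite ler0_norm; [rewrite ler0_norm; lra|lra].
exact: le_trans (max_lip _ _) (min_lip _ _).
Qed.

Lemma clamp_within n M (a b : R) (x : R -> 'rV[R]_n) :
  (forall j, {within `[a, b], continuous (fun t => x t 0 j)}) ->
  forall j, {within `[a, b], continuous (fun t => clamp M (x t) 0 j)}.
Proof.
move=> cx j; have lip y z : `|clamp M z 0 j - clamp M y 0 j| <= `|z 0 j - y 0 j|.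
  have := clamp_lipschitz M (\row_(i < 1) z 0 j) (\row_(i < 1) y 0 j).
  by rewrite /norm1 !big_ord1 !mxE.
apply/subspace_continuousP => t tab; apply/cvgrPdist_lt => e e0.
move: (cx j) => /subspace_continuousP /(_ t tab)/cvgrPdist_lt /(_ e e0).
by apply: filterS => s; exact: le_lt_trans (lip _ _).
Qed.

(** With D the sum of the squares of the components of d, the function (D + eta^2) exp (- K (t - a))
    is non-increasing. Squares are used because they remain absolutely continuous with an explicit
    derivative. The constant is uniform in the curve and in [eta], which will be 0 for uniqueness
    and of order s^3 for perturbations. *)
Lemma gronwall (n : nat) (a b L : R) : 0 <= L ->
  exists2 C : R, 0 <= C & forall (d d' : R -> 'rV[R]_n) (eta : R), 0 <= eta ->
    acd a b d d' -> d a = 0 ->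
    ae_on a b (fun t => forall j, `|d' t 0 j| <= L * norm1 (d t) + eta) ->
    forall t, a <= t <= b -> forall j, `|d t 0 j| <= C * eta.
Proof.
(* With N the sum norm of d, the derivative of D is at most 2 N (L N + eta), hence at most (2 L + 1)
   N^2 + eta^2, and N^2 <= n D. The last summand 1 absorbs eta^2. *)
move=> L0; pose K := (2 * L + 1) * n%:R + 1.
have K0 : 0 <= K by rewrite /K addr_ge0// mulr_ge0//; lra.
exists (expR (K * (b - a))) => [|d d' eta eta0 hd da hd' t tab j]; first exact: expR_ge0.
move/acd_rVP : hd => hd.
pose D t := \sum_i d t 0 i * d t 0 i.
pose D' t := \sum_i (d' t 0 i * d t 0 i + d t 0 i * d' t 0 i).
have hD : acd a b D D' by apply: acd_sum => i; exact: acdM.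
have N2 s : norm1 (d s) ^+ 2 <= n%:R * D s.
  rewrite expr2 /norm1 mulr_suml.
  apply: (@le_trans _ _ (\sum_(i < n) \sum_(l < n) (d s 0 i ^+ 2 + d s 0 l ^+ 2) / 2)).
    apply: ler_sum => i _; rewrite mulr_sumr; apply: ler_sum => l _.
    rewrite -(real_normK (num_real (d s 0 i))) -(real_normK (num_real (d s 0 l))).
    by have := sqr_ge0 (`|d s 0 i| - `|d s 0 l|); rewrite !expr2; lra.
  have -> : \sum_(i < n) \sum_(l < n) (d s 0 i ^+ 2 + d s 0 l ^+ 2) / 2 = n%:R * D s.
    under eq_bigr do rewrite -mulr_suml big_split/= sumr_const card_ord.
    rewrite -mulr_suml big_split/= sumr_const card_ord sumrMnl mulr_natl.
    by rewrite -[X in X / 2]mulr2n -[X in X / 2](mulr_natr _ 2) mulfK ?pnatr_eq0.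
  exact: lexx.
have D0 s : 0 <= D s by apply: sumr_ge0 => i _; rewrite -expr2 sqr_ge0.
pose G t := - ((D t + eta ^+ 2) * expR ((- K) * (t - a))).
have hE := acd_exp a b (- K) a 1.
have hG := acdZ (- 1) (acdM (acdD hD (acd_cst a b (eta ^+ 2))) hE).
have GG h := acd_homo hG h (lexx a).
case/andP: (tab) => at_ tb.
have {}GG h := GG t h at_ tb.
have : - 1 * ((D a + eta ^+ 2) * (1 * expR ((- K) * (a - a)))) <=
    - 1 * ((D t + eta ^+ 2) * (1 * expR ((- K) * (t - a)))).
  apply: GG; apply: ae_on1 hd' => s _ hs.
  have D's : D' s <= 2 * (norm1 (d s) * (L * norm1 (d s) + eta)).
    rewrite /D' {1}/norm1 mulr_suml mulr_sumr; apply: ler_sum => i _.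
    apply: (le_trans (ler_norm _)).
    have -> : d' s 0 i * d s 0 i + d s 0 i * d' s 0 i = 2 * (d s 0 i * d' s 0 i) by ring.
    rewrite !normrM ger0_norm// ler_wpM2l// ler_wpM2l//.
  have e0 := expR_ge0 ((- K) * (s - a)).
  have N0 := norm1_ge0 (d s).
  have h1 : D' s <= K * (D s + eta ^+ 2).
    apply: (le_trans D's); have := N2 s; have := D0 s.
    have h3 : 0 <= (norm1 (d s) - eta) ^+ 2 by exact: sqr_ge0.
    have h4 : 0 <= (2 * L + 1) * (n%:R * D s - norm1 (d s) ^+ 2).
      by rewrite mulr_ge0 ?subr_ge0//; lra.
    have h5 : 0 <= (2 * L + 1) * n%:R * eta ^+ 2.
      by rewrite mulr_ge0 ?sqr_ge0// mulr_ge0//; lra.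
    rewrite /K; rewrite !expr2 in h3 h4 h5 *; lra.
  have : 0 <= (K * (D s + eta ^+ 2) - D' s) * expR ((- K) * (s - a)).
    by rewrite mulr_ge0 ?subr_ge0.
  lra.
rewrite subrr mulr0 expR0 {1}/D da.
under eq_bigr do rewrite mxE mulr0.
rewrite sumr_const mul0rn add0r !mulN1r lerN2 !mul1r mulr1 => h1.
have h2 : D t <= eta ^+ 2 * expR (K * (b - a)).
  have h3 : D t + eta ^+ 2 <= eta ^+ 2 * expR (K * (t - a)).
    move: h1; rewrite mulNr expRN -[X in _ <= X]mulr1 => h1.
    have h4 := expR_gt0 (K * (t - a)).
    by move: h1; rewrite mulr1 ler_pdivrMr.
  apply: (@le_trans _ _ (eta ^+ 2 * expR (K * (t - a)))).
    by apply: le_trans h3; rewrite lerDl sqr_ge0.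
  by rewrite ler_wpM2l ?sqr_ge0// ler_expR ler_wpM2l// lerB.
have E1 : 1 <= expR (K * (b - a)).
  by rewrite -expR0 ler_expR mulr_ge0// subr_ge0 (le_trans at_ tb).
rewrite -(@ler_pXn2r _ 2)// ?nnegrE ?mulr_ge0 ?expR_ge0//.
rewrite real_normK ?num_real//.
apply: (@le_trans _ _ (D t)).
  by rewrite /D (bigD1 j)//= expr2 lerDl; apply: sumr_ge0 => i _; rewrite -expr2 sqr_ge0.
apply: (le_trans h2); rewrite exprMn mulrC ler_wpM2r ?sqr_ge0// expr2 ler_peMr// expR_ge0.
Qed.

(** Taylor's formula at h = s g1 + s^2 g2, sorted by powers of s: [T] is the coefficient of s^2, and
    the constant is uniform in the base point, the directions and s, so that it holds along a whole
    curve. *)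
Lemma field_expansion (n m : nat) (F : 'rV[R]_n -> 'rV[R]_m) (M G : R) :
  smooth F -> exists2 K : R, 0 <= K & forall (x g1 g2 : 'rV[R]_n) (s : R),
    `|s| <= 1 -> `|x| <= M -> `|x + (s *: g1 + s ^+ 2 *: g2)| <= M ->
    norm1 g1 <= G -> norm1 g2 <= G -> forall j,
    let T := 'D_g2 F x 0 j + 'D_g1 (fun y => 'D_g1 F y) x 0 j / 2 in
    `|F (x + (s *: g1 + s ^+ 2 *: g2)) 0 j - F x 0 j - s * 'D_g1 F x 0 j - s ^+ 2 * T|
      <= K * `|s| ^+ 3 /\ `|T| <= K.
Proof.
move=> sF.
have [C3 C30 C3P] := smooth_taylor M sF.
have [C1 C10 C1P] := iterD_bounded 1 M sF.
have [C2 C20 C2P] := iterD_bounded 2 M sF.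
have Hc (ba : 'I_n * 'I_n) : exists C : R, 0 <= C /\ forall x, `|x| <= M -> forall j,
    `|'D_(delta_mx 0 ba.1) (fun y => 'D_(delta_mx 0 ba.2) F y) x 0 j| <= C.
  have [C C0 CP] := smooth_bounded M (smooth_derive (delta_mx 0 ba.1)
    (smooth_derive (delta_mx 0 ba.2) sF)).
  by exists C.
have [c cP] := choice Hc.
have c0 ba : 0 <= c ba by have [] := cP ba.
pose Cq : R := \sum_(ba : 'I_n * 'I_n) c ba.
have Cq0 : 0 <= Cq by exact: sumr_ge0.
pose G' : R := `|G|.
have G'0 : 0 <= G' by exact: normr_ge0.
(* The summands bound, in this order, the Taylor remainder (h has sum norm at most 2 G' |s|), the
   three mixed terms of order s^3 in the quadratic form at h, and the two parts of [T]. *)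
pose K : R := C3 * (2 * G') ^+ 3 + Cq * (3 * G' ^+ 2) + C1 * G' + C2 * G' ^+ 2.
have K1 : 0 <= C3 * (2 * G') ^+ 3 by rewrite mulr_ge0// exprn_ge0// mulr_ge0.
have K2 : 0 <= Cq * (3 * G' ^+ 2) by rewrite !mulr_ge0// sqr_ge0.
have K3 : 0 <= C1 * G' by rewrite mulr_ge0.
have K4 : 0 <= C2 * G' ^+ 2 by rewrite mulr_ge0// sqr_ge0.
exists K => [|x g1 g2 s s1 xM xhM g1G g2G j T]; first by rewrite /K; lra.
have s0 := normr_ge0 s.
have {}g1G : norm1 g1 <= G' by exact: le_trans g1G (ler_norm _).
have {}g2G : norm1 g2 <= G' by exact: le_trans g2G (ler_norm _).
set h := s *: g1 + s ^+ 2 *: g2 in xhM *.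
have hG : norm1 h <= 2 * G' * `|s|.
  apply: (le_trans (norm1D _ _)); rewrite !norm1Z normrX.
  have h1 : `|s| * norm1 g1 <= `|s| * G' by rewrite ler_wpM2l.
  have h2 : `|s| ^+ 2 * norm1 g2 <= `|s| * G'.
    by rewrite ler_pM// ?sqr_ge0 ?norm1_ge0// expr2 ler_piMl.
  lra.
have half (y : R) : `|y / 2| <= `|y|.
  by rewrite normrM normfV (ger0_norm (x := 2))//; have := normr_ge0 y; lra.
split; last first.
  apply: (le_trans (ler_normD _ _)).
  have h1 := C1P g2 x xM j; have h2 := C2P g1 x xM j; rewrite /= expr1 in h1 h2.
  have h3 : C1 * norm1 g2 <= C1 * G' by rewrite ler_wpM2l.
  have h4 : C2 * norm1 g1 ^+ 2 <= C2 * G' ^+ 2.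
    by rewrite ler_wpM2l// lerXn2r ?nnegrE// norm1_ge0.
  have h5 : `|'D_g1 (fun y => 'D_g1 F y) x 0 j / 2| <= `|'D_g1 (fun y => 'D_g1 F y) x 0 j|.
    exact: half.
  rewrite /K; lra.
have Q2 : `|'D_h (fun y => 'D_h F y) x 0 j - s ^+ 2 * 'D_g1 (fun y => 'D_g1 F y) x 0 j|
    <= Cq * (3 * G' ^+ 2) * `|s| ^+ 3.
  rewrite !derive2_basis// !pair_bigA/= !summxE mulr_sumr -sumrB.
  rewrite /Cq !mulr_suml; apply: (le_trans (ler_norm_sum _ _ _)).
  apply: ler_sum => -[p r] _ /=; rewrite !scalemxE.
  set e := fun_of_matrix ('D_(delta_mx 0 p) _ _) _ _.
  have -> : h 0 p * h 0 r * e - s ^+ 2 * (g1 0 p * g1 0 r * e) =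
      e * (s ^+ 3 * (g1 0 p * g2 0 r + g2 0 p * g1 0 r + s * (g2 0 p * g2 0 r))).
    by rewrite /h !mxE; ring.
  have eC : `|e| <= c (p, r) by have [_] := cP (p, r); exact.
  rewrite normrM -[leRHS]mulrA ler_pM// normrM normrX mulrC ler_wpM2r ?exprn_ge0//.
  have P x1 x2 : `|x1| <= G' -> `|x2| <= G' -> `|x1 * x2| <= G' ^+ 2.
    by move=> h1 h2; rewrite normrM expr2 ler_pM.
  have B1 i : `|g1 0 i| <= G' by exact: le_trans (coord_norm1 _ _) g1G.
  have B2 i : `|g2 0 i| <= G' by exact: le_trans (coord_norm1 _ _) g2G.
  have h3 : `|s * (g2 0 p * g2 0 r)| <= G' ^+ 2.
    rewrite normrM; apply: le_trans (P _ _ (B2 p) (B2 r)); exact: ler_piMl.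
  apply: (le_trans (ler_normD _ _)).
  apply: (le_trans (lerD (ler_normD _ _) (lexx _))).
  have := P _ _ (B1 p) (B2 r); have := P _ _ (B2 p) (B1 r); lra.
have := C3P x h xM xhM j.
have -> : 'D_h F x 0 j = s * 'D_g1 F x 0 j + s ^+ 2 * 'D_g2 F x 0 j.
  by rewrite /h (derive_dirD x _ _ sF) (derive_dirZ x s g1 sF) (derive_dirZ x (s ^+ 2) g2 sF)
    addmxE !scalemxE.
move=> h1.
have alg (A B d1 d2 e e1 : R) : A - B - s * d1 - s ^+ 2 * (d2 + e1 / 2) =
  (A - B - (s * d1 + s ^+ 2 * d2) - e / 2) + (e - s ^+ 2 * e1) / 2 by field.
rewrite /T (alg _ _ _ _ ('D_h (fun y => 'D_h F y) x 0 j)).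
apply: (le_trans (ler_normD _ _)).
have h2 : C3 * norm1 h ^+ 3 <= C3 * (2 * G') ^+ 3 * `|s| ^+ 3.
  by rewrite -mulrA -exprMn ler_wpM2l// lerXn2r ?nnegrE ?norm1_ge0// !mulr_ge0.
have h3 : 0 <= `|s| ^+ 3 by rewrite exprn_ge0.
have h4 : 0 <= C1 * G' * `|s| ^+ 3 by rewrite mulr_ge0.
have h5 : 0 <= C2 * G' ^+ 2 * `|s| ^+ 3 by rewrite mulr_ge0.
have h6 : 0 <= Cq * (3 * G' ^+ 2) * `|s| ^+ 3 by rewrite mulr_ge0.
apply: (le_trans (lerD (le_trans h1 h2) (le_trans (half _) Q2))).
rewrite /K 3!mulrDl; lra.
Qed.

End perturbation.

(** * Existence, uniqueness and perturbation of trajectories *)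

Section control_systems.
Context {R : realType} {n k : nat}.
Context (X : 'I_k -> 'rV[R]_n -> 'rV[R]_n) (sX : forall i, smooth (X i)).

Definition mbounded_ctl (u : R -> 'rV[R]_k) := forall i, mbounded (fun t => u t 0 i).

Lemma Linfty_mbounded (a b : R) (u : R -> 'rV[R]_k) : Linfty a b u ->
  exists2 v, mbounded_ctl v & ae_on a b (fun t => u t = v t).
Proof.
move=> /LinftyP lu.
have H i : exists v, mbounded v /\ ae_on a b (fun t => u t 0 i = v t).
  by have [v] := Linf_mbounded (lu i); exists v.
have [v vP] := choice H; exists (fun t => \row_i v i t).
  move=> i; have [mv _] := vP i; congr mbounded: mv.
  by apply/funext => t; rewrite mxE.
apply: ae_on1 (ae_on_forall (fun i => proj2 (vP i))) => t _ h.
by apply/rowP => i; rewrite mxE h.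
Qed.

Lemma mbounded_ctl_bound (u : R -> 'rV[R]_k) : mbounded_ctl u ->
  exists2 M : R, 0 <= M & forall t i, `|u t 0 i| <= M.
Proof.
move=> mu.
have H i : exists M : R, 0 <= M /\ forall t, `|u t 0 i| <= M.
  by have [_ [M M0 MP]] := mu i; exists M.
have [M MP] := choice H.
have M0 i : 0 <= M i by have [] := MP i.
exists (\sum_i M i) => [|t i]; first exact: sumr_ge0.
by apply: (le_trans (proj2 (MP i) t)); rewrite (bigD1 i)//= lerDl sumr_ge0.
Qed.

Lemma within_rV_bounded (a b : R) (q : R -> 'rV[R]_n) :
  (forall j, {within `[a, b], continuous (fun t => q t 0 j)}) ->
  exists2 M : R, 0 <= M & forall t, a <= t <= b -> `|q t| <= M /\ norm1 (q t) <= M.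
Proof.
move=> cq.
have H j : exists M : R, 0 <= M /\ forall t, a <= t <= b -> `|q t 0 j| <= M.
  by have [M M0 MP] := within_bounded (cq j); exists M.
have [M MP] := choice H.
have M0 i : 0 <= M i by have [] := MP i.
have S0 : 0 <= \sum_i M i by exact: sumr_ge0.
exists (\sum_i M i) => // t tab; split.
  apply/norm_rV_le => // i; apply: (le_trans (proj2 (MP i) t tab)).
  by rewrite (bigD1 i)//= lerDl sumr_ge0.
by apply: ler_sum => i _; exact: (proj2 (MP i)).
Qed.

Lemma acd_rVZ (a b c : R) (f df : R -> 'rV[R]_n) : acd a b f df ->
  acd a b (fun t => c *: f t) (fun t => c *: df t).
Proof.
move=> /acd_rVP h; apply/acd_rVP => j.
apply: acd_ae (acd_eq _ (acdZ c (h j))) => [|t _]; last by rewrite mxE.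
by apply: ae_onT => t _; rewrite mxE.
Qed.

Lemma acd_rV_within (a b : R) (f df : R -> 'rV[R]_n) : acd a b f df ->
  forall j, {within `[a, b], continuous (fun t => f t 0 j)}.
Proof. by move=> /acd_rVP h j; exact: acd_within (h j). Qed.

Lemma derive_coord_Linf (a b : R) (q x : R -> 'rV[R]_n) i :
  (forall j, {within `[a, b], continuous (fun t => q t 0 j)}) ->
  (forall j, {within `[a, b], continuous (fun t => x t 0 j)}) ->
  forall j, Linf a b (fun t => 'D_(x t) (X i) (q t) 0 j).
Proof.
move=> cq cx j.
have : Linf a b (fun t => \sum_c x t 0 c * 'D_(delta_mx 0 c) (X i) (q t) 0 j).
  apply: Linf_sum => c; apply: LinfM; first exact: Linf_within (cx c).
  by apply: Linf_within; apply: (smooth_within (smooth_derive _ (sX i)) cq).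
apply: Linf_ext => t _; rewrite (derive_basis (q t) (x t) (sX i)) summxE.
by apply: eq_bigr => c _; rewrite scalemxE.
Qed.

Let comb_sub (c : 'I_k -> R) (P Q : 'I_k -> 'rV[R]_n) (r : 'rV[R]_n) j :
  (\sum_i c i *: P i + r) 0 j - (\sum_i c i *: Q i + r) 0 j =
  \sum_i c i * (P i - Q i) 0 j.
Proof.
rewrite !mxE opprD addrACA subrr addr0 !summxE -sumrB.
by apply: eq_bigr => i _; rewrite !mxE mulrBr.
Qed.

Let defect_sum (c w : 'I_k -> R) (Xp Xq D1 D2 Q : 'I_k -> 'rV[R]_n) (s : R) j :
  (\sum_i (c i + s * w i) *: Xp i) 0 j -
  (\sum_i c i *: Xq i + (s *: (\sum_i c i *: D1 i + \sum_i w i *: Xq i) +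
   s ^+ 2 *: (\sum_i c i *: D2 i +
     (\sum_i c i *: (2^-1 *: Q i) + \sum_i w i *: D1 i)))) 0 j =
  \sum_i ((c i + s * w i) *
      (Xp i 0 j - Xq i 0 j - s * D1 i 0 j - s ^+ 2 * (D2 i 0 j + Q i 0 j / 2)) +
    s ^+ 3 * (w i * (D2 i 0 j + Q i 0 j / 2))).
Proof.
rewrite !mxE !summxE !mulrDr !mulr_sumr -!big_split/= -sumrB.
by apply: eq_bigr => i _; rewrite !mxE; field.
Qed.

Let defect_bound (s w c A T K M N : R) : `|w| <= M -> `|c| <= N ->
  `|A| <= K * `|s| ^+ 3 -> `|T| <= K ->
  `|w * A + s ^+ 3 * (c * T)| <= (M + N) * K * `|s| ^+ 3.
Proof.
move=> wM cN h1 h2; apply: (le_trans (ler_normD _ _)).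
rewrite (normrM w) (normrM (s ^+ 3)) normrX (normrM c).
have s3 : 0 <= `|s| ^+ 3 by rewrite exprn_ge0.
have h3 : `|w| * `|A| <= M * (K * `|s| ^+ 3) by rewrite ler_pM.
have h4 : `|s| ^+ 3 * (`|c| * `|T|) <= `|s| ^+ 3 * (N * K).
  by rewrite ler_wpM2l// ler_pM.
lra.
Qed.

(** [picard_exists] asks for a Lipschitz bound at every time. The control is therefore replaced by
    an everywhere bounded representative, and the equation is carried back almost everywhere. *)
Lemma linear_ode (a b : R) (u : R -> 'rV[R]_k) (q r : R -> 'rV[R]_n) (x0 : 'rV[R]_n) :
  a <= b -> Linfty a b u ->
  (forall j, {within `[a, b], continuous (fun t => q t 0 j)}) ->
  (forall j, Linf a b (fun t => r t 0 j)) ->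
  exists x, acd a b x (fun t => \sum_i u t 0 i *: 'D_(x t) (X i) (q t) + r t)
    /\ x a = x0.
Proof.
move=> ab /Linfty_mbounded[v mv uv] cq lr.
have [Mv Mv0 MvP] := mbounded_ctl_bound mv.
have [Mq Mq0 MqP] := within_rV_bounded cq.
have H i : exists C : R, 0 <= C /\ forall h x, `|x| <= Mq -> forall j,
    `|'D_h (X i) x 0 j| <= C * norm1 h.
  by have [C C0 CP] := iterD_bounded 1 Mq (sX i); exists C.
have [C CP] := choice H.
have C0 i : 0 <= C i by have [] := CP i.
have [//||||x [hx xa]] := @picard_exists R n a b (Mv * \sum_i C i)
  (fun t x => \sum_i v t 0 i *: 'D_x (X i) (q t) + r t) x0.
- by rewrite mulr_ge0// sumr_ge0.
- move=> x cx j.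
  have : Linf a b (fun t => \sum_i v t 0 i * 'D_(x t) (X i) (q t) 0 j + r t 0 j).
    apply: LinfD => //; apply: Linf_sum => i; apply: LinfM.
      exact: mbounded_Linf.
    exact: derive_coord_Linf.
  apply: Linf_ext => t _; rewrite addmxE summxE; congr (_ + _).
  by apply: eq_bigr => i _; rewrite scalemxE.
- move=> t x y j tab.
  rewrite (comb_sub (v t 0) (fun i => 'D_x (X i) (q t)) (fun i => 'D_y (X i) (q t)) (r t)).
  apply: (le_trans (ler_norm_sum _ _ _)).
  rewrite -mulrA mulr_suml mulr_sumr; apply: ler_sum => i _; rewrite normrM ler_pM//.
  have -> : 'D_x (X i) (q t) - 'D_y (X i) (q t) = 'D_(x - y) (X i) (q t).
    by rewrite -(scaleN1r y) (derive_dirD _ x _ (sX i)) (derive_dirZ _ _ y (sX i)) scaleN1r.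
  apply: (le_trans (proj2 (CP i) _ _ (proj1 (MqP t tab)) j)).
  by rewrite ler_wpM2l//; apply: ler_sum => c _; rewrite addmxE oppmxE.
exists x; split => //; apply: acd_ae hx; apply: ae_on1 uv => t _ ->.
by [].
Qed.

(** The fields are Lipschitz only on bounded sets, but both curves stay in a common ball; there
    Gronwall's estimate applies with [eta] equal to 0. *)
Lemma trajectory_unique (a b : R) (u : R -> 'rV[R]_k) (g h : R -> 'rV[R]_n) :
  Linfty a b u -> trajectory X a b u g -> trajectory X a b u h -> g a = h a ->
  forall t, a <= t <= b -> g t = h t.
Proof.
move=> /Linfty_mbounded[v mv uv] hg hh gha t tab.
have [Mv Mv0 MvP] := mbounded_ctl_bound mv.
have [Mg Mg0 MgP] := within_rV_bounded (acd_rV_within hg).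
have [Mh Mh0 MhP] := within_rV_bounded (acd_rV_within hh).
pose M := Mg + Mh.
have H i : exists C : R, 0 <= C /\ forall x y, `|x| <= M -> `|y| <= M -> forall j,
    `|X i y 0 j - X i x 0 j| <= C * norm1 (y - x).
  by have [C C0 CP] := smooth_lipschitz M (sX i); exists C.
have [C CP] := choice H.
have C0 i : 0 <= C i by have [] := CP i.
have L0 : 0 <= Mv * \sum_i C i by rewrite mulr_ge0// sumr_ge0.
have [K K0 KP] := gronwall n a b L0.
have hd := acdD hg (acd_rVZ (- 1) hh).
have := KP _ _ 0 (lexx 0) hd; rewrite gha scaleN1r subrr mulr0 => /(_ erefl) E.
apply/rowP => j; apply/eqP; rewrite -subr_eq0 -normr_le0.
have : forall j : 'I_n, `|(g t + -1 *: h t) 0 j| <= 0.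
  apply: E => //; apply: ae_on1 uv => s /andP[as_ sb] us l.
  have sab : a <= s <= b by rewrite !ltW.
  have [gM _] := MgP s sab; have [hM _] := MhP s sab.
  rewrite addr0 us !scaleN1r -sumrN -big_split/= summxE.
  apply: (le_trans (ler_norm_sum _ _ _)); rewrite -mulrA mulr_suml mulr_sumr.
  apply: ler_sum => i _; rewrite !mxE -mulrBr normrM ler_pM//.
  apply: (proj2 (CP i)); first by apply: (le_trans hM); rewrite /M lerDr.
  by apply: (le_trans gM); rewrite /M lerDl.
by move=> /(_ j); rewrite !mxE mulN1r.
Qed.

(** This and [jet_field2] are the coefficients of s and s^2 in the formal expansion of the sum of
    (u_i + s du_i) X_i(q + s g1 + s^2 g2). The factor 1 / 2 is that of Taylor's formula, as g2 is
    half of a second derivative in s. *)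
Definition jet_field1 (u du : R -> 'rV[R]_k) (q g1 : R -> 'rV[R]_n) (t : R) :=
  \sum_i u t 0 i *: 'D_(g1 t) (X i) (q t) + \sum_i du t 0 i *: X i (q t).

Definition jet_field2 (u du : R -> 'rV[R]_k) (q g1 g2 : R -> 'rV[R]_n) (t : R) :=
  \sum_i u t 0 i *: 'D_(g2 t) (X i) (q t) +
  (\sum_i u t 0 i *: (2^-1 *: 'D_(g1 t) (fun y => 'D_(g1 t) (X i) y) (q t)) +
   \sum_i du t 0 i *: 'D_(g1 t) (X i) (q t)).

Lemma jet_curves (a b : R) (u du : R -> 'rV[R]_k) (q : R -> 'rV[R]_n) :
  a <= b -> Linfty a b u -> Linfty a b du ->
  (forall j, {within `[a, b], continuous (fun t => q t 0 j)}) ->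
  exists g1 g2, [/\ acd a b g1 (jet_field1 u du q g1), g1 a = 0,
    acd a b g2 (jet_field2 u du q g1 g2) & g2 a = 0].
Proof.
move=> ab lu ldu cq.
have lu' := (LinftyP a b u).1 lu; have ldu' := (LinftyP a b du).1 ldu.
have [g1 [hg1 g1a]] := linear_ode (r := fun t => \sum_i du t 0 i *: X i (q t)) 0 ab lu cq
  (ltac:(move=> j;
   have : Linf a b (fun t => \sum_i du t 0 i * X i (q t) 0 j);
   [by apply: Linf_sum => i; apply: LinfM => //; apply: Linf_within; exact: smooth_within (sX i) cq j|
    by apply: Linf_ext => t _; rewrite summxE; apply: eq_bigr => i _; rewrite mxE])).
have cg1 := acd_rV_within hg1.
have l2 i j : Linf a b (fun t => 'D_(g1 t) (fun y => 'D_(g1 t) (X i) y) (q t) 0 j).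
  have : Linf a b (fun t => \sum_c \sum_d (g1 t 0 c * g1 t 0 d) *
      'D_(delta_mx 0 c) (fun y => 'D_(delta_mx 0 d) (X i) y) (q t) 0 j).
    apply: Linf_sum => c; apply: Linf_sum => d; apply: LinfM.
      by apply: LinfM; apply: Linf_within; exact: cg1.
    apply: Linf_within.
    exact: smooth_within (smooth_derive _ (smooth_derive _ (sX i))) cq j.
  apply: Linf_ext => t _; rewrite (derive2_basis (q t) _ _ (sX i)) summxE.
  apply: eq_bigr => c _; rewrite summxE; apply: eq_bigr => d _.
  by rewrite [RHS]scalemxE.
have [|g2 [hg2 g2a]] := linear_ode (r := fun t =>
   \sum_i u t 0 i *: (2^-1 *: 'D_(g1 t) (fun y => 'D_(g1 t) (X i) y) (q t)) +
   \sum_i du t 0 i *: 'D_(g1 t) (X i) (q t)) 0 ab lu cq.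
  move=> j; have : Linf a b (fun t =>
     \sum_i u t 0 i * (2^-1 * 'D_(g1 t) (fun y => 'D_(g1 t) (X i) y) (q t) 0 j) +
     \sum_i du t 0 i * 'D_(g1 t) (X i) (q t) 0 j).
    apply: LinfD; apply: Linf_sum => i; apply: LinfM => //.
      by apply: LinfM => //; exact: Linf_cst.
    exact: derive_coord_Linf.
  apply: Linf_ext => t _; rewrite addmxE !summxE; congr (_ + _).
    by apply: eq_bigr => i _; rewrite !scalemxE.
  by apply: eq_bigr => i _; rewrite scalemxE.
by exists g1, g2.
Qed.

(** The truncated system has a solution on the whole interval. The curve q + s g1 + s^2 g2 satisfies
    the perturbed equation up to a defect of order s^3, so Gronwall's estimate keeps the solution
    close to it; for small s the solution stays inside the ball where nothing was truncated. *)
Lemma perturbed_trajectory (a b : R) (u du : R -> 'rV[R]_k) (q g1 g2 : R -> 'rV[R]_n) :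
  a <= b -> mbounded_ctl u -> mbounded_ctl du -> trajectory X a b u q ->
  acd a b g1 (jet_field1 u du q g1) -> g1 a = 0 ->
  acd a b g2 (jet_field2 u du q g1 g2) -> g2 a = 0 ->
  exists2 C : R, 0 <= C & exists2 s0 : R, 0 < s0 & forall s, `|s| <= s0 ->
    exists g, [/\ trajectory X a b (fun t => u t + s *: du t) g, g a = q a &
      forall t, a <= t <= b -> forall j,
        `|(g t - (q t + (s *: g1 t + s ^+ 2 *: g2 t))) 0 j| <= C * `|s| ^+ 3].
Proof.
move=> ab mu mdu hq hg1 g1a hg2 g2a.
have [Mu Mu0 MuP] := mbounded_ctl_bound mu.
have [Md Md0 MdP] := mbounded_ctl_bound mdu.
have [Mq Mq0 MqP] := within_rV_bounded (acd_rV_within hq).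
have [G1 G10 G1P] := within_rV_bounded (acd_rV_within hg1).
have [G2 G20 G2P] := within_rV_bounded (acd_rV_within hg2).
(* [Mq + 2 * G] bounds the approximate curve for |s| <= 1; the extra 1 leaves room for the distance
   of the solution from it. *)
pose G := G1 + G2; pose M := Mq + 2 * G + 1.
have G0 : 0 <= G by exact: addr_ge0.
have M0 : 0 <= M by rewrite /M; lra.
have HL i : exists C : R, 0 <= C /\ forall x y, `|x| <= M -> `|y| <= M -> forall j,
    `|X i y 0 j - X i x 0 j| <= C * norm1 (y - x).
  by have [C C0 CP] := smooth_lipschitz M (sX i); exists C.
have [CL CLP] := choice HL.
have CL0 i : 0 <= CL i by have [] := CLP i.
have HK i : exists K : R, 0 <= K /\ forall (x g1 g2 : 'rV[R]_n) (s : R),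
    `|s| <= 1 -> `|x| <= M -> `|x + (s *: g1 + s ^+ 2 *: g2)| <= M ->
    norm1 g1 <= G -> norm1 g2 <= G -> forall j,
    let T := 'D_g2 (X i) x 0 j + 'D_g1 (fun y => 'D_g1 (X i) y) x 0 j / 2 in
    `|X i (x + (s *: g1 + s ^+ 2 *: g2)) 0 j - X i x 0 j - s * 'D_g1 (X i) x 0 j - s ^+ 2 * T|
      <= K * `|s| ^+ 3 /\ `|T| <= K.
  by have [K K0 KP] := field_expansion M G (sX i); exists K.
have [K KP] := choice HK.
have K0 i : 0 <= K i by have [] := KP i.
pose L := (Mu + Md) * \sum_i CL i.
have L0 : 0 <= L by rewrite mulr_ge0 ?addr_ge0 ?sumr_ge0.
pose E := \sum_i (Mu + Md + Md) * K i.
have E0 : 0 <= E by apply: sumr_ge0 => i _; rewrite mulr_ge0// !addr_ge0.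
have [Cg Cg0 CgP] := gronwall n a b L0.
pose p s t := q t + (s *: g1 t + s ^+ 2 *: g2 t).
have pM (s t : R) : `|s| <= 1 -> a <= t <= b -> `|p s t| <= Mq + 2 * G.
  move=> s1 tab; have [h1 _] := MqP t tab; have [h2 _] := G1P t tab; have [h3 _] := G2P t tab.
  apply: (le_trans (ler_normD _ _)); apply: (le_trans (lerD h1 (ler_normD _ _))).
  rewrite lerD2l.
  have h4 : `|s *: g1 t| <= G1 by rewrite normrZ (le_trans _ h2)// ler_piMl.
  have h5 : `|s ^+ 2 *: g2 t| <= G2.
    have s2 : `|s ^+ 2| <= 1 by rewrite normrX expr_le1.
    by rewrite normrZ (le_trans _ h3)// ler_piMl.
  rewrite /G; lra.
exists (Cg * E); first by rewrite mulr_ge0.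
(* This bound on s makes the error [Cg * E * |s|^3] at most 1, the room left in [M]. *)
exists (Num.min 1 (1 + Cg * E)^-1).
  by rewrite lt_min ltr01/= invr_gt0 ltr_pwDl// mulr_ge0.
move=> s; rewrite le_min => /andP[s1 s2].
have CE1 : 0 < 1 + Cg * E by rewrite ltr_pwDl// mulr_ge0.
have Cs : Cg * E * `|s| ^+ 3 <= 1.
  have h1 : `|s| ^+ 3 <= `|s| by rewrite exprS ler_piMr// expr_le1.
  have h2 : `|s| * (1 + Cg * E) <= 1 by rewrite -ler_pdivlMr// mul1r.
  have h3 : 0 <= Cg * E by rewrite mulr_ge0.
  apply: (@le_trans _ _ (Cg * E * `|s|)); first by rewrite ler_wpM2l.
  have := normr_ge0 s; lra.
have mw i : mbounded (fun t => u t 0 i + s * du t 0 i).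
  by apply: mboundedD => //; apply: mboundedM => //; exact: mbounded_cst.
have wM t i : `|u t 0 i + s * du t 0 i| <= Mu + Md.
  apply: (le_trans (ler_normD _ _)); rewrite lerD// normrM.
  by rewrite (le_trans _ (MdP t i))// ler_piMl.
pose f t (x : 'rV[R]_n) := \sum_i (u t 0 i + s * du t 0 i) *: X i (clamp M x).
have fL t x y j : `|f t x 0 j - f t y 0 j| <= L * norm1 (x - y).
  rewrite /f !summxE -sumrB; apply: (le_trans (ler_norm_sum _ _ _)).
  rewrite /L -mulrA mulr_suml mulr_sumr; apply: ler_sum => i _.
  rewrite !mxE -mulrBr normrM ler_pM//.
  apply: (le_trans (proj2 (CLP i) _ _ (clamp_norm _ M0) (clamp_norm _ M0) j)).
  by rewrite ler_wpM2l// clamp_lipschitz.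
have [||g [hg ga]] := @picard_exists R n a b L f (q a) ab L0.
- move=> x cx j.
  have : Linf a b (fun t => \sum_i (u t 0 i + s * du t 0 i) * X i (clamp M (x t)) 0 j).
    apply: Linf_sum => i; apply: LinfM; first exact: mbounded_Linf.
    by apply: Linf_within; apply: (smooth_within (sX i)); exact: clamp_within.
  apply: Linf_ext => t _; rewrite /f summxE.
  by apply: eq_bigr => i _; rewrite [in RHS]mxE.
- move=> t x y j _; apply: (le_trans (fL t x y j)).
  by rewrite ler_wpM2l// /norm1; apply: ler_sum => c _; rewrite !mxE.
have hp := acdD hq (acdD (acd_rVZ s hg1) (acd_rVZ (s ^+ 2) hg2)).
have hd := acdD hg (acd_rVZ (- 1) hp).
have est : forall t, a <= t <= b -> forall j, `|(g t + -1 *: p s t) 0 j| <= Cg * (E * `|s| ^+ 3).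
  apply: (CgP _ _ (E * `|s| ^+ 3) _ hd).
  - by rewrite mulr_ge0// exprn_ge0.
  - by rewrite ga g1a g2a !scaler0 !addr0 scaleN1r subrr.
  apply: ae_onT => t /andP[at_ tb] j; have tab : a <= t <= b by rewrite !ltW.
  rewrite scaleN1r addmxE oppmxE.
  have -> : f t (g t) 0 j = (f t (g t) 0 j - f t (p s t) 0 j) + f t (p s t) 0 j by rewrite subrK.
  rewrite -addrA; apply: (le_trans (ler_normD _ _)); apply: lerD.
    by rewrite scaleN1r; exact: fL.
  have pM' : `|p s t| <= M by apply: (le_trans (pM s t s1 tab)); rewrite /M lerDl.
  have [qM _] := MqP t tab; have [_ g1M] := G1P t tab; have [_ g2M] := G2P t tab.
  have {}qM : `|q t| <= M by apply: (le_trans qM); rewrite /M; lra.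
  have {}g1M : norm1 (g1 t) <= G by apply: (le_trans g1M); rewrite /G lerDl.
  have {}g2M : norm1 (g2 t) <= G by apply: (le_trans g2M); rewrite /G lerDr.
  rewrite /f (clamp_id pM') /jet_field1 /jet_field2.
  rewrite (defect_sum (u t 0) (du t 0) (fun i => X i (p s t)) (fun i => X i (q t))
    (fun i => 'D_(g1 t) (X i) (q t)) (fun i => 'D_(g2 t) (X i) (q t))
    (fun i => 'D_(g1 t) (fun y => 'D_(g1 t) (X i) y) (q t))).
  rewrite /E mulr_suml; apply: (le_trans (ler_norm_sum _ _ _)); apply: ler_sum => i _.
  have [_ KPi] := KP i.
  have [h1 h2] := KPi (q t) (g1 t) (g2 t) s s1 qM pM' g1M g2M j.
  exact: (defect_bound (wM t i) (MdP t i) h1 h2).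
have gM t : a <= t <= b -> `|g t| <= M.
  move=> tab; have -> : g t = p s t + (g t + -1 *: p s t) by rewrite scaleN1r addrCA subrr addr0.
  apply: (le_trans (ler_normD _ _)); apply: lerD; first exact: pM.
  apply/norm_rV_le => // j; apply: (le_trans (est t tab j)).
  by rewrite mulrA.
exists g; split => //; last first.
  by move=> t tab j; rewrite -mulrA -scaleN1r; exact: est.
apply: acd_ae hg; apply: ae_onT => t /andP[at_ tb].
rewrite /f clamp_id; last by apply: gM; rewrite !ltW.
by apply: eq_bigr => i _; rewrite !mxE.
Qed.

End control_systems.

(** * The jets of the extended end-point map *)

Section jets_expansion.
Context {R : realType} {n k : nat}.
Context (X : 'I_k -> 'rV[R]_n -> 'rV[R]_n) (sX : forall i, smooth (X i)).
Notation mu := (@lebesgue_measure R).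

Lemma expansion_unique {V : normedModType R} (x y : V) :
  (forall e : R, 0 < e -> exists2 d : R, 0 < d &
     forall s, 0 < s -> s < d -> `|s *: x + s ^+ 2 *: y| <= e * s ^+ 2) ->
  x = 0 /\ y = 0.
Proof.
move=> H.
have x0 : x = 0.
  apply/eqP; rewrite -normr_le0; apply/ler_addgt0Pl => e e0; rewrite addr0.
  have [d d0 dP] := H 1 ltr01.
  have y1 : 0 < 1 + `|y| by rewrite ltr_pwDl.
  pose s := Num.min (d / 2) (e / (1 + `|y|)).
  have s0 : 0 < s by rewrite lt_min !divr_gt0.
  have sd : s < d by rewrite gt_min; apply/orP; left; lra.
  have := dP s s0 sd; rewrite mul1r.
  have -> : s *: x + s ^+ 2 *: y = s *: (x + s *: y) by rewrite scalerDr scalerA expr2.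
  rewrite normrZ (gtr0_norm s0) expr2 ler_pM2l// => h.
  have -> : x = (x + s *: y) - s *: y by rewrite addrK.
  apply: (le_trans (ler_normB _ _)); rewrite normrZ (gtr0_norm s0).
  apply: (@le_trans _ _ (s * (1 + `|y|))); first by rewrite mulrDr mulr1 lerD2r.
  by rewrite -ler_pdivlMr// ge_min lexx orbT.
split=> //; apply/eqP; rewrite -normr_le0; apply/ler_addgt0Pl => e e0; rewrite addr0.
have [d d0 dP] := H e e0.
have d2 : 0 < d / 2 by rewrite divr_gt0.
have dd : d / 2 < d by lra.
have := dP (d / 2) d2 dd; rewrite x0 scaler0 add0r normrZ.
rewrite (ger0_norm (x := (d / 2) ^+ 2)); last by rewrite exprn_ge0// ltW.
by rewrite mulrC ler_pM2r// exprn_gt0.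
Qed.

(** [jets] is chosen among all second-order expansions. Two of them differ by a polynomial in s that
    is negligible against s^2, so both of its coefficients vanish and any expansion computes the
    jets. *)
Lemma jets_unique (a : R) (q0 : 'rV[R]_n) (u : R -> 'rV[R]_k) (t : R)
    (du : R -> 'rV[R]_k) w1 w2 :
  End_expansion X a q0 u t du w1 w2 -> jets X a q0 u t du = (w1, w2).
Proof.
move=> h; have : End_expansion X a q0 u t du (jets X a q0 u t du).1 (jets X a q0 u t du).2.
  exact: (@getPex _ [set w | End_expansion X a q0 u t du w.1 w.2] (ex_intro _ (w1, w2) h)).
rewrite [RHS]surjective_pairing [LHS]surjective_pairing /=.
move: (jets X a q0 u t du) => [v1 v2] /= h'.
have [] := @expansion_unique _ (w1 - v1) (w2 - v2); last first.
  by move=> /subr0_eq -> /subr0_eq ->.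
move=> e e0; have e20 : 0 < e / 2 by rewrite divr_gt0.
move/eqoP: h => /(_ _ e20)/nbhs_ballP[d /= d0 dP].
move/eqoP: h' => /(_ _ e20)/nbhs_ballP[d' /= d'0 d'P].
exists (Num.min d d'); first by rewrite lt_min d0.
move=> s s0; rewrite lt_min => /andP[sd sd'].
have sB r : s < r -> ball 0 r s by rewrite /ball/= sub0r normrN gtr0_norm.
have := dP s (sB _ sd); have := d'P s (sB _ sd').
rewrite !(ger0_norm (x := s ^+ 2)) ?exprn_ge0 ?(ltW s0)//.
move: (End _ _ _ _ _ - End _ _ _ _ _) => A h1 h2.
have alg (V : zmodType) (D a1 a2 b1 b2 : V) :
    (a1 - b1) + (a2 - b2) = (D - b1 - b2) - (D - a1 - a2).
  by rewrite addrACA -opprD -(addrA D (- b1)) -(addrA D (- a1)) -!opprD opprB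
       [RHS]addrC addrA subrK.
rewrite !scalerBr (alg _ A).
apply: (le_trans (ler_normB _ _)).
rewrite (splitr e) mulrDl; exact: lerD.
Qed.

Lemma End_endpoint (a b : R) (w : R -> 'rV[R]_k) (q0 : 'rV[R]_n) (g : R -> 'rV[R]_n) :
  a <= b -> Linfty a b w -> trajectory X a b w g -> g a = q0 ->
  (End X a q0 b w).1 = g b.
Proof.
move=> ab lw hg ga; apply: xget_unique; first by exists g.
move=> y [h [hh ha <-]].
apply: (trajectory_unique sX lw hh hg); first by rewrite ha ga.
by rewrite ab lexx.
Qed.

(** The bilinear form whose diagonal is twice the energy; with u in one slot it gives c1, and half
    of its diagonal gives c2. *)
Definition cross_energy (a b : R) (v w : R -> 'rV[R]_k) : R :=
  \int[mu]_(t in `[a, b]) (\sum_i v t 0 i * w t 0 i).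

Lemma Linf_cross (a b : R) (v w : R -> 'rV[R]_k) : Linfty a b v -> Linfty a b w ->
  Linf a b (fun t => \sum_i v t 0 i * w t 0 i).
Proof.
by move=> /LinftyP lv /LinftyP lw; apply: Linf_sum => i; exact: LinfM.
Qed.

Lemma fine_energy (a b : R) (v : R -> 'rV[R]_k) : Linfty a b v ->
  fine (energy a b v) = cross_energy a b v v / 2.
Proof.
move=> lv; rewrite /energy fineM//; last first.
  by apply: integrable_fin_num => //; exact: (Linf_integrable (Linf_cross lv lv)).
by rewrite /= mulrC.
Qed.

Lemma LinftyD (a b : R) (v w : R -> 'rV[R]_k) (s : R) : Linfty a b v -> Linfty a b w ->
  Linfty a b (fun t => v t + s *: w t).
Proof.
move=> /LinftyP lv /LinftyP lw; apply/LinftyP => j.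
have := LinfD (lv j) (LinfM (Linf_cst a b s) (lw j)).
by apply: Linf_ext => t _; rewrite !mxE.
Qed.

Lemma energy_expansion (a b : R) (v w : R -> 'rV[R]_k) (s : R) :
  Linfty a b v -> Linfty a b w ->
  fine (energy a b (fun t => v t + s *: w t)) =
  fine (energy a b v) + s * cross_energy a b v w + s ^+ 2 * (cross_energy a b w w / 2).
Proof.
move=> lv lw; have lvw := LinftyD s lv lw.
have iC (v' w' : R -> 'rV[R]_k) : Linfty a b v' -> Linfty a b w' ->
    mu.-integrable `[a, b] (EFin \o (fun t => \sum_i v' t 0 i * w' t 0 i)).
  by move=> h1 h2; exact: (Linf_integrable (Linf_cross h1 h2)).
have iZ c (v' w' : R -> 'rV[R]_k) : Linfty a b v' -> Linfty a b w' ->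
    mu.-integrable `[a, b] (EFin \o (fun t => c * \sum_i v' t 0 i * w' t 0 i)).
  move=> h1 h2; apply: Linf_integrable.
  by apply: LinfM; [exact: Linf_cst|exact: Linf_cross].
rewrite !fine_energy//.
have -> : cross_energy a b (fun t => v t + s *: w t) (fun t => v t + s *: w t) =
    cross_energy a b v v + 2 * s * cross_energy a b v w + s ^+ 2 * cross_energy a b w w.
  rewrite /cross_energy -!RintegralZl ?iC// -RintegralD ?iC ?iZ// -RintegralD ?iZ//; last first.
    apply: Linf_integrable; apply: LinfD; first exact: Linf_cross.
    by apply: LinfM; [exact: Linf_cst|exact: Linf_cross].
  apply: eq_Rintegral => t _; rewrite !mulr_sumr -!big_split/=.
  by apply: eq_bigr => i _; rewrite !mxE; ring.
by field.
Qed.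

Lemma jetsE (a b : R) (u du : R -> 'rV[R]_k) (q g1 g2 : R -> 'rV[R]_n) :
  a <= b -> Linfty a b u -> Linfty a b du -> trajectory X a b u q ->
  acd a b g1 (jet_field1 X u du q g1) -> g1 a = 0 ->
  acd a b g2 (jet_field2 X u du q g1 g2) -> g2 a = 0 ->
  jets X a (q a) u b du =
  ((g1 b, cross_energy a b u du), (g2 b, cross_energy a b du du / 2)).
Proof.
move=> ab lu ldu hq hg1 g1a hg2 g2a; apply: jets_unique.
have [v mv uv] := Linfty_mbounded lu; have [dv mdv dudv] := Linfty_mbounded ldu.
have [|||C C0 [s0 s00 sP]] :=
  @perturbed_trajectory R n k X sX a b v dv q g1 g2 ab mv mdv _ _ g1a _ g2a.
- by apply: acd_ae hq; apply: ae_on1 uv => t _ ->.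
- by apply: acd_ae hg1; apply: ae_on2 uv dudv => t _; rewrite /jet_field1 => -> ->.
- by apply: acd_ae hg2; apply: ae_on2 uv dudv => t _; rewrite /jet_field2 => -> ->.
(* For |s| <= e / (C + 1) the remainder C |s|^3 is at most e |s|^2. *)
apply/eqoP => e e0; pose d := Num.min s0 (e / (C + 1)).
have C1 : 0 < C + 1 by rewrite ltr_wpDl.
have d0 : 0 < d by rewrite lt_min s00 divr_gt0.
apply/nbhs_ballP; exists d => // s /=; rewrite /ball/= sub0r normrN => sd.
have ss0 : `|s| <= s0 by apply: (le_trans (ltW sd)); rewrite ge_min lexx.
have se : `|s| <= e / (C + 1) by apply: (le_trans (ltW sd)); rewrite ge_min lexx orbT.
have [g [hg ga gP]] := sP s ss0.
have hg' : trajectory X a b (fun t => u t + s *: du t) g.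
  by apply: acd_ae hg; apply: ae_on2 uv dudv => t _ -> ->.
have E1 := End_endpoint ab (LinftyD s lu ldu) hg' ga.
have E0 := End_endpoint ab lu hq (erefl (q a)).
(* The energy is exactly quadratic in s, so the whole remainder sits in the end-point. *)
have -> : End X a (q a) b (fun t => u t + s *: du t) - End X a (q a) b u
    - s *: (g1 b, cross_energy a b u du) - s ^+ 2 *: (g2 b, cross_energy a b du du / 2) =
    (g b - (q b + (s *: g1 b + s ^+ 2 *: g2 b)), 0).
  rewrite [End X a _ b (fun t => _)]surjective_pairing E1.
  rewrite [End X a _ b u]surjective_pairing E0 /=.
  rewrite energy_expansion//; apply/pair_equal_spec; split => /=.
    by rewrite !opprD !addrA.
  by rewrite /GRing.scale/=; ring.
rewrite [leLHS]prod_normE /= normr0 ge_max.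
have es0 : 0 <= e * `|s ^+ 2| by rewrite mulr_ge0// ltW.
rewrite es0 andbT; apply/norm_rV_le => // j.
apply: (le_trans (gP b _ j)); first by rewrite ab lexx.
rewrite normrX exprS mulrA ler_wpM2r ?exprn_ge0//.
have h1 : `|s| * (C + 1) <= e by rewrite -ler_pdivlMr.
have := normr_ge0 s; lra.
Qed.

End jets_expansion.

(** * The second variation in adapted coordinates *)

Section within_continuity.
Context {R : realType} (a b : R).
Implicit Types f g : R -> R.
Notation wc f := {within `[a, b], continuous f}.

Lemma within_cst (c : R) : wc (fun _ => c).
Proof. by move=> x; exact: cvg_cst. Qed.

Lemma withinD f g : wc f -> wc g -> wc (fun t => f t + g t).
Proof. by move=> cf cg x; apply: cvgD; [exact: cf|exact: cg]. Qed.

Lemma withinM f g : wc f -> wc g -> wc (fun t => f t * g t).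
Proof. by move=> cf cg x; apply: cvgM; [exact: cf|exact: cg]. Qed.

Lemma within_ext f g : (forall t, a <= t <= b -> f t = g t) -> wc f -> wc g.
Proof.
move=> fg /subspace_continuousP cf; apply/subspace_continuousP => x xab.
have fgx : f x = g x by apply: fg; move: xab; rewrite /= in_itv.
apply/cvgrPdist_lt => e e0; move/cvgrPdist_lt: (cf x xab) => /(_ e e0).
rewrite !near_withinE; apply: filterS => t ht tab; have := ht tab.
by rewrite /from_subspace/= fgx fg//; move: tab; rewrite /= in_itv.
Qed.

Lemma within_sum (I : eqType) (s : seq I) (P : pred I) (f : I -> R -> R) :
  (forall i, wc (f i)) -> wc (fun t => \sum_(i <- s | P i) f i t).
Proof.
move=> cf; elim: s => [|i s IHs].
  by apply: within_ext (@within_cst 0) => t _; rewrite big_nil.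
apply: (@within_ext (fun t => (if P i then f i t else 0) + \sum_(j <- s | P j) f j t)).
  by move=> t _; rewrite big_cons; case: ifP => // _; rewrite add0r.
by apply: withinD => //; case: (P i); [exact: cf|exact: within_cst].
Qed.

Lemma within_prod (I : eqType) (s : seq I) (f : I -> R -> R) :
  (forall i, wc (f i)) -> wc (fun t => \prod_(i <- s) f i t).
Proof.
move=> cf; elim: s => [|i s IHs].
  by apply: within_ext (@within_cst 1) => t _; rewrite big_nil.
by apply: within_ext (withinM (cf i) IHs) => t _; rewrite big_cons.
Qed.

Lemma withinV f : (forall t, a <= t <= b -> f t != 0) -> wc f -> wc (fun t => (f t)^-1).
Proof.
move=> f0 /subspace_continuousP cf; apply/subspace_continuousP => x xab.
apply: cvgV; last exact: cf.
by apply: f0; move: xab; rewrite /= in_itv.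
Qed.

Lemma within_det (m : nat) (A : R -> 'M[R]_m) : (forall i j, wc (fun t => A t i j)) ->
  wc (fun t => \det (A t)).
Proof.
move=> cA; apply: within_sum => s; apply: withinM; first exact: within_cst.
exact: within_prod.
Qed.

(** Cramer's rule: cofactors and determinants are polynomials in the entries. *)
Lemma within_invmx (m : nat) (A : R -> 'M[R]_m) : (forall i j, wc (fun t => A t i j)) ->
  (forall t, a <= t <= b -> A t \in unitmx) -> forall i j, wc (fun t => invmx (A t) i j).
Proof.
move=> cA uA i j.
have : wc (fun t => (\det (A t))^-1 * cofactor (A t) j i).
  apply: withinM.
    apply: withinV; last exact: within_det.
    by move=> t tab; have := uA t tab; rewrite unitmxE unitfE.
  apply: withinM; first exact: within_cst.
  apply: within_det => i' j'; apply: within_ext (cA (lift j i') (lift i j')) => t _.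
  by rewrite !mxE.
by apply: within_ext => t tab; rewrite /invmx uA// !mxE.
Qed.

Lemma within_mulmx (m n p : nat) (A : R -> 'M[R]_(m, n)) (B : R -> 'M[R]_(n, p)) :
  (forall i j, wc (fun t => A t i j)) -> (forall i j, wc (fun t => B t i j)) ->
  forall i j, wc (fun t => (A t *m B t) i j).
Proof.
move=> cA cB i j.
have : wc (fun t => \sum_l A t i l * B t l j).
  by apply: within_sum => l; apply: withinM; [exact: cA|exact: cB].
by apply: within_ext => t _; rewrite mxE.
Qed.

End within_continuity.

Section linear_maps.
Context {R : realType}.

Lemma linear_comb (V W : lmodType R) (f : V -> W) (I : Type) (s : seq I) (c : I -> R)
    (x : I -> V) : linear f ->
  f (\sum_(i <- s) c i *: x i) = \sum_(i <- s) c i *: f (x i).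
Proof.
move=> lf; elim: s => [|i s IHs]; last by rewrite !big_cons lf IHs.
by rewrite !big_nil; have := lf (-1) 0 0; rewrite scaler0 add0r scaleN1r addNr.
Qed.

Lemma bilinear_basis (n : nat) (W : lmodType R) (B : 'rV[R]_n -> 'rV[R]_n -> W) v w :
  sym_bilinear B ->
  B v w = \sum_c \sum_d (v 0 c * w 0 d) *: B (delta_mx 0 c) (delta_mx 0 d).
Proof.
move=> [sB lB]; rewrite {1}(row_sum_delta v) (linear_comb _ _ _ (lB w)).
apply: eq_bigr => c _; rewrite sB {1}(row_sum_delta w) (linear_comb _ _ _ (lB _)).
by rewrite scaler_sumr; apply: eq_bigr => d _; rewrite scalerA sB.
Qed.

Lemma pairingE (n : nat) (v : 'rV[R]_n) (p : 'cV[R]_n) :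
  pairing v p = \sum_l v 0 l * p l 0.
Proof. by rewrite /pairing mxE. Qed.

Lemma pairingD (n : nat) (v w : 'rV[R]_n) (p : 'cV[R]_n) :
  pairing (v + w) p = pairing v p + pairing w p.
Proof. by rewrite /pairing mulmxDl mxE. Qed.

Lemma pairingZ (n : nat) (c : R) (v : 'rV[R]_n) (p : 'cV[R]_n) :
  pairing (c *: v) p = c * pairing v p.
Proof. by rewrite /pairing -scalemxAl mxE. Qed.

Lemma pairing_sum (n : nat) (I : Type) (s : seq I) (v : I -> 'rV[R]_n) (p : 'cV[R]_n) :
  pairing (\sum_(i <- s) v i) p = \sum_(i <- s) pairing (v i) p.
Proof. by rewrite /pairing mulmx_suml summxE. Qed.

End linear_maps.

(** * The characteristic cost as a bilinear form *)

Section second_variation.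
Context {R : realType} {n k : nat}.
Context (X : 'I_k -> 'rV[R]_n -> 'rV[R]_n) (sX : forall i, smooth (X i)).
Context (t0 t1 : R) (t01 : t0 < t1).
Context (u : R -> 'rV[R]_k) (q : R -> 'rV[R]_n).
Context (lu : Linfty t0 t1 u) (hq : trajectory X t0 t1 u q).
Context (Phi1 : R -> 'M[R]_n) (Phi2 : R -> 'rV[R]_n -> 'rV[R]_n -> 'rV[R]_n).
Context (hPhi1 : adapted1 X t0 t1 u q Phi1) (hPhi2 : adapted2 X t0 t1 u q Phi1 Phi2).
Context (psi0 : 'cV[R]_n).
Notation wc f := {within `[t0, t1], continuous f}.
Notation mu := (@lebesgue_measure R).
Notation e_ c := (delta_mx 0 c).

Lemma within_q j : wc (fun t => q t 0 j).
Proof. exact: acd_rV_within hq j. Qed.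

Lemma Phi1_unit t : t0 <= t <= t1 -> Phi1 t \in unitmx.
Proof. by move=> tab; have [+ _ _] := hPhi1; apply; rewrite in_itv. Qed.

Lemma Phi1_acd : acd t0 t1 Phi1 (fun t => 'D_1 Phi1 t).
Proof.
by have [_ h1 h2] := hPhi1; split=> //; apply: ae_on1 h2 => t _ [/derivableP].
Qed.

Lemma within_Phi1 i j : wc (fun t => Phi1 t i j).
Proof. exact: acd_within ((acd_mxP _ _ _ _).1 Phi1_acd i j). Qed.

Lemma Phi2_bilinear t : t0 <= t <= t1 -> sym_bilinear (Phi2 t).
Proof. by move=> tab; have [+ _ _ _] := hPhi2; apply; rewrite in_itv. Qed.

Lemma within_Phi2 v w l : wc (fun t => Phi2 t v w 0 l).
Proof.
have [_ _ /(_ v w) h _] := hPhi2.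
exact: abs_continuous_within ((abs_continuous_mxP _ _ _).1 h 0 l).
Qed.

Lemma within_X i j : wc (fun t => X i (q t) 0 j).
Proof. exact: smooth_within (sX i) within_q j. Qed.

Lemma within_DX i v j : wc (fun t => 'D_v (X i) (q t) 0 j).
Proof. exact: smooth_within (smooth_derive v (sX i)) within_q j. Qed.

Lemma within_Y1 i j : wc (fun t => Y1 X q Phi1 i t 0 j).
Proof.
apply: (within_mulmx (A := fun t => X i (q t))) => [l m|]; last exact: within_Phi1.
by rewrite (ord1 l); exact: within_X.
Qed.

(** Regularity of [Phi2] in time is available for fixed arguments only, so expressions with moving
    arguments are expanded along the standard basis. *)
Definition S2 (c d : 'I_n) (t : R) : R := pairing (Phi2 t (e_ c) (e_ d)) psi0.

Lemma within_S2 c d : wc (S2 c d).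
Proof.
have : wc (fun t => \sum_l Phi2 t (e_ c) (e_ d) 0 l * psi0 l 0).
  by apply: within_sum => l; apply: withinM; [exact: within_Phi2|exact: within_cst].
by apply: within_ext => t _; rewrite /S2 pairingE.
Qed.

Lemma Phi2E t v w : t0 <= t <= t1 ->
  pairing (Phi2 t v w) psi0 = \sum_c \sum_d v 0 c * w 0 d * S2 c d t.
Proof.
move=> /Phi2_bilinear bP; rewrite (bilinear_basis v w bP) pairing_sum.
apply: eq_bigr => c _; rewrite pairing_sum; apply: eq_bigr => d _.
by rewrite pairingZ.
Qed.

Definition DXpsi (i : 'I_k) (c : 'I_n) (t : R) : R :=
  pairing ('D_(e_ c) (X i) (q t) *m Phi1 t) psi0.

Lemma within_DXpsi i c : wc (DXpsi i c).
Proof.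
have h l : wc (fun t => ('D_(e_ c) (X i) (q t) *m Phi1 t) 0 l).
  apply: (within_mulmx (A := fun t => 'D_(e_ c) (X i) (q t))) => [r m|]; last exact: within_Phi1.
  by rewrite (ord1 r); exact: within_DX.
have : wc (fun t => \sum_l ('D_(e_ c) (X i) (q t) *m Phi1 t) 0 l * psi0 l 0).
  by apply: within_sum => l; apply: withinM; [exact: h|exact: within_cst].
by apply: within_ext => t _; rewrite /DXpsi pairingE.
Qed.

Lemma DXpsiE i t v :
  pairing ('D_v (X i) (q t) *m Phi1 t) psi0 = \sum_c v 0 c * DXpsi i c t.
Proof.
rewrite (derive_basis (q t) v (sX i)) mulmx_suml pairing_sum; apply: eq_bigr => c _.
by rewrite -scalemxAl pairingZ.
Qed.

(* The covector dual to the cost density: <Y2_i(t, b Phi1), psi0> = kap . b *)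
Definition kap (i : 'I_k) (c : 'I_n) (t : R) : R :=
  DXpsi i c t + \sum_d X i (q t) 0 d * S2 d c t.

Lemma within_kap i c : wc (kap i c).
Proof.
apply: withinD; first exact: within_DXpsi.
by apply: within_sum => d; apply: withinM; [exact: within_X|exact: within_S2].
Qed.

Lemma kapE i t v : t0 <= t <= t1 ->
  pairing ('D_v (X i) (q t) *m Phi1 t + Phi2 t (X i (q t)) v) psi0 =
  \sum_c v 0 c * kap i c t.
Proof.
move=> tab; rewrite pairingD DXpsiE Phi2E// exchange_big/= -big_split/=.
apply: eq_bigr => c _; rewrite /kap mulrDr; congr (_ + _).
by rewrite mulr_sumr; apply: eq_bigr => d _; rewrite mulrA (mulrC (v 0 c)).
Qed.

(** The covector [kap] transported by the inverse of [Phi1]: [kap] acts on tangent vectors, [yy] on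
    adapted coordinates. *)
Definition yy (i : 'I_k) (r : 'I_n) (t : R) : R :=
  \sum_c invmx (Phi1 t) r c * kap i c t.

Lemma within_yy i r : wc (yy i r).
Proof.
apply: within_sum => c; apply: withinM; last exact: within_kap.
by apply: within_invmx; [exact: within_Phi1|exact: Phi1_unit].
Qed.

Lemma Y2E i t w : t0 <= t <= t1 ->
  pairing (Y2 X q Phi1 Phi2 i t w) psi0 = \sum_r w 0 r * yy i r t.
Proof.
move=> tab; rewrite /Y2 kapE//.
under eq_bigr do rewrite mxE mulr_suml.
rewrite exchange_big/=; apply: eq_bigr => r _; rewrite /yy mulr_sumr.
by apply: eq_bigr => c _; rewrite mulrA.
Qed.

Definition zrate (v : R -> 'rV[R]_k) (j : 'I_n) (t : R) : R :=
  \sum_i v t 0 i * Y1 X q Phi1 i t 0 j.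

(** An explicit formula for the components of the curve that [q1] obtains by choice. As a primitive
    it depends linearly on the control. *)
Definition zcurve (v : R -> 'rV[R]_k) (j : 'I_n) (t : R) : R :=
  primitive t0 (zrate v j) t.

Definition ccurve (v : R -> 'rV[R]_k) (t : R) : R :=
  primitive t0 (fun t => \sum_i v t 0 i * u t 0 i) t.

Lemma Linf_zrate v j : Linfty t0 t1 v -> Linf t0 t1 (zrate v j).
Proof.
move=> /LinftyP lv; apply: Linf_sum => i; apply: LinfM => //.
exact/Linf_within/within_Y1.
Qed.

Lemma zcurve_acd v j : Linfty t0 t1 v -> acd t0 t1 (zcurve v j) (zrate v j).
Proof. by move=> lv; exact/primitive_Linf/Linf_zrate. Qed.

Lemma ccurve_acd v : Linfty t0 t1 v ->
  acd t0 t1 (ccurve v) (fun t => \sum_i v t 0 i * u t 0 i).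
Proof. by move=> lv; apply: primitive_Linf; exact: Linf_cross. Qed.

Lemma zcurve_start v j : zcurve v j t0 = 0.
Proof. exact: primitive_start. Qed.

Lemma q1E v : Linfty t0 t1 v -> forall t, t0 <= t <= t1 ->
  q1 X u q Phi1 t0 t1 v t = (\row_j zcurve v j t, ccurve v t).
Proof.
move=> lv; set P := [set z : R -> 'rV[R]_n * R | [/\ abs_continuous t0 t1 z, z t0 = 0 &
  ae_on t0 t1 (fun t => is_derive t 1 z (\sum_i v t ord0 i *: Y1 X q Phi1 i t,
           \sum_i v t ord0 i * u t ord0 i))]].
have Pz : P (fun t => (\row_j zcurve v j t, ccurve v t)).
  have [h1 h2] : acd t0 t1 (fun t => (\row_j zcurve v j t, ccurve v t))
     (fun t => (\sum_i v t 0 i *: Y1 X q Phi1 i t, \sum_i v t 0 i * u t 0 i)).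
    apply/acd_pairP; split => /=; last exact: ccurve_acd.
    apply/acd_rVP => j; apply: acd_ae (acd_eq _ (zcurve_acd j lv)).
      apply: ae_onT => t _; rewrite summxE /zrate; apply: eq_bigr => i _.
      by rewrite scalemxE.
    by move=> t _; rewrite mxE.
  split => //; congr pair; last exact: primitive_start.
  by apply/rowP => j; rewrite !mxE zcurve_start.
have [g1 g2 g3] := getI Pz.
have [/acd_rVP gz gc] := (acd_pairP _ _ _ _).1 (conj g1 g3 : acd t0 t1 (get P) _).
move=> t tab; rewrite /q1 -/P [LHS]surjective_pairing; congr pair.
  apply/rowP => j; rewrite mxE.
  apply: (acd_unique (gz j) (zcurve_acd j lv)) => //; last by rewrite g2 zcurve_start mxE.
  apply: ae_onT => s _; rewrite summxE /zrate; apply: eq_bigr => i _.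
  by rewrite scalemxE.
apply: (acd_unique gc (ccurve_acd lv)) => //; first exact: ae_onT.
by rewrite g2 /ccurve primitive_start.
Qed.

Definition density (w : R -> 'rV[R]_k) (i : 'I_k) (t : R) : R :=
  \sum_r zcurve w r t * yy i r t.

Lemma within_density w i : Linfty t0 t1 w -> wc (density w i).
Proof.
move=> lw; apply: within_sum => r; apply: withinM; last exact: within_yy.
exact: acd_within (zcurve_acd r lw).
Qed.

(** The argument [v] enters as a control and [w] only through its curve, so the form need not be
    symmetric; optimality sees its symmetrization. *)
Definition beta (v w : R -> 'rV[R]_k) : R :=
  \int[mu]_(t in `[t0, t1]) (\sum_i v t 0 i * density w i t).

Lemma Linf_beta v w : Linfty t0 t1 v -> Linfty t0 t1 w ->
  Linf t0 t1 (fun t => \sum_i v t 0 i * density w i t).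
Proof.
move=> /LinftyP lv lw; apply: Linf_sum => i; apply: LinfM => //.
exact/Linf_within/within_density.
Qed.

Lemma OCP_costE v : Linfty t0 t1 v ->
  OCP_cost X u q Phi1 Phi2 psi0 t0 t1 v = beta v v.
Proof.
move=> lv; apply: eq_Rintegral => t; rewrite inE/= in_itv/= => tab.
apply: eq_bigr => i _; congr (_ * _); rewrite (q1E lv tab)/= Y2E//.
by apply: eq_bigr => r _; rewrite mxE.
Qed.

Lemma Linfty_comb (c : R) (v w : R -> 'rV[R]_k) : Linfty t0 t1 v -> Linfty t0 t1 w ->
  Linfty t0 t1 (c *: v + w).
Proof.
by move=> lv lw; rewrite addrC; exact: (LinftyD c lw lv).
Qed.

Lemma primitive_comb (c : R) (r s p : R -> R) t : Linf t0 t1 r -> Linf t0 t1 s ->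
  (forall x, p x = c * r x + s x) -> t0 <= t <= t1 ->
  primitive t0 p t = c * primitive t0 r t + primitive t0 s t.
Proof.
move=> lr ls pE tab; have -> : p = (fun x => c * r x + s x) by exact/funext.
have lrs : Linf t0 t1 (fun x => c * r x + s x).
  by apply: LinfD => //; apply: LinfM => //; exact: Linf_cst.
apply: (acd_unique (primitive_Linf lrs)
  (acdD (acdZ c (primitive_Linf lr)) (primitive_Linf ls))) => //.
  exact: ae_onT.
by rewrite !primitive_start mulr0 addr0.
Qed.

Lemma zcurve_comb c v w j t : Linfty t0 t1 v -> Linfty t0 t1 w -> t0 <= t <= t1 ->
  zcurve (c *: v + w) j t = c * zcurve v j t + zcurve w j t.
Proof.
move=> lv lw; apply: primitive_comb; [exact: Linf_zrate|exact: Linf_zrate|].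
move=> x; rewrite /zrate mulr_sumr -big_split/=; apply: eq_bigr => i _.
by rewrite addmxE scalemxE; ring.
Qed.

Lemma ccurve_comb c v w t : Linfty t0 t1 v -> Linfty t0 t1 w -> t0 <= t <= t1 ->
  ccurve (c *: v + w) t = c * ccurve v t + ccurve w t.
Proof.
move=> lv lw; apply: primitive_comb; [exact: Linf_cross|exact: Linf_cross|].
move=> x; rewrite mulr_sumr -big_split/=; apply: eq_bigr => i _.
by rewrite addmxE scalemxE; ring.
Qed.

Lemma betaDl w : Linfty t0 t1 w -> linear_on (Linfty t0 t1) (beta^~ w).
Proof.
move=> lw c v v' lv lv'; have tt : t0 <= t1 <= t1 by rewrite lexx ltW.
apply: (primitive_comb (Linf_beta lv lw) (Linf_beta lv' lw)) => // x.
rewrite mulr_sumr -big_split/=; apply: eq_bigr => i _.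
by rewrite addmxE scalemxE; ring.
Qed.

Lemma betaDr v : Linfty t0 t1 v -> linear_on (Linfty t0 t1) (beta v).
Proof.
move=> lv c w w' lw lw'; have tt : t0 <= t1 <= t1 by rewrite lexx ltW.
rewrite /beta -(primitive_comb (c := c) (p := fun t => \sum_i v t 0 i *
   (c * density w i t + density w' i t)) (Linf_beta lv lw) (Linf_beta lv lw')) //; last first.
  move=> x; rewrite mulr_sumr -big_split/=; apply: eq_bigr => i _; ring.
apply: eq_Rintegral => t; rewrite inE/= in_itv/= => tab.
apply: eq_bigr => i _; congr (_ * _); rewrite /density mulr_sumr -big_split/=.
by apply: eq_bigr => r _; rewrite zcurve_comb//; ring.
Qed.

(* integration by parts moves the control out of the inner integral *)
Definition costate (e : R -> 'rV[R]_k) (r : 'I_n) (t : R) : R :=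
  primitive t0 (fun s => \sum_i e s 0 i * yy i r s) t1 -
  primitive t0 (fun s => \sum_i e s 0 i * yy i r s) t.

(** The function H of the overview. The first term comes from the slot where the varied control acts
    directly, the second from the slot where it acts through its curve. *)
Definition representer (e : R -> 'rV[R]_k) (i : 'I_k) (t : R) : R :=
  density e i t + \sum_r Y1 X q Phi1 i t 0 r * costate e r t.

Lemma Linf_yy e r : Linfty t0 t1 e -> Linf t0 t1 (fun s => \sum_i e s 0 i * yy i r s).
Proof.
move=> /LinftyP le; apply: Linf_sum => i; apply: LinfM => //.
exact/Linf_within/within_yy.
Qed.

Lemma costate_acd e r : Linfty t0 t1 e ->
  acd t0 t1 (costate e r) (fun s => - \sum_i e s 0 i * yy i r s).
Proof.
move=> le; have := acdB (acd_cst t0 t1 (primitive t0 (fun s => \sum_i e s 0 i * yy i r s) t1))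
  (primitive_Linf (Linf_yy r le)).
by apply: acd_ae; apply: ae_onT => t _; rewrite sub0r.
Qed.

Lemma within_representer e i : Linfty t0 t1 e -> wc (representer e i).
Proof.
move=> le; apply: withinD; first exact: within_density.
apply: within_sum => r; apply: withinM; first exact: within_Y1.
exact: acd_within (costate_acd r le).
Qed.

(** The sum over r of [zcurve v r] times [costate e r] vanishes at both ends: the curve at t0, the
    costate at t1. The integral of its derivative is thus 0, which rewrites [beta e v] as an
    integral of v against a function independent of v. *)
Lemma representerE e v : Linfty t0 t1 e -> Linfty t0 t1 v ->
  beta v e + beta e v = \int[mu]_(t in `[t0, t1]) (\sum_i v t 0 i * representer e i t).
Proof.
move=> le lv; have lv' := (LinftyP t0 t1 v).1 lv.
have tt : t0 <= t1 by rewrite ltW.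
have hF := acd_sum (fun r => acdM (zcurve_acd r lv) (costate_acd r le)).
have lG : Linf t0 t1 (fun t => \sum_i v t 0 i * (\sum_r Y1 X q Phi1 i t 0 r * costate e r t)).
  apply: Linf_sum => i; apply: LinfM => //; apply: Linf_within.
  apply: within_sum => r; apply: withinM; first exact: within_Y1.
  exact: acd_within (costate_acd r le).
have h : \int[mu]_(t in `[t0, t1]) (\sum_i v t 0 i * (\sum_r Y1 X q Phi1 i t 0 r * costate e r t)
     - \sum_i e t 0 i * density v i t) = 0.
  rewrite (Rintegral_acd tt _ (acd_ae _ hF)).
  - rewrite !big1 ?subrr// => r _; first by rewrite zcurve_start mul0r.
    by rewrite /costate subrr mulr0.
  - apply: LinfD => //; have := LinfM (Linf_cst t0 t1 (-1)) (Linf_beta le lv).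
    by apply: Linf_ext => t _; rewrite mulN1r.
  - apply: ae_onT => t _; rewrite big_split/=; congr (_ + _).
      rewrite /zrate; under eq_bigr do rewrite mulr_suml.
      rewrite exchange_big/=; apply: eq_bigr => i _; rewrite mulr_sumr.
      by apply: eq_bigr => r _; rewrite mulrA.
    under [LHS]eq_bigr do rewrite mulrN mulr_sumr.
    rewrite sumrN exchange_big/=; congr (- _); apply: eq_bigr => i _.
    by rewrite /density mulr_sumr; apply: eq_bigr => r _; ring.
have [iG ie] := (Linf_integrable lG, Linf_integrable (Linf_beta le lv)).
have ive := Linf_integrable (Linf_beta lv le).
move: h; rewrite RintegralB// => /subr0_eq h.
rewrite {2}/beta -h /beta -RintegralD//.
apply: eq_Rintegral => t _; rewrite -big_split/=; apply: eq_bigr => i _.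
by rewrite -mulrDr.
Qed.

End second_variation.

(** * The jets on a sub-interval and the characteristic problem *)

Section jets_and_costs.
Context {R : realType} {n k : nat}.
Context (X : 'I_k -> 'rV[R]_n -> 'rV[R]_n) (sX : forall i, smooth (X i)).
Context (t0 t1 : R) (t01 : t0 < t1).
Context (u : R -> 'rV[R]_k) (q : R -> 'rV[R]_n).
Context (lu : Linfty t0 t1 u) (hq : trajectory X t0 t1 u q).
Context (Phi1 : R -> 'M[R]_n) (Phi2 : R -> 'rV[R]_n -> 'rV[R]_n -> 'rV[R]_n).
Context (hPhi1 : adapted1 X t0 t1 u q Phi1) (hPhi2 : adapted2 X t0 t1 u q Phi1 Phi2).
Context (psi0 : 'cV[R]_n).
Notation mu := (@lebesgue_measure R).
Notation e_ c := (delta_mx 0 c).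
Notation S2 := (S2 Phi2 psi0).
Notation zcurve := (zcurve X t0 q Phi1).
Notation ccurve := (ccurve t0 u).
Notation density := (density X t0 q Phi1 Phi2 psi0).
Notation beta := (beta X t0 t1 q Phi1 Phi2 psi0).

(* The rate of change of <Phi2(t)[v, w], psi0> before symmetrization. *)
Definition S2rate (v w : 'rV[R]_n) (t : R) : R :=
  - \sum_i u t 0 i *
    (pairing ('D_v (fun x => 'D_w (X i) x) (q t) *m Phi1 t) psi0 +
     2 * pairing (Phi2 t ('D_v (X i) (q t)) w) psi0).

Lemma S2rate_basis v w t : t0 <= t <= t1 ->
  S2rate v w t = \sum_c \sum_d v 0 c * w 0 d * S2rate (e_ c) (e_ d) t.
Proof.
move=> tab; have bP := Phi2_bilinear hPhi2 tab.
have e1 i : pairing ('D_v (fun x => 'D_w (X i) x) (q t) *m Phi1 t) psi0 =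
    \sum_c \sum_d v 0 c * w 0 d *
      pairing ('D_(e_ c) (fun x => 'D_(e_ d) (X i) x) (q t) *m Phi1 t) psi0.
  rewrite (derive2_basis (q t) w v (sX i)) mulmx_suml pairing_sum.
  apply: eq_bigr => c _; rewrite mulmx_suml pairing_sum; apply: eq_bigr => d _.
  by rewrite -scalemxAl pairingZ.
have e2 i : pairing (Phi2 t ('D_v (X i) (q t)) w) psi0 =
    \sum_c \sum_d v 0 c * w 0 d *
      pairing (Phi2 t ('D_(e_ c) (X i) (q t)) (e_ d)) psi0.
  have [sB lB] := bP.
  rewrite (derive_basis (q t) v (sX i)) (linear_comb _ _ _ (lB w)) pairing_sum.
  apply: eq_bigr => c _; rewrite pairingZ sB {1}(row_sum_delta w).
  rewrite (linear_comb _ _ _ (lB _)) pairing_sum mulr_sumr; apply: eq_bigr => d _.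
  by rewrite pairingZ sB mulrA.
rewrite /S2rate; under eq_bigr do rewrite e1 e2.
under [RHS]eq_bigr do under eq_bigr do rewrite mulrN mulr_sumr -sumrN.
under [RHS]eq_bigr do rewrite exchange_big/=.
rewrite [RHS]exchange_big/= -sumrN; apply: eq_bigr => i _.
rewrite mulrDr !mulr_sumr -big_split/= -sumrN; apply: eq_bigr => c _.
rewrite !mulr_sumr -big_split/= -sumrN; apply: eq_bigr => d _.
by ring.
Qed.

Let P2 v t := pairing (Phi2 t v v) psi0.

Let P2_acd v : acd t0 t1 (P2 v) (S2rate v v).
Proof.
have [_ _ /(_ v v) h1 /(_ v) h2] := hPhi2.
have : acd t0 t1 (fun t => Phi2 t v v) (fun t => 'D_1 (fun s => Phi2 s v v) t).
  by split=> //; apply: ae_on1 h2 => t _ [/derivableP].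
move/acd_rVP => hP.
have := acd_sum (fun l => acdM (hP l) (acd_cst t0 t1 (psi0 l 0))).
move=> hs; apply: acd_ae (acd_eq _ hs) => [|t _]; last by rewrite /P2 pairingE.
apply: ae_on1 h2 => t _ [_ /eqP]; rewrite addr_eq0 => /eqP ->.
under eq_bigr do rewrite mulr0 addr0.
rewrite -pairingE -scaleN1r pairingZ mulN1r pairing_sum /S2rate; congr (- _).
apply: eq_bigr => i _; rewrite pairingZ pairingD; congr (_ * (_ + _)).
by rewrite mulr2n pairingD; ring.
Qed.

(** The equation for [Phi2] is given on the diagonal only; polarization recovers the mixed entries
    and symmetrizes the rate. *)
Lemma S2_acd c d : acd t0 t1 (S2 c d)
  (fun t => (S2rate (e_ c) (e_ d) t + S2rate (e_ d) (e_ c) t) / 2).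
Proof.
have h := acdZ 2^-1 (acdB (acdB (P2_acd (e_ c + e_ d)) (P2_acd (e_ c))) (P2_acd (e_ d))).
apply: acd_ae (acd_eq _ h) => [|t tab].
  apply: ae_onT => t /andP[ta tb]; have tab : t0 <= t <= t1 by rewrite !ltW.
  have addS v w : S2rate (v + w) (v + w) t =
      S2rate v v t + S2rate v w t + S2rate w v t + S2rate w w t.
    rewrite !(S2rate_basis _ _ tab) -!big_split/=; apply: eq_bigr => r _.
    rewrite -!big_split/=; apply: eq_bigr => s _.
    by rewrite !addmxE; ring.
  have alg (x y z w : R) : 2^-1 * (x + y + z + w - x - w) = (y + z) / 2 by field.
  by rewrite addS; exact: alg.
have [sB lB] := Phi2_bilinear hPhi2 tab.
have DB x y z : Phi2 t (x + y) z = Phi2 t x z + Phi2 t y z.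
  by have := lB z 1 x y; rewrite !scale1r.
rewrite /P2 DB pairingD (sB _ (_ + _)) DB pairingD (sB (e_ d) (_ + _)) DB pairingD.
have alg (x y z : R) : 2^-1 * (x + y + (y + z) - x - z) = y by field.
by rewrite /S2 (sB (e_ d) (e_ c)); exact: alg.
Qed.

Lemma S2_sym c d t : t0 <= t <= t1 -> S2 c d t = S2 d c t.
Proof. by move=> tab; have [sB _] := Phi2_bilinear hPhi2 tab; rewrite /S2 sB. Qed.

(** A control extended by zero leaves its primitives at rest outside [a, b]; this moves values
    between t0 and a, and between b and t1. *)
Lemma acd_constant (a b c d : R) (F f : R -> R) : acd a b F f -> a <= c -> c <= d -> d <= b ->
  (forall t, c < t < d -> f t = 0) -> F c = F d.
Proof.
move=> hF ac cd db f0.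
apply/esym/(acd_unique (acdS ac db hF) (acd_cst c d (F c))) => //.
  by apply: ae_onT => t tcd; exact: f0.
by rewrite cd lexx.
Qed.

Definition extend (a b : R) (v : R -> 'rV[R]_k) (t : R) : 'rV[R]_k :=
  if t \in `[a, b] then v t else 0.

Context (a b : R) (ta : t0 <= a) (ab : a <= b) (bt : b <= t1).

Lemma extend_in v t : a <= t <= b -> extend a b v t = v t.
Proof. by move=> tab; rewrite /extend in_itv/= tab. Qed.

Lemma extend_out v t : t < a \/ b < t -> extend a b v t = 0.
Proof.
rewrite /extend in_itv/= => h; case: ifP => // /andP[h1 h2].
by case: h => h; [move: (lt_le_trans h h1)|move: (lt_le_trans h h2)]; rewrite ltxx.
Qed.

Lemma Linfty_extend v : Linfty a b v -> Linfty t0 t1 (extend a b v).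
Proof.
move=> /LinftyP lv; apply/LinftyP => j.
apply: Linf_ext (Linf_restrict ta bt (lv j)) => t _.
by rewrite /extend; case: ifP => _ //; rewrite mxE.
Qed.

(** [Phi1] solves the equation adjoint to the linearized one, so multiplication by it cancels the
    homogeneous part and leaves the source alone. *)
Lemma acd_mulPhi1 (g dg r : R -> 'rV[R]_n) : acd a b g dg ->
  ae_on a b (fun t => dg t = \sum_i u t 0 i *: 'D_(g t) (X i) (q t) + r t) ->
  acd a b (fun t => g t *m Phi1 t) (fun t => r t *m Phi1 t).
Proof.
move=> /acd_rVP hg hdg; apply/acd_rVP => j.
have /acd_mxP hP := acdS ta bt (Phi1_acd hPhi1).
have := acd_sum (fun c => acdM (hg c) (hP c j)).
move=> h; apply: acd_ae (acd_eq _ h) => [|t _]; last by rewrite mxE.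
have [_ _ h2] := hPhi1.
apply: ae_on2 hdg (ae_onS ta bt h2) => t _ dgE [_ /(_ (g t)) /eqP].
rewrite addr_eq0 => /eqP gP; rewrite big_split/=.
have -> : \sum_c g t 0 c * 'D_1 Phi1 t c j = (g t *m 'D_1 Phi1 t) 0 j by rewrite [RHS]mxE.
have -> : \sum_c dg t 0 c * Phi1 t c j = (dg t *m Phi1 t) 0 j by rewrite [RHS]mxE.
rewrite gP dgE mulmxDl addmxE oppmxE mulmx_suml !summxE.
rewrite [X in X + _ - _](eq_bigr (fun i => (u t 0 i *: ('D_(g t) (X i) (q t) *m Phi1 t)) 0 j)).
  by rewrite addrAC subrr add0r.
by move=> i _; rewrite scalemxAl.
Qed.

Lemma zcurve_extend du g : Linfty a b du -> acd a b g (jet_field1 X u du q g) -> g a = 0 ->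
  forall t, a <= t <= b -> \row_r zcurve (extend a b du) r t = g t *m Phi1 t.
Proof.
move=> ldu hg ga t tab; have lV := Linfty_extend ldu; apply/rowP => r; rewrite mxE.
apply/esym; have /acd_rVP h := acd_mulPhi1 hg (ae_onT (fun t _ => erefl)).
apply: (acd_unique (h r) (acdS ta bt (zcurve_acd sX hq hPhi1 r lV))) => //.
  apply: ae_onT => s /andP[as_ sb]; rewrite /zrate mulmx_suml summxE; apply: eq_bigr => i _.
  by rewrite extend_in ?(ltW as_) ?(ltW sb)// -scalemxAl scalemxE.
have at1 : a <= t1 by exact: le_trans bt.
rewrite ga mul0mx mxE -(zcurve_start X t0 q Phi1 (extend a b du) r).
apply: (acd_constant (zcurve_acd sX hq hPhi1 r lV)) => // s /andP[_ sa].
by rewrite /zrate big1// => i _; rewrite extend_out ?mxE ?mul0r//; left.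
Qed.

Lemma density_extend du g : Linfty a b du -> acd a b g (jet_field1 X u du q g) -> g a = 0 ->
  forall i t, a <= t <= b ->
    density (extend a b du) i t = \sum_c g t 0 c * kap X q Phi1 Phi2 psi0 i c t.
Proof.
move=> ldu hg ga i t tab; have zE := zcurve_extend ldu hg ga tab.
have tt : t0 <= t <= t1 by case/andP: tab => h1 h2; rewrite (le_trans ta h1) (le_trans h2 bt).
have uP := Phi1_unit hPhi1 tt.
have gE : (\row_r zcurve (extend a b du) r t) *m invmx (Phi1 t) = g t by rewrite zE mulmxK.
rewrite -gE /density; under [RHS]eq_bigr do rewrite mxE mulr_suml.
rewrite exchange_big/=; apply: eq_bigr => r _; rewrite /yy mulr_sumr.
by apply: eq_bigr => c _; rewrite mxE mulrA.
Qed.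

(** For the last claim, <g2 Phi1, psi0> + <Phi2[g1, g1], psi0> / 2 has the same derivative as the
    running cost. Both start from 0 at a, and at b the quadratic term disappears exactly because b1
    = 0, which is why the link is stated under that condition. *)
Lemma jets_link du : Linfty a b du ->
  let V := extend a b du in let j := jets X a (q a) u b du in
  [/\ j.1.1 *m Phi1 b = \row_r zcurve V r t1, j.1.2 = ccurve V t1 &
      j.1.1 = 0 -> pairing j.2.1 (Phi1 b *m psi0) = beta V V].
Proof.
move=> ldu V j.
have lV := Linfty_extend ldu; rewrite -/V in lV.
have luab : Linfty a b u by apply/LinftyP => i; apply: LinfS ta bt _; exact: (LinftyP _ _ _).1 lu i.
have hqab : trajectory X a b u q := acdS ta bt hq.
have cq := acd_rV_within hqab.
have [g1 [g2 [hg1 g1a hg2 g2a]]] := jet_curves sX ab luab ldu cq.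
have -> : j = ((g1 b, cross_energy a b u du), (g2 b, cross_energy a b du du / 2)).
  exact: (jetsE sX ab luab ldu hqab hg1 g1a hg2 g2a).
rewrite /=; have tb : t0 <= b by exact: le_trans ab.
have at1 : a <= t1 by exact: le_trans bt.
have V0l t : t0 < t < a -> forall i, V t 0 i = 0.
  by move=> /andP[_ h] i; rewrite /V extend_out ?mxE//; left.
have V0r t : b < t < t1 -> forall i, V t 0 i = 0.
  by move=> /andP[h _] i; rewrite /V extend_out ?mxE//; right.
have zE r t : a <= t <= b -> zcurve V r t = (g1 t *m Phi1 t) 0 r.
  by move=> tab; rewrite -(zcurve_extend ldu hg1 g1a tab) mxE.
split.
- apply/rowP => r; rewrite mxE -zE ?ab ?lexx//.
  apply: (acd_constant (zcurve_acd sX hq hPhi1 r lV)) => // s sa.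
  by rewrite /zrate big1// => i _; rewrite V0r// mul0r.
- have hc := ccurve_acd lu lV.
  have c0 : ccurve V a = 0.
    rewrite -(primitive_start t0 (fun t => \sum_i V t 0 i * u t 0 i)).
    apply/esym/(acd_constant hc) => // s sa.
    by rewrite big1// => i _; rewrite V0l// mul0r.
  have c1 : ccurve V b = ccurve V t1.
    apply: (acd_constant hc) => // s sa.
    by rewrite big1// => i _; rewrite V0r// mul0r.
  rewrite -c1 /cross_energy (Rintegral_acd ab (Linf_cross luab ldu) (F := ccurve V)).
    by rewrite c0 subr0.
  apply: acd_ae (acdS ta bt hc); apply: ae_onT => s /andP[as_ sb].
  apply: eq_bigr => i _; rewrite /V extend_in ?(ltW as_) ?(ltW sb)//.
  exact: mulrC.
move=> g1b.
have lB := Linf_beta sX hq hPhi1 hPhi2 psi0 lV lV.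
have hJ := primitive_Linf lB.
set J := primitive t0 _ in hJ.
have Ja : J a = 0.
  rewrite -(primitive_start t0 (fun t => \sum_i V t 0 i * density V i t)).
  apply/esym/(acd_constant hJ) => // s sa.
  by rewrite big1// => i _; rewrite V0l// mul0r.
have -> : beta V V = J b.
  apply/esym/(acd_constant hJ) => // s sa.
  by rewrite big1// => i _; rewrite V0r// mul0r.
have /acd_rVP hg1' := hg1.
have /acd_rVP hG2 := acd_mulPhi1 hg2 (ae_onT (fun t _ => erefl)).
(* [hL] is the linear part <g2 Phi1, psi0>, [hQ] the quadratic form of [Phi2] along g1; their
   combination [hP] is compared with the running cost [J]. *)
have hL := acd_sum (fun l => acdM (hG2 l) (acd_cst a b (psi0 l 0))).
have hQ := acd_sum (fun c => acd_sum (fun d =>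
  acdM (acdM (hg1' c) (hg1' d)) (acdS ta bt (S2_acd c d)))).
have hP := acdD hL (acdZ 2^-1 hQ).
have := acd_unique (acdS ta bt hJ) hP _ _ (introT andP (conj ab (lexx b))).
rewrite Ja g1a g2a g1b; move=> ->.
- rewrite -/J [X in _ = _ + _ * X]big1 ?mulr0 ?addr0; last first.
    by move=> c _; rewrite big1// => d _; rewrite mxE !mul0r.
  by rewrite -pairingE /pairing mulmxA.
- apply: ae_onT => t /andP[at_ tb']; have tab : a <= t <= b by rewrite !ltW.
  have tt : t0 <= t <= t1 by case/andP: tab => h1 h2; rewrite (le_trans ta h1) (le_trans h2 bt).
  have uP := Phi1_unit hPhi1 tt.
  have dE i : density V i t = pairing ('D_(g1 t) (X i) (q t) *m Phi1 t) psi0 +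
      pairing (Phi2 t (X i (q t)) (g1 t)) psi0.
    by rewrite -pairingD (kapE sX hPhi2 psi0 i (g1 t) tt); exact: density_extend.
  have -> : \sum_i V t 0 i * density V i t = \sum_i du t 0 i *
      (pairing ('D_(g1 t) (X i) (q t) *m Phi1 t) psi0 +
      pairing (Phi2 t (X i (q t)) (g1 t)) psi0).
    by apply: eq_bigr => i _; rewrite dE /V extend_in.
  under [X in _ = X + _]eq_bigr do rewrite mulr0 addr0.
  rewrite -pairingE mulmxDl pairingD !mulmx_suml !pairing_sum.
  have -> : \sum_c \sum_d ((jet_field1 X u du q g1 t 0 c * g1 t 0 d +
        g1 t 0 c * jet_field1 X u du q g1 t 0 d) * S2 c d t +
        g1 t 0 c * g1 t 0 d * ((S2rate (e_ c) (e_ d) t + S2rate (e_ d) (e_ c) t) / 2)) =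
      2 * pairing (Phi2 t (jet_field1 X u du q g1 t) (g1 t)) psi0 + S2rate (g1 t) (g1 t) t.
    rewrite (Phi2E hPhi2 psi0 _ _ tt) (S2rate_basis _ _ tt).
    (* Double sums are symmetrized so that they can be compared entry by entry with the symmetric
       matrix [S2]. *)
    have sw (f : 'I_n -> 'I_n -> R) : \sum_c \sum_d f c d = \sum_c \sum_d ((f c d + f d c) / 2).
      under [RHS]eq_bigr do rewrite -mulr_suml big_split/=.
      by rewrite -mulr_suml big_split/= [X in _ + X]exchange_big/=; field.
    rewrite [X in _ = 2 * X + _]sw [X in _ = _ + X]sw mulr_sumr -big_split/=.
    apply: eq_bigr => c _; rewrite mulr_sumr -big_split/=; apply: eq_bigr => d _.
    by rewrite (S2_sym d c tt); field.
  rewrite /jet_field1.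
  have [sB lB'] := Phi2_bilinear hPhi2 tt.
  have DB x y z : Phi2 t (x + y) z = Phi2 t x z + Phi2 t y z.
    by have := lB' z 1 x y; rewrite !scale1r.
  rewrite DB pairingD !(linear_comb _ _ _ (lB' (g1 t))) !pairing_sum /S2rate.
  rewrite [X in 2 * (X + _)](eq_bigr (fun i =>
     u t 0 i * pairing (Phi2 t ('D_(g1 t) (X i) (q t)) (g1 t)) psi0));
    last by move=> i _; rewrite pairingZ.
  rewrite [X in 2 * (_ + X)](eq_bigr (fun i =>
     du t 0 i * pairing (Phi2 t (X i (q t)) (g1 t)) psi0));
    last by move=> i _; rewrite pairingZ.
  rewrite [X in X + _ + _](eq_bigr (fun i =>
     u t 0 i * (2^-1 * pairing ('D_(g1 t) (fun y => 'D_(g1 t) (X i) y) (q t) *m Phi1 t) psi0))); last first.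
    by move=> i _; rewrite -!scalemxAl !pairingZ.
  rewrite [X in _ = _ + X + _](eq_bigr (fun i =>
     du t 0 i * pairing ('D_(g1 t) (X i) (q t) *m Phi1 t) psi0)); last first.
    by move=> i _; rewrite -!scalemxAl !pairingZ.
  (* The second derivatives of the fields ([p3]) and the terms [Phi2[D X[g1], g1]] ([p4]) cancel
     against the rate of [Phi2]: the equation that defines [Phi2] is made for this. *)
  have alg (x y p1 p2 p3 p4 : 'I_k -> R) : \sum_i y i * (p1 i + p2 i) =
      \sum_i x i * (2^-1 * p3 i) + \sum_i y i * p1 i +
      2^-1 * (2 * (\sum_i x i * p4 i + \sum_i y i * p2 i) -
              \sum_i x i * (p3 i + 2 * p4 i)).
    have -> : \sum_i y i * (p1 i + p2 i) = \sum_i y i * p1 i + \sum_i y i * p2 i.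
      by rewrite -big_split; apply: eq_bigr => i _; rewrite mulrDr.
    have -> : \sum_i x i * (p3 i + 2 * p4 i) = \sum_i x i * p3 i + 2 * \sum_i x i * p4 i.
      by rewrite mulr_sumr -big_split; apply: eq_bigr => i _; rewrite mulrDr mulrCA.
    have -> : \sum_i x i * (2^-1 * p3 i) = 2^-1 * \sum_i x i * p3 i.
      by rewrite mulr_sumr; apply: eq_bigr => i _; rewrite mulrCA.
    by field.
  exact: alg.
- rewrite [X in 0 = _ + _ * X]big1 ?mulr0 ?addr0; last first.
    by move=> c _; rewrite big1// => d _; rewrite mxE !mul0r.
  by rewrite big1// => l _; rewrite mul0mx mxE mul0r.
Qed.

End jets_and_costs.

(** * Regularity *)

Section continuously_differentiable.
Context {R : realType}.

Lemma withinS (a b c d : R) (f : R -> R) : a <= c -> d <= b ->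
  {within `[a, b], continuous f} -> {within `[c, d], continuous f}.
Proof.
move=> ac db; apply: continuous_subspaceW => x; rewrite /= !in_itv/= => /andP[h1 h2].
by rewrite (le_trans ac h1) (le_trans h2 db).
Qed.

Lemma within_rV (n : nat) (a b : R) (x : R -> 'rV[R]_n) :
  (forall j, {within `[a, b], continuous (fun t => x t 0 j)}) ->
  {within `[a, b], continuous x}.
Proof. by move=> cx t; apply: cvg_rV => i; exact: cx. Qed.

(** Near t the function g differs from g t by at most e, so comparing f with its tangent through
    [acd_bound] bounds the increment error by e times the length, on either side of t. *)
Lemma acd_is_derive (a b : R) (f g : R -> R) : acd a b f g ->
  {within `[a, b], continuous g} -> forall t, a < t < b -> is_derive t (1 : R) f (g t).
Proof.
move=> hf /subspace_continuousP cg t /andP[at_ tb].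
have tab : `[a, b]%classic t by rewrite /= in_itv/= !ltW.
suff h : (fun h => h^-1 *: ((f \o shift t) (h *: 1) - f t)) @ 0^' --> g t.
  by split; [apply/cvg_ex; exists (g t)|exact: cvg_lim h].
apply/cvgrPdist_le => e e0; move/cvgrPdist_le: (cg t tab) => /(_ e e0).
rewrite near_withinE => /nbhs_ballP[d /= d0 dP].
have d'0 : 0 < Num.min d (Num.min (t - a) (b - t)) by rewrite !lt_min d0 !subr_gt0 at_.
near=> h.
have hd : `|h| < Num.min d (Num.min (t - a) (b - t)).
  near: h; apply: nbhs_dnbhs; apply/nbhs_ballP.
  by exists (Num.min d (Num.min (t - a) (b - t))) => // y; rewrite /ball/= sub0r normrN.
move: hd; rewrite !lt_min => /and3P[hd ha hb].
have h0 : h != 0 by near: h; exact: nbhs_dnbhs_neq.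
have H x y : a <= x -> x <= y -> y <= b -> `|t - x| < d -> `|t - y| < d ->
    `|f y - f x - g t * (y - x)| <= e * (y - x).
  move=> ax xy yb tx ty.
  have hF := acdB (acdB (acdS ax yb hf) (acd_cst x y (f x))) (acd_affine x y (g t) (- (g t * x))).
  have hH := acd_affine x y e (- (e * x)).
  have := acd_bound hF hH _ _ (introT andP (conj xy (lexx y))).
  rewrite -!mulrBr; apply.
    by rewrite !subrr !mulr0 subr0 normr0.
  apply: ae_onT => s /andP[xs sy].
  rewrite subr0 distrC; apply: dP.
    move: tx ty; rewrite /ball/= !ltr_norml => /andP[h1 h2] /andP[h3 h4].
    by apply/andP; split; lra.
  by rewrite /= in_itv/= (le_trans ax (ltW xs)) (le_trans (ltW sy) yb).
have E : g t - h^-1 *: ((f \o shift t) (h *: 1) - f t) =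
    - h^-1 * (f (h + t) - f t - g t * h).
  by rewrite /= /GRing.scale/= mulr1; field.
rewrite E normrM normrN normfV ler_pdivrMl ?normr_gt0//.
move: ha hb; rewrite !ltr_norml => /andP[ha _] /andP[_ hb].
have [hpos|hneg] := leP 0 h.
  have := H t (h + t) (ltW at_); rewrite addrK subrr normr0.
  rewrite (_ : t - (h + t) = - h) ?normrN; last by ring.
  rewrite (ger0_norm hpos) => h1; rewrite [h * e]mulrC; apply: h1 => //; first by rewrite lerDr.
    by lra.
  by rewrite ger0_norm// in hd.
have := H (h + t) t; rewrite (_ : t - (h + t) = - h) ?subrr ?normr0 ?normrN; last by ring.
have -> : f t - f (h + t) - g t * - h = - (f (h + t) - f t - g t * h) by ring.
rewrite normrN (ltr0_norm hneg) [- h * e]mulrC; apply => //.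
- by lra.
- by lra.
- exact: ltW.
- by rewrite ltr0_norm// in hd.
Unshelve. all: by end_near.
Qed.

Context (a b : R).
Implicit Types f g : R -> R.

(** This form avoids one-sided derivatives at the end-points and passes through sums and products;
    genuine derivatives in the interior are recovered by [acd_is_derive]. *)
Definition C1on f := exists2 f', acd a b f f' & {within `[a, b], continuous f'}.

Lemma C1on_within f : C1on f -> {within `[a, b], continuous f}.
Proof. by move=> [f' hf _]; exact: acd_within hf. Qed.

Lemma C1on_ext f g : (forall t, a <= t <= b -> f t = g t) -> C1on f -> C1on g.
Proof. by move=> fg [f' hf cf]; exists f' => //; exact: acd_eq hf. Qed.

Lemma C1on_cst (c : R) : C1on (fun _ => c).
Proof. by exists (fun _ => 0); [exact: acd_cst|exact: within_cst]. Qed.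

Lemma C1onD f g : C1on f -> C1on g -> C1on (fun t => f t + g t).
Proof.
by move=> [f' hf cf] [g' hg cg]; exists (fun t => f' t + g' t); [exact: acdD|exact: withinD].
Qed.

Lemma C1onM f g : C1on f -> C1on g -> C1on (fun t => f t * g t).
Proof.
move=> hf hg; have [cf cg] := (C1on_within hf, C1on_within hg).
case: hf hg => [f' hf cf'] [g' hg cg']; exists (fun t => f' t * g t + f t * g' t).
  exact: acdM.
by apply: withinD; [apply: withinM; [exact: cf'|exact: cg]|apply: withinM; [exact: cf|exact: cg']].
Qed.

Lemma C1on_sum (I : eqType) (s : seq I) (f : I -> R -> R) :
  (forall i, C1on (f i)) -> C1on (fun t => \sum_(i <- s) f i t).
Proof.
move=> cf; elim: s => [|i s IHs].
  by apply: C1on_ext (@C1on_cst 0) => t _; rewrite big_nil.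
by apply: C1on_ext (C1onD (cf i) IHs) => t _; rewrite big_cons.
Qed.

Lemma C1on_acd f f' g : acd a b f f' -> ae_on a b (fun t => f' t = g t) ->
  {within `[a, b], continuous g} -> C1on f.
Proof. by move=> hf fg cg; exists g => //; exact: acd_ae hf. Qed.

Lemma C1on_smooth (n m : nat) (F : 'rV[R]_n -> 'rV[R]_m) (x dx : R -> 'rV[R]_n) :
  smooth F -> acd a b x dx -> (forall c, {within `[a, b], continuous (fun t => dx t 0 c)}) ->
  forall j, C1on (fun t => F (x t) 0 j).
Proof.
move=> sF hx cdx j; have cx := acd_rV_within hx.
have [M M0 xM] := within_rV_bounded cx.
have [C C0 FC] := smooth_lipschitz M sF.
apply: (@C1on_acd _ (fun t => 'D_(dx t) F (x t) 0 j)
  (fun t => \sum_c dx t 0 c * 'D_(delta_mx 0 c) F (x t) 0 j)).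
- split; last first.
    have [_ h] := hx; apply: ae_on1 h => t _ ht.
    exact: (is_derive_mxP _ _ _ _).1 (chain_rule sF ht) 0 j.
  have [h _] := acd_rVZ (C * n%:R) hx.
  apply: abs_continuous_le h => s t sab tab.
  have [[xs _] [xt _]] := (xM s sab, xM t tab).
  apply: le_trans (FC _ _ xs xt j) _.
  rewrite -scalerBr normrZ ger0_norm ?mulr_ge0// -mulrA ler_wpM2l//.
  rewrite mulrC -[X in _ <= _ * X]/(n%:R) mulr_natr -[X in _ <= _ *+ X]card_ord -sumr_const.
  by apply: ler_sum => c _; exact: norm_mx_coord.
- apply: ae_onT => t _; rewrite (derive_basis (x t) (dx t) sF) summxE.
  by apply: eq_bigr => c _; rewrite scalemxE.
apply: within_sum => c; apply: withinM; first exact: cdx.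
exact: (smooth_within (smooth_derive _ sF) cx).
Qed.

End continuously_differentiable.

(** * Gain of regularity when the control has a continuous representative *)

Section regularity.
Context {R : realType} {n k : nat}.
Context (X : 'I_k -> 'rV[R]_n -> 'rV[R]_n) (sX : forall i, smooth (X i)).
Context (t0 t1 : R) (t01 : t0 < t1).
Context (u : R -> 'rV[R]_k) (q : R -> 'rV[R]_n).
Context (lu : Linfty t0 t1 u) (hq : trajectory X t0 t1 u q).
Context (Phi1 : R -> 'M[R]_n) (Phi2 : R -> 'rV[R]_n -> 'rV[R]_n -> 'rV[R]_n).
Context (hPhi1 : adapted1 X t0 t1 u q Phi1) (hPhi2 : adapted2 X t0 t1 u q Phi1 Phi2).
Context (psi0 : 'cV[R]_n).
Context (a b : R) (ta : t0 <= a) (ab : a <= b) (bt : b <= t1).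
Context (U : 'I_k -> R -> R) (cU : forall i, {within `[a, b], continuous (U i)}).
Context (uU : ae_on a b (fun t => forall i, u t 0 i = U i t)).
Notation wc f := {within `[a, b], continuous f}.
Notation e_ c := (delta_mx 0 c).

Let inS (f : R -> R) : {within `[t0, t1], continuous f} -> wc f.
Proof. exact: withinS. Qed.

Let cq j : wc (fun t => q t 0 j).
Proof. by apply: inS; exact: (within_q hq). Qed.

Let luab : Linfty a b u.
Proof. by apply/LinftyP => i; apply: LinfS ta bt _; exact: (LinftyP _ _ _).1 lu i. Qed.

Lemma velocity_within j : wc (fun t => \sum_i U i t * X i (q t) 0 j).
Proof.
apply: within_sum => i; apply: withinM; first exact: cU.
exact: smooth_within (sX i) cq j.
Qed.

Lemma velocity_acd : acd a b q (fun t => \row_j \sum_i U i t * X i (q t) 0 j).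
Proof.
apply: acd_ae (acdS ta bt hq); apply: ae_on1 uU => t _ ut; apply/rowP => j.
by rewrite summxE mxE; apply: eq_bigr => i _; rewrite scalemxE ut.
Qed.

Lemma C1on_field (F : 'rV[R]_n -> 'rV[R]_n) j : smooth F -> C1on a b (fun t => F (q t) 0 j).
Proof.
move=> sF; apply: C1on_smooth sF velocity_acd _ j => c.
by apply: within_ext (@velocity_within c) => t _; rewrite mxE.
Qed.

Lemma C1on_Phi1 c j : C1on a b (fun t => Phi1 t c j).
Proof.
have h := acdS ta bt ((acd_mxP _ _ _ _).1 (Phi1_acd hPhi1) c j).
apply: (C1on_acd h (g := fun t => - \sum_i U i t * ('D_(e_ c) (X i) (q t) *m Phi1 t) 0 j)).
  have [_ _ h2] := hPhi1.
  apply: ae_on2 uU (ae_onS ta bt h2) => t _ ut [_ /(_ (e_ c)) /eqP].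
  rewrite addr_eq0 => /eqP eP.
  have row_coord (A : 'M[R]_n) : A c j = ((delta_mx 0 c : 'rV_n) *m A) 0 j.
    by rewrite -rowE mxE.
  rewrite row_coord eP oppmxE summxE; congr (- _).
  by apply: eq_bigr => i _; rewrite scalemxE ut.
have h1 : wc (fun t => \sum_i U i t * ('D_(e_ c) (X i) (q t) *m Phi1 t) 0 j).
  apply: within_sum => i; apply: withinM; first exact: cU.
  apply: (within_mulmx (A := fun t => 'D_(e_ c) (X i) (q t))) => [r m|r m].
    by rewrite (ord1 r); apply: inS; exact: (within_DX sX hq).
  by apply: inS; exact: (within_Phi1 hPhi1).
have h2 : wc (fun t => -1 * \sum_i U i t * ('D_(e_ c) (X i) (q t) *m Phi1 t) 0 j).
  by apply: withinM; [exact: within_cst|exact: h1].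
by apply: within_ext h2 => t _; rewrite mulN1r.
Qed.

Lemma C1on_mulPhi1 (F : R -> 'rV[R]_n) j : (forall c, C1on a b (fun t => F t 0 c)) ->
  C1on a b (fun t => (F t *m Phi1 t) 0 j).
Proof.
move=> hF; have : C1on a b (fun t => \sum_c F t 0 c * Phi1 t c j).
  by apply: C1on_sum => c; apply: C1onM; [exact: hF|exact: C1on_Phi1].
by apply: C1on_ext => t _; rewrite mxE.
Qed.

Lemma C1on_Y1 i j : C1on a b (fun t => Y1 X q Phi1 i t 0 j).
Proof. by apply: C1on_mulPhi1 => c; exact: C1on_field. Qed.

Lemma C1on_S2 c d : C1on a b (S2 Phi2 psi0 c d).
Proof.
pose G v w t := \sum_i U i t *
    (pairing ('D_v (fun x => 'D_w (X i) x) (q t) *m Phi1 t) psi0 +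
     2 * pairing (Phi2 t ('D_v (X i) (q t)) w) psi0).
have cG v w : wc (G v w).
  apply: within_sum => i; apply: withinM; first exact: cU.
  apply: withinD.
    have : wc (fun t => \sum_l ('D_v (fun x => 'D_w (X i) x) (q t) *m Phi1 t) 0 l * psi0 l 0).
      apply: within_sum => l; apply: withinM; last exact: within_cst.
      apply: C1on_within; apply: C1on_mulPhi1 => r.
      apply: (C1on_field (F := fun x => 'D_v (fun y => 'D_w (X i) y) x)).
      by do 2! apply: smooth_derive.
    by apply: within_ext => t _; rewrite pairingE.
  apply: withinM; first exact: within_cst.
  have : wc (fun t => \sum_c \sum_d 'D_v (X i) (q t) 0 c * w 0 d * S2 Phi2 psi0 c d t).
    apply: within_sum => r; apply: within_sum => s; apply: withinM.
      apply: withinM; last exact: within_cst.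
      by apply: inS; exact: (within_DX sX hq).
    by apply: inS; exact: (within_S2 hPhi2).
  apply: within_ext => t /andP[at_ tb]; rewrite (Phi2E hPhi2)//.
  by rewrite (le_trans ta at_) (le_trans tb bt).
have h := acdS ta bt (S2_acd sX hPhi2 psi0 c d).
apply: (C1on_acd h (g := fun t => (G (e_ c) (e_ d) t + G (e_ d) (e_ c) t) * - 2^-1)).
  apply: ae_on1 uU => t _ ut.
  have E v w : S2rate X u q Phi1 Phi2 psi0 v w t = - G v w t.
    by rewrite /S2rate; congr (- _); apply: eq_bigr => i _; rewrite ut.
  by rewrite !E -opprD mulrN mulNr.
by apply: withinM; [apply: withinD; exact: cG|exact: within_cst].
Qed.

Lemma C1on_kap i c : C1on a b (kap X q Phi1 Phi2 psi0 i c).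
Proof.
apply: C1onD.
  have : C1on a b (fun t => \sum_l ('D_(e_ c) (X i) (q t) *m Phi1 t) 0 l * psi0 l 0).
    apply: C1on_sum => l; apply: C1onM; last exact: C1on_cst.
    by apply: C1on_mulPhi1 => r; apply: (C1on_field (F := fun x => 'D_(e_ c) (X i) x));
      exact: smooth_derive.
  by apply: C1on_ext => t _; rewrite /DXpsi pairingE.
by apply: C1on_sum => d; apply: C1onM; [exact: C1on_field|exact: C1on_S2].
Qed.

Context (e : R -> 'rV[R]_k) (ce : forall i, wc (fun t => e t 0 i)).

Let le : Linfty a b e.
Proof. by apply/LinftyP => i; exact: Linf_within. Qed.

(** On [a, b] the density is the pairing of [kap] with the linearized curve g of [e]. The derivative
    of g involves both the control and [e], and both have continuous representatives. *)
Lemma C1on_density i : C1on a b (density X t0 q Phi1 Phi2 psi0 (extend a b e) i).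
Proof.
have [g [_ [hg ga _ _]]] := jet_curves sX ab luab le cq.
have : C1on a b (fun t => \sum_c g t 0 c * kap X q Phi1 Phi2 psi0 i c t).
  apply: C1on_sum => c; apply: C1onM; last exact: C1on_kap.
  have /acd_rVP hg' := hg.
  apply: (C1on_acd (hg' c) (g := fun t =>
    \sum_i U i t * (\sum_d g t 0 d * 'D_(e_ d) (X i) (q t) 0 c) +
    \sum_i e t 0 i * X i (q t) 0 c)).
    apply: ae_on1 uU => t _ ut; rewrite /jet_field1 addmxE !summxE; congr (_ + _).
      apply: eq_bigr => l _; rewrite scalemxE ut (derive_basis (q t) (g t) (sX l)) summxE.
      by congr (_ * _); apply: eq_bigr => d _; rewrite scalemxE.
    by apply: eq_bigr => l _; rewrite scalemxE.
  apply: withinD; apply: within_sum => l; apply: withinM; [exact: cU| |exact: ce|].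
    apply: within_sum => d; apply: withinM; first exact: (acd_rV_within hg).
    by apply: inS; exact: (within_DX sX hq).
  by apply: inS; exact: (within_X sX hq).
apply: C1on_ext => t tab; apply/esym.
exact: (density_extend sX hq Phi2 hPhi1 psi0 ta ab bt le hg ga).
Qed.

(** The derivative of the costate contains [e] itself: here the continuity of [e] on [a, b] is
    decisive. *)
Lemma C1on_costate r : C1on a b (costate X t0 t1 q Phi1 Phi2 psi0 (extend a b e) r).
Proof.
have h := acdS ta bt (costate_acd sX hq hPhi1 hPhi2 psi0 r (Linfty_extend ta bt le)).
apply: (C1on_acd h (g := fun t => -1 * \sum_i e t 0 i * yy X q Phi1 Phi2 psi0 i r t)).
  apply: ae_onT => t /andP[at_ tb]; rewrite mulN1r; congr (- _).
  by apply: eq_bigr => i _; rewrite extend_in ?(ltW at_) ?(ltW tb).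
apply: withinM; first exact: within_cst.
apply: within_sum => i; apply: withinM; first exact: ce.
by apply: inS; exact: (within_yy sX hq hPhi1 hPhi2).
Qed.

Lemma C1on_representer i :
  C1on a b (representer X t0 t1 q Phi1 Phi2 psi0 (extend a b e) i).
Proof.
apply: C1onD; first exact: C1on_density.
by apply: C1on_sum => r; apply: C1onM; [exact: C1on_Y1|exact: C1on_costate].
Qed.

Lemma C2_of_C1_control : (forall i, C1on a b (U i)) -> C2_on a b q.
Proof.
move=> hU; have hV j : C1on a b (fun t => \sum_i U i t * X i (q t) 0 j).
  by apply: C1on_sum => i; apply: C1onM; [exact: hU|exact: C1on_field].
split; first exact: within_rV cq.
have [dV hdV] : exists dV : 'I_n -> R -> R, forall j,
    acd a b (fun t => \sum_i U i t * X i (q t) 0 j) (dV j) /\ wc (dV j).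
  by exists (fun j => s2val (cid2 (hV j))) => j; case: (cid2 (hV j)).
exists (fun t => \row_j \sum_i U i t * X i (q t) 0 j), (fun t => \row_j dV j t).
split; [apply: within_rV => j|apply: within_rV => j|].
- by apply: within_ext (@velocity_within j) => t _; rewrite mxE.
- by apply: within_ext (hdV j).2 => t _; rewrite mxE.
move=> t; rewrite in_itv/= => tab; split; apply/is_derive_mxP => l j; rewrite (ord1 l).
  have /acd_rVP /(_ j) h := velocity_acd.
  have c : wc (fun t => (\row_j \sum_i U i t * X i (q t) 0 j) 0 j).
    by apply: within_ext (@velocity_within j) => s _; rewrite mxE.
  exact: acd_is_derive h c t tab.
have -> : (fun y => (\row_j \sum_i U i y * X i (q y) 0 j) 0 j) =
    (fun t => \sum_i U i t * X i (q t) 0 j) by apply/funext => y; rewrite mxE.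
by rewrite mxE; have [h c] := hdV j; exact: acd_is_derive h c t tab.
Qed.

End regularity.

(** * Fundamental lemma of the calculus of variations *)

Section fundamental_lemma.
Context {R : realType}.
Notation mu := (@lebesgue_measure R).

(* With P the primitive of r, the test function given by the primitive F of P yields
   int P^2 = [F P] - int F r = 0. *)
Lemma orthogonal_to_continuous (a b : R) (r : R -> R) : a <= b -> Linf a b r ->
  (forall f : R -> R, {within `[a, b], continuous f} -> \int[mu]_(t in `[a, b]) (f t * r t) = 0) ->
  ae_on a b (fun t => r t = 0).
Proof.
move=> ab lr r0; have hP := primitive_Linf lr; set P := primitive a r in hP.
have bb : a <= b <= b by rewrite ab lexx.
have Pa : P a = 0 by exact: primitive_start.
have Pb : P b = 0.
  rewrite -(r0 _ (@within_cst _ a b 1)) /P /primitive.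
  by apply: eq_Rintegral => t _; rewrite mul1r.
have cP := acd_within hP.
have hF := primitive_Linf (Linf_within cP); set F := primitive a P in hF.
have cF := acd_within hF.
have hS := primitive_Linf (Linf_within (withinM cP cP)).
have hT := primitive_Linf (LinfM (Linf_within cF) lr).
set S := primitive a _ in hS; set T := primitive a _ in hT.
have Tb : T b = 0 by exact: r0.
have Sb : S b = 0.
  have := acd_unique (acdM hF hP) (acdD hS hT) (ae_onT (fun t _ => erefl)) _ bb.
  rewrite Pb mulr0 Tb addr0 => <- //.
  by rewrite Pa mulr0 /S /T !primitive_start addr0.
(* [S], the primitive of P^2, is non-decreasing and equal to 0 at both ends. *)
have S0 t : a <= t <= b -> S t = 0.
  move=> /andP[at_ tb]; apply/eqP; rewrite eq_le.
  have pos : ae_on a b (fun t => 0 <= P t * P t).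
    by apply: ae_onT => s _; rewrite -expr2 sqr_ge0.
  have mon := acd_homo hS pos.
  have := mon t b at_ tb (lexx b); have := mon a t (lexx a) at_ tb.
  by rewrite Sb /S primitive_start => -> ->.
have P0 t : a <= t <= b -> P t = 0.
  rewrite le_eqVlt => /andP[/predU1P[<- _|at_]]; first exact: Pa.
  rewrite le_eqVlt => /predU1P[->|tb]; first exact: Pb.
  have tab : a < t < b by rewrite at_.
  have h := acd_is_derive (acd_eq S0 hS) (withinM cP cP) tab.
  have [_ h1] := h; have [_ h2] := is_derive1_cst (0 : R) t.
  by move: h1; rewrite h2 => /esym /eqP; rewrite mulf_eq0 orbb => /eqP.
have [_ h] := acd_eq P0 hP; apply: ae_on1 h => t _ [_ h1].
by have [_ h2] := is_derive1_cst (0 : R) t; rewrite -h1 h2.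
Qed.

Lemma integral_extend (k : nat) (t0 t1 a b : R) (v : R -> 'rV[R]_k) (r : 'I_k -> R -> R) :
  t0 <= a -> a <= b -> b <= t1 -> Linfty a b v -> (forall i, Linf t0 t1 (r i)) ->
  \int[mu]_(t in `[t0, t1]) (\sum_i extend a b v t 0 i * r i t) =
  \int[mu]_(t in `[a, b]) (\sum_i v t 0 i * r i t).
Proof.
move=> ta ab bt lv lr; have at1 : a <= t1 by exact: le_trans bt.
have tb : t0 <= b by exact: le_trans ab.
have lV := (LinftyP _ _ _).1 (Linfty_extend ta bt lv).
have hJ := primitive_Linf (Linf_sum (index_enum _) (fun i => LinfM (lV i) (lr i))).
set J := primitive t0 _ in hJ.
have Ja : J a = 0.
  rewrite -(primitive_start t0 (fun t => \sum_i extend a b v t 0 i * r i t)).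
  apply/esym/(acd_constant hJ) => // s /andP[_ sa].
  by rewrite big1// => i _; rewrite extend_out ?mxE ?mul0r//; left.
have Jb : J t1 = J b.
  apply/esym/(acd_constant hJ) => // s /andP[bs _].
  by rewrite big1// => i _; rewrite extend_out ?mxE ?mul0r//; right.
rewrite [LHS]Jb (@Rintegral_acd _ a b J) ?Ja ?subr0//.
  move/LinftyP: lv => lv; apply: Linf_sum => i; apply: LinfM => //.
  exact: LinfS (lr i).
apply: acd_ae (acdS ta bt hJ); apply: ae_onT => t /andP[at_ tb'].
by apply: eq_bigr => i _; rewrite extend_in// !ltW.
Qed.

Lemma orthogonal_to_controls (k : nat) (t0 t1 a b : R) (r : 'I_k -> R -> R) :
  t0 <= a -> a <= b -> b <= t1 -> (forall i, Linf t0 t1 (r i)) ->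
  (forall v : R -> 'rV[R]_k, (forall i, {within `[a, b], continuous (fun t => v t 0 i)}) ->
    \int[mu]_(t in `[t0, t1]) (\sum_i extend a b v t 0 i * r i t) = 0) ->
  ae_on a b (fun t => forall i, r i t = 0).
Proof.
move=> ta ab bt lr h; apply: ae_on_forall => i.
apply: orthogonal_to_continuous => //; first exact: LinfS (lr i).
move=> f cf; pose v t : 'rV[R]_k := f t *: delta_mx 0 i.
have cv j : {within `[a, b], continuous (fun t => v t 0 j)}.
  have : {within `[a, b], continuous (fun t => f t * (delta_mx 0 i : 'rV[R]_k) 0 j)}.
    by apply: withinM; [exact: cf|exact: within_cst].
  by apply: within_ext => t _; rewrite /v scalemxE.
have lv : Linfty a b v by apply/LinftyP => j; exact: Linf_within.
have := h v cv; rewrite integral_extend// => <-.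
apply: eq_Rintegral => t _; rewrite (bigD1 i)//= big1 ?addr0.
  by rewrite /v scalemxE mxE !eqxx mulr1.
by move=> j ji; rewrite /v scalemxE mxE eqxx (negbTE ji) mulr0 mul0r.
Qed.

End fundamental_lemma.

#[local] Opaque beta.

(** * Consequences of Monti's condition and regularity of one piece *)

Section regularity_of_pieces.
Context {R : realType} {n k : nat}.
Context (X : 'I_k -> 'rV[R]_n -> 'rV[R]_n) (sX : forall i, smooth (X i)).
Context (t0 t1 : R) (t01 : t0 < t1).
Context (u : R -> 'rV[R]_k) (q : R -> 'rV[R]_n).
Context (lu : Linfty t0 t1 u) (hq : trajectory X t0 t1 u q).
Context (Phi1 : R -> 'M[R]_n) (Phi2 : R -> 'rV[R]_n -> 'rV[R]_n -> 'rV[R]_n).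
Context (hPhi1 : adapted1 X t0 t1 u q Phi1) (hPhi2 : adapted2 X t0 t1 u q Phi1 Phi2).
Context (psi0 : 'cV[R]_n).
Context (hmonti : monti_condition X u q Phi1 Phi2 psi0 t0 t1).
Notation mu := (@lebesgue_measure R).
Notation zcurve := (zcurve X t0 q Phi1).
Notation ccurve := (ccurve t0 u).
Notation beta := (beta X t0 t1 q Phi1 Phi2 psi0).
Notation representer := (representer X t0 t1 q Phi1 Phi2 psi0).

Let t11 : t0 <= t1 <= t1. Proof. by rewrite lexx ltW. Qed.

Lemma lin_closed_Linfty : lin_closed (Linfty (k:=k) t0 t1).
Proof.
split; last by move=> c v w lv lw; exact: Linfty_comb.
apply/LinftyP => i; apply: Linf_ext (Linf_cst t0 t1 0) => t _.
by rewrite /= mxE.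
Qed.

Lemma beta00 : beta 0 0 = 0.
Proof.
have [l0 _] := lin_closed_Linfty.
exact: linear_on0 lin_closed_Linfty (betaDl sX t01 hq hPhi1 hPhi2 psi0 l0).
Qed.

Lemma OCP_admE v : Linfty t0 t1 v -> (forall j, zcurve v j t1 = 0) -> ccurve v t1 = 0 ->
  OCP_adm X u q Phi1 t0 t1 0 v.
Proof.
move=> lv zv cv; split=> //; rewrite (q1E sX lu hq hPhi1 lv t11) cv.
by congr pair; apply/rowP => j; rewrite !mxE zv.
Qed.

(** Finite codimension includes being a subspace, so the zero control is optimal and the optimal
    value is [beta 0 0], that is 0. The same remark gives positivity on the kernel in [beta_ge0]. *)
Lemma Sol0E v : Sol0 X u q Phi1 Phi2 psi0 t0 t1 v -> beta v v = 0.
Proof.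
have [[_ [_ h0] _] _] := hmonti; have [l0 _] := lin_closed_Linfty.
move=> [[lv _]]; rewrite -h0.
rewrite (OCP_costE sX lu hq hPhi1 hPhi2 psi0 lv) (OCP_costE sX lu hq hPhi1 hPhi2 psi0 l0).
by rewrite beta00 => -[].
Qed.

Lemma beta_ge0 v : Linfty t0 t1 v -> (forall j, zcurve v j t1 = 0) -> ccurve v t1 = 0 ->
  0 <= beta v v.
Proof.
move=> lv zv cv; have [[_ [_ h0] _] _] := hmonti; have [l0 _] := lin_closed_Linfty.
move: h0; rewrite (OCP_costE sX lu hq hPhi1 hPhi2)// beta00 => h0.
rewrite -lee_fin h0; apply: ereal_inf_lbound; exists v; first exact: OCP_admE.
by rewrite (OCP_costE sX lu hq hPhi1 hPhi2).
Qed.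

Lemma linear_on_zcurve j : linear_on (Linfty t0 t1) (fun v => zcurve v j t1).
Proof. by move=> c v w lv lw; exact: (zcurve_comb sX hq hPhi1). Qed.

Lemma linear_on_ccurve : linear_on (Linfty t0 t1) (fun v => ccurve v t1).
Proof. by move=> c v w lv lw; exact: (ccurve_comb lu). Qed.

Definition polar v w := beta v w + beta w v.

Lemma polarC v w : polar v w = polar w v.
Proof. exact: addrC. Qed.

Lemma linear_on_polar w : Linfty t0 t1 w -> linear_on (Linfty t0 t1) (polar^~ w).
Proof.
move=> lw c v v' lv lv'; rewrite /polar.
rewrite (betaDl sX t01 hq hPhi1 hPhi2 psi0 lw c lv lv').
rewrite (betaDr sX t01 hq hPhi1 hPhi2 psi0 lw c lv lv').
move: (beta _ _) (beta _ _) (beta _ _) (beta _ _) => x y z t.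
by ring.
Qed.

Lemma betaD v w (c : R) : Linfty t0 t1 v -> Linfty t0 t1 w ->
  beta (c *: w + v) (c *: w + v) = beta v v + c * polar v w + c ^+ 2 * beta w w.
Proof.
move=> lv lw; have lvw := Linfty_comb c lw lv; rewrite /polar.
rewrite (betaDl sX t01 hq hPhi1 hPhi2 psi0 lvw c lw lv).
rewrite (betaDr sX t01 hq hPhi1 hPhi2 psi0 lw c lw lv).
rewrite (betaDr sX t01 hq hPhi1 hPhi2 psi0 lv c lw lv).
move: (beta _ _) (beta _ _) (beta _ _) (beta _ _) => x y z t.
by ring.
Qed.

Context (a b : R) (ta : t0 <= a) (ab : a < b) (bt : b <= t1).
Let ab' : a <= b. Proof. exact: ltW. Qed.

(** Continuity relative to [a, b] allows jumps at a and at b. The second clause fixes the values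
    outside, so that these controls form a linear set of functions on the line on which [extend a b]
    is the identity. *)
Definition continuous_control (v : R -> 'rV[R]_k) :=
  (forall i, {within `[a, b], continuous (fun t => v t 0 i)}) /\ extend a b v = v.

Lemma continuous_extend (v : R -> 'rV[R]_k) :
  (forall i, {within `[a, b], continuous (fun t => v t 0 i)}) ->
  continuous_control (extend a b v).
Proof.
move=> cv; split=> [i|]; last by apply/funext => t; rewrite /extend; case: (t \in _).
by apply: within_ext (cv i) => t tab; rewrite extend_in.
Qed.

Lemma continuous_Linfty v : continuous_control v -> Linfty t0 t1 v.
Proof.
by move=> [cv <-]; apply: Linfty_extend => //; apply/LinftyP => i; exact: Linf_within.
Qed.

Lemma lin_closed_continuous : lin_closed continuous_control.
Proof.
split; [split=> [i|]|move=> c v w [cv ev] [cw ew]; split=> [i|]].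
- by apply: within_ext (@within_cst _ a b 0) => t _; rewrite mxE.
- by apply/funext => t; rewrite /extend; case: ifP.
- have : {within `[a, b], continuous (fun t => c * v t 0 i + w t 0 i)}.
    apply: withinD; last exact: cw.
    by apply: withinM; [exact: within_cst|exact: cv].
  by apply: within_ext => t _; rewrite addmxE scalemxE.
- rewrite -[in RHS]ev -[in RHS]ew; apply/funext => t; rewrite /extend.
  rewrite -[RHS]/(c *: (if _ then _ else _) + (if _ then _ else _)).
  by case: ifP => _ //; rewrite scaler0 addr0.
Qed.

(** The index [ord0] is the energy component and [lift ord0 j] the j-th adapted coordinate, so the
    multiplier at [ord0] is the lam of the overview. *)
Definition endpoint_functional (i : 'I_n.+1) (v : R -> 'rV[R]_k) : R :=
  if unlift ord0 i is Some j then zcurve v j t1 else ccurve v t1.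

Lemma linear_on_endpoint i : linear_on (Linfty t0 t1) (endpoint_functional i).
Proof.
rewrite /endpoint_functional; case: unliftP => [j _|_].
  exact: linear_on_zcurve.
exact: linear_on_ccurve.
Qed.

Lemma Linf_relation (lam : R) (p : 'I_n -> R) i :
  Linf t0 t1 (fun t => lam * u t 0 i + \sum_j p j * Y1 X q Phi1 i t 0 j).
Proof.
apply: LinfD; first by apply: LinfM; [exact: Linf_cst|exact: (LinftyP _ _ _).1 lu i].
apply: Linf_sum => j; apply: LinfM; first exact: Linf_cst.
by apply: Linf_within; exact: (within_Y1 sX hq hPhi1).
Qed.

Lemma endpoint_integral v (lam : R) (p : 'I_n -> R) : Linfty t0 t1 v ->
  lam * ccurve v t1 + \sum_j p j * zcurve v j t1 =
  \int[mu]_(t in `[t0, t1]) (\sum_i v t 0 i *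
    (lam * u t 0 i + \sum_j p j * Y1 X q Phi1 i t 0 j)).
Proof.
move=> lv; have hc := acdZ lam (ccurve_acd lu lv).
have hz := acd_sum (fun j => acdZ (p j) (zcurve_acd sX hq hPhi1 j lv)).
have := acdD hc hz => /(acd_ae _) h.
have lY i := Linf_relation lam p i.
rewrite (Rintegral_acd (ltW t01) _ (h _ _)).
- rewrite /ccurve primitive_start mulr0 [X in _ - (_ + X)]big1 ?addr0 ?subr0//.
  by move=> j _; rewrite zcurve_start mulr0.
- by apply: Linf_sum => i; apply: LinfM; [exact: (LinftyP _ _ _).1 lv i|exact: lY].
apply: ae_onT => t _; rewrite mulr_sumr.
under [X in _ + X]eq_bigr do rewrite /zrate mulr_sumr.
rewrite exchange_big/= -big_split/=; apply: eq_bigr => i _.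
rewrite mulrDr mulrCA; congr (_ + _); rewrite mulr_sumr.
by apply: eq_bigr => j _; rewrite mulrCA.
Qed.

(** The coefficient [al] lets one statement serve both cases: 1 for the corrected control e, and 0
    when the end-point components alone satisfy a relation. *)
Lemma control_relation e (al lam : R) (p : 'I_n -> R) : Linfty t0 t1 e ->
  (forall v, continuous_control v ->
    al * polar e v = lam * ccurve v t1 + \sum_j p j * zcurve v j t1) ->
  ae_on a b (fun t => forall i, al * representer e i t =
    lam * u t 0 i + \sum_j p j * Y1 X q Phi1 i t 0 j).
Proof.
move=> le h.
have lH i : Linf t0 t1 (representer e i).
  by apply: Linf_within; exact: (within_representer sX hq hPhi1 hPhi2).
have lY i := Linf_relation lam p i.
have lr i : Linf t0 t1 (fun t => al * representer e i t +
    (- 1) * (lam * u t 0 i + \sum_j p j * Y1 X q Phi1 i t 0 j)).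
  by apply: LinfD; (apply: LinfM; first exact: Linf_cst).
have : ae_on a b (fun t => forall i, al * representer e i t +
    (- 1) * (lam * u t 0 i + \sum_j p j * Y1 X q Phi1 i t 0 j) = 0).
  apply: (orthogonal_to_controls ta ab' bt lr) => v cv.
  have Cv := continuous_extend cv; have lv := continuous_Linfty Cv.
  have lv' := (LinftyP _ _ _).1 lv.
  have := h _ Cv; rewrite endpoint_integral// /polar addrC.
  rewrite (representerE sX t01 hq hPhi1 hPhi2 psi0 le lv) => hE.
  have i1 := Linf_integrable (Linf_sum (index_enum _) (fun i => LinfM (lv' i) (lH i))).
  have i2 := Linf_integrable (Linf_sum (index_enum _) (fun i => LinfM (lv' i) (lY i))).
  rewrite -[RHS](subrr (\int[mu]_(t in `[t0, t1]) (\sum_i extend a b v t 0 i *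
    (lam * u t 0 i + \sum_j p j * Y1 X q Phi1 i t 0 j)))) -{1}hE.
  rewrite -RintegralZl// -RintegralB//; last first.
    exact: Linf_integrable (LinfM (Linf_cst t0 t1 al) (Linf_sum _ (fun i => LinfM (lv' i) (lH i)))).
  apply: eq_Rintegral => t _; rewrite mulr_sumr -sumrB; apply: eq_bigr => i _.
  by rewrite mulrDr mulrCA mulN1r mulrN.
by apply: ae_on1 => t _ + i => /(_ i) /eqP; rewrite mulN1r subr_eq0 => /eqP.
Qed.

Lemma C2_of_relation e (al : R) (p : 'I_n -> R) : continuous_control e ->
  ae_on a b (fun t => forall i,
    u t 0 i = al * representer e i t + \sum_j p j * Y1 X q Phi1 i t 0 j) ->
  C2_on a b q.
Proof.
move=> [ce ee] hu; have le := continuous_Linfty (conj ce ee).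
pose U i t := al * representer e i t + \sum_j p j * Y1 X q Phi1 i t 0 j.
have cU i : {within `[a, b], continuous (U i)}.
  apply: (withinS ta bt); apply: withinD.
    by apply: withinM; [exact: within_cst|exact: (within_representer sX hq hPhi1 hPhi2)].
  apply: within_sum => j; apply: withinM; first exact: within_cst.
  exact: (within_Y1 sX hq hPhi1).
apply: (C2_of_C1_control sX hq ta bt cU hu) => i.
apply: C1onD.
  apply: C1onM; first exact: C1on_cst.
  rewrite -ee.
  exact: (C1on_representer sX lu hq hPhi1 hPhi2 psi0 ta ab' bt cU hu ce).
apply: C1on_sum => j; apply: C1onM; first exact: C1on_cst.
exact: (C1on_Y1 sX hq hPhi1 ta bt cU hu).
Qed.

Lemma Phi1_inj x t : t0 <= t <= t1 -> x *m Phi1 t = 0 -> x = 0 :> 'rV[R]_n.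
Proof. by move=> tt h; rewrite -(mulmxK (Phi1_unit hPhi1 tt) x) h mul0mx. Qed.

(** The infimum formula at t = b and at the value (0, 1), carried over by [jets_link]. That formula
    concerns attained values only, hence the witness [e]; it yields a lower bound for all
    competitors, and equality when [e] is a minimizer. *)
Lemma value_bound phi (B : R -> 'rV[R]_n * R -> 'rV[R]_n * R -> R) :
  phi b = Phi1 b *m psi0 -> value_family X a b u q phi B ->
  let P v := [/\ Linfty a b v, forall j, zcurve (extend a b v) j t1 = 0 &
                 ccurve (extend a b v) t1 = 1] in
  forall e, P e ->
    (forall v, P v -> - B b (0, 1) (0, 1) <= beta (extend a b v) (extend a b v)) /\
    ((forall v, P v -> beta (extend a b e) (extend a b e) <= beta (extend a b v) (extend a b v)) ->
      - B b (0, 1) (0, 1) = beta (extend a b e) (extend a b e)).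
Proof.
move=> phib [_ hB _ _] P e Pe.
have bab : b \in `[a, b] by rewrite in_itv/= ab' lexx.
have tb : t0 <= b <= t1 by rewrite bt andbT (le_trans ta).
have PE v : Linfty a b v -> jet1 X a (q a) u b v = (0, 1) <-> P v.
  move=> lv; have [h1 h2 _] := jets_link sX lu hq hPhi1 hPhi2 psi0 ta ab' bt lv.
  rewrite /jet1 [jets _ _ _ _ _ _]surjective_pairing /=; split.
    move=> hj; rewrite hj /= in h1 h2; split=> // j.
    by have /rowP /(_ j) := h1; rewrite mul0mx !mxE.
  move=> [_ zv cv]; rewrite [LHS]surjective_pairing h2 cv; congr pair.
  apply: (Phi1_inj tb); rewrite h1; apply/rowP => j; by rewrite !mxE.
have bE v : P v -> pairing (jet2 X a (q a) u b v).1 (phi b) = beta (extend a b v) (extend a b v).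
  move=> Pv; have [lv _ _] := Pv; have := (PE v lv).2 Pv.
  have [_ _ h3] := jets_link sX lu hq hPhi1 hPhi2 psi0 ta ab' bt lv.
  by rewrite /jet1 /jet2 phib => hj; apply: h3; rewrite hj.
have [le _ _] := Pe.
have := hB b (0, 1) bab; have : (jet1 X a (q a) u b @` Linfty a b) (0, 1).
  by exists e => //; exact/PE.
move=> e1 /(_ e1) vE; split=> [v Pv|emin].
  have [lv _ _] := Pv; rewrite -lee_fin vE -bE//; apply: ereal_inf_lbound.
  by exists v => //; split=> //; exact/PE.
apply/eqP; rewrite eq_le -!lee_fin vE; apply/andP; split.
  by rewrite -bE//; apply: ereal_inf_lbound; exists e => //; split=> //; exact/PE.
apply: le_ereal_inf_tmp => _ [v [lv /= jv] <-]; have Pv := (PE v lv).1 jv.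
by rewrite lee_fin (bE v Pv); exact: emin v Pv.
Qed.

(** A relation between functionals that was derived from continuous controls passes to all
    essentially bounded ones on [a, b], since it has become a pointwise identity almost everywhere
    that can be integrated against any of them. *)
Lemma polar_relation e (al lam : R) (p : 'I_n -> R) v : Linfty t0 t1 e -> Linfty a b v ->
  ae_on a b (fun t => forall i, al * representer e i t =
    lam * u t 0 i + \sum_j p j * Y1 X q Phi1 i t 0 j) ->
  al * polar e (extend a b v) =
  lam * ccurve (extend a b v) t1 + \sum_j p j * zcurve (extend a b v) j t1.
Proof.
move=> le lv h; have lV := Linfty_extend ta bt lv.
have lH i : Linf t0 t1 (representer e i).
  by apply: Linf_within; exact: (within_representer sX hq hPhi1 hPhi2).
have lr i := Linf_relation lam p i.
rewrite endpoint_integral// polarC /polar (representerE sX t01 hq hPhi1 hPhi2 psi0 le lV).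
rewrite !integral_extend//.
have lv' := (LinftyP _ _ _).1 lv.
have iH := Linf_sum (index_enum _) (fun i => LinfM (lv' i) (LinfS ta bt (lH i))).
rewrite -RintegralZl//; last exact: Linf_integrable.
apply: eq_Rintegral_ae.
- exact: LinfM (Linf_cst a b al) iH.
- by apply: Linf_sum => i; apply: LinfM => //; exact: LinfS (lr i).
apply: ae_on1 h => t _ h; rewrite mulr_sumr; apply: eq_bigr => i _.
by rewrite -h mulrCA.
Qed.

Lemma piece_regular phi (B : R -> 'rV[R]_n * R -> 'rV[R]_n * R -> R) :
  phi b = Phi1 b *m psi0 -> value_family X a b u q phi B ->
  B b (0, 1) (0, 1) != 0 -> C2_on a b q.
Proof.
move=> phib hB B0; have cC := lin_closed_continuous; have [C0 CL] := cC.
have CE : continuous_control `<=` Linfty t0 t1 by exact: continuous_Linfty.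
have lz j : linear_on continuous_control (fun v => zcurve v j t1).
  exact: sub_linear_on CE (linear_on_zcurve j).
have lc : linear_on continuous_control (fun v => ccurve v t1).
  exact: sub_linear_on CE linear_on_ccurve.
have [[e' [Ce' ze' ce']]|none] := pselect (exists e, [/\ continuous_control e,
    forall j, zcurve e j t1 = 0 & ccurve e t1 != 0]); last first.
  have [p pE] : exists p : 'I_n -> R, forall v, continuous_control v ->
      ccurve v t1 = \sum_j p j * zcurve v j t1.
    apply: (kernel_combination cC lz lc) => v Cv zv; apply/eqP/negP => /negP cv.
    by apply: none; exists v.
  (* With [al = 0] the costate term drops out, so the zero control can stand for e; the multiplier
     -1 of the energy component leaves u_i = <Y1_i, p>. *)
  have h := @control_relation 0 0 (-1) p (CE _ C0).
  apply: (@C2_of_relation 0 0 p C0); apply: ae_on1 (h _) => [t _ + i|v Cv].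
    by move=> /(_ i); rewrite mul0r mulN1r add0r addrC => /esym /subr0_eq ->.
  by rewrite mul0r mulN1r pE// addNr.
pose e0 := (ccurve e' t1)^-1 *: e'.
have Ce0 : continuous_control e0 by exact: lin_closedZ.
have ze0 j : zcurve e0 j t1 = 0 by rewrite /e0 (linear_onZ _ cC (lz j))// ze' mulr0.
have ce0 : ccurve e0 t1 = 1 by rewrite /e0 (linear_onZ _ cC lc)// mulVf.
pose K := [set v | continuous_control v /\ forall i, endpoint_functional i v = 0].
have KC : K `<=` continuous_control by move=> v [].
have Kz v : K v -> (forall j, zcurve v j t1 = 0) /\ ccurve v t1 = 0.
  move=> [_ h]; split=> [j|].
    by have := h (lift ord0 j); rewrite /endpoint_functional liftK.
  by have := h ord0; rewrite /endpoint_functional unlift_none.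
have cK : lin_closed K.
  split; first by split=> // i; exact: linear_on0 lin_closed_Linfty (linear_on_endpoint i).
  move=> c v w [Cv hv] [Cw hw]; split; first exact: CL.
  move=> i; rewrite (linear_on_endpoint i c (CE _ Cv) (CE _ Cw)) hv hw.
  by rewrite mulr0 addr0.
pose P v := [/\ Linfty a b v, forall j, zcurve (extend a b v) j t1 = 0 &
               ccurve (extend a b v) t1 = 1].
have PC v : continuous_control v -> (forall j, zcurve v j t1 = 0) -> ccurve v t1 = 1 -> P v.
  move=> [cv ev] zv c1; split; rewrite ?ev//.
  by apply/LinftyP => i; exact: Linf_within.
have Q2 v : polar v v = 2 * beta v v.
  by rewrite /polar; move: (beta _ _) => x; ring.
have bK v : K v -> 0 <= beta v v.
  by move=> Kv; have [zv cv] := Kz v Kv; apply: beta_ge0 => //; exact/CE/KC.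
have lQ w : continuous_control w -> linear_on continuous_control (polar^~ w).
  by move=> Cw; exact: sub_linear_on CE (linear_on_polar (CE _ Cw)).
have lQr w : continuous_control w -> linear_on continuous_control (polar w).
  by move=> Cw c v v' Cv Cv'; rewrite !(polarC w); exact: lQ.
have [d dep] := finite_codim_dependent hmonti.
have [w Kw wP] : exists2 w, K w & forall x, K x -> polar (e0 - w) x = 0.
  have oc := @orthogonal_correction _ _ _ cC _ polarC lQ d K e0 KC cK Ce0.
  apply: oc.
  - by move=> x Kx; rewrite Q2 mulr_ge0// bK.
  - move=> x Kx /eqP; rewrite Q2 mulf_eq0 pnatr_eq0/= => /eqP x0.
    apply/eqP/negP => /negP ex.
    have [low _] := value_bound phib hB (PC _ Ce0 ze0 ce0).
    have [zx cx] := Kz x Kx; have Cx := KC x Kx.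
    (* If x is null but not orthogonal to [e0], the cost is affine along [e0 + m x]; this m makes it
       [- B b (0, 1) (0, 1) - 1], below the infimum. *)
    pose m := (- B b (0, 1) (0, 1) - beta e0 e0 - 1) / polar e0 x.
    have Cm : continuous_control (m *: x + e0) by exact: CL.
    have Pm : P (m *: x + e0).
      apply: PC => // [j|]; first by rewrite (lz j)// zx ze0 mulr0 addr0.
      by rewrite lc// cx ce0 mulr0 add0r.
    have := low _ Pm; rewrite Cm.2 (betaD m (CE _ Ce0) (CE _ Cx)) x0 mulr0 addr0.
    rewrite /m divfK//; move: (B _ _ _) (beta e0 e0) => y z.
    by rewrite (_ : z + (- y - z - 1) = - y - 1); [lra|ring].
  (* Monti's condition concerns controls on all of [t0, t1]; it bounds the number of Gram-Schmidt
     steps in [K] because [K] consists of controls extended by zero. *)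
  - move=> x Kx; have [c [cn Sc]] := dep x (fun i => CE _ (KC _ (Kx i))).
    exists c; split=> //=; rewrite Q2 Sol0E ?mulr0//.
pose e := e0 - w.
have Cw := KC w Kw; have [zw cw] := Kz w Kw.
have Ce : continuous_control e by rewrite /e -[w]scale1r; exact: lin_closedB.
have ze j : zcurve e j t1 = 0.
  by rewrite /e -[w]scale1r (linear_onB 1 (lz j))// ze0 zw mulr0 subr0.
have ce : ccurve e t1 = 1.
  by rewrite /e -[w]scale1r (linear_onB 1 lc)// ce0 cw mulr0 subr0.
have [p pE] : exists p : 'I_n.+1 -> R, forall v, continuous_control v ->
    polar e v = \sum_i p i * endpoint_functional i v.
  apply: (kernel_combination cC _ (lQr e Ce)) => [i|v Cv hv].
    exact: sub_linear_on CE (linear_on_endpoint i).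
  by apply: wP; split.
have rel : ae_on a b (fun t => forall i, 1 * representer e i t =
    p ord0 * u t 0 i + \sum_j p (lift ord0 j) * Y1 X q Phi1 i t 0 j).
  apply: control_relation; first exact: CE.
  move=> v Cv; rewrite mul1r pE// big_ord_recl /endpoint_functional unlift_none.
  by congr (_ + _); apply: eq_bigr => j _; rewrite liftK.
(* [p ord0] multiplies u in the pointwise relation; when it is nonzero, the relation can be solved
   for u. *)
have [p0|p0] := eqVneq (p ord0) 0; last first.
  apply: (@C2_of_relation e (p ord0)^-1 (fun j => - (p ord0)^-1 * p (lift ord0 j)) Ce).
  apply: ae_on1 rel => t _ + i => /(_ i); rewrite mul1r => ->.
  rewrite mulrDr mulKf// -addrA [X in _ = _ + X](_ : _ = 0) ?addr0//.
  rewrite mulr_sumr -big_split/= big1// => j _.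
  by rewrite mulNr mulNr mulrA subrr.
(* The competitor [v] has end-point (0, 1), so the energy term is cancelled by [p ord0 = 0] and the
   other terms by the vanishing coordinates. *)
have PQ v : P v -> polar e (extend a b v) = 0.
  move=> [lv zv cv]; have := polar_relation (CE _ Ce) lv rel.
  by rewrite mul1r p0 mul0r add0r => ->; rewrite big1// => j _; rewrite zv mulr0.
have Pe : P e by exact: PC.
(* [e] is itself a competitor, so it is orthogonal to itself. *)
have ee : beta e e = 0.
  have := PQ e Pe; rewrite Ce.2 Q2 => /eqP; rewrite mulf_eq0 pnatr_eq0/= => /eqP.
  exact.
have [_ /(_ _)] := value_bound phib hB Pe; rewrite Ce.2 ee => hv.
have [] := negP B0; rewrite -oppr_eq0 hv// => v Pv.
have [lv zv cv] := Pv; have lV := Linfty_extend ta bt lv; have le := CE _ Ce.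
(* [r] has end-point 0, so its cost is nonnegative; in the expansion of the cost of [r + e] the
   mixed term and the cost of [e] vanish. *)
pose r := extend a b v - 1 *: e.
have lr : Linfty t0 t1 r by exact: lin_closedB lin_closed_Linfty lV le.
have -> : extend a b v = 1 *: r + e by rewrite /r !scale1r subrK.
rewrite (betaD 1 le lr) ee add0r mul1r expr1n mul1r.
have -> : polar e r = 0.
  rewrite polarC /r (linear_onB 1 (linear_on_polar le) lV le) ![polar _ e]polarC PQ//.
  by rewrite -[X in polar e X]Ce.2 PQ// mulr0 subr0.
rewrite add0r; apply: beta_ge0 => // [j|].
  by rewrite /r (linear_onB 1 (linear_on_zcurve j))// zv ze mulr0 subr0.
by rewrite /r (linear_onB 1 linear_on_ccurve)// cv ce mulr1 subrr.
Qed.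

End regularity_of_pieces.

Theorem lemma5p9 (R : realType) (n k : nat)
  (X : 'I_k -> 'rV[R]_n -> 'rV[R]_n)
  (Xsmooth : forall i, smooth (X i))
  (Xfree : forall x, row_free (\matrix_(i < k) X i x))
  (t0 t1 : R) (t01 : t0 < t1)
  (u : R -> 'rV[R]_k) (q : R -> 'rV[R]_n)
  (uLinfty : Linfty t0 t1 u)
  (qtraj : trajectory X t0 t1 u q)
  (qmin : minimizing X t0 t1 u q)
  (qabn : strictly_abnormal X t0 t1 u q)
  (Phi1 : R -> 'M[R]_n) (Phi2 : R -> 'rV[R]_n -> 'rV[R]_n -> 'rV[R]_n)
  (hPhi1 : adapted1 X t0 t1 u q Phi1)
  (hPhi2 : adapted2 X t0 t1 u q Phi1 Phi2)
  (psi0 : 'cV[R]_n) (phi : R -> 'cV[R]_n)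
  (hphi : pontryagin_covector X t0 t1 u q phi)
  (phiE : forall t, t \in `[t0, t1] -> phi t = Phi1 t *m psi0)
  (N : nat) (tau : nat -> R) (htau : division t0 t1 N tau)
  (B : R -> R -> R -> 'rV[R]_n * R -> 'rV[R]_n * R -> R)
  (hB : forall a b, piece N tau a b -> value_family X a b u q phi (B a b))
  (hmonti : monti_condition X u q Phi1 Phi2 psi0 t0 t1) :
  forall a b, piece N tau a b -> two_abnormal a b (B a b) \/ C2_on a b q.
Proof.
move=> a b pab; have [ab [i iN [ia bi]]] := pab.
have [tau0 tauN tauS] := htau.
have mono j l : (j <= l <= N)%N -> tau j <= tau l.
  elim: l => [|l IHl]; first by rewrite leqn0 => /andP[/eqP->].
  rewrite leq_eqVlt => /andP[/predU1P[->//|jl] lN].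
  by apply: le_trans (ltW (tauS l lN)); apply: IHl; rewrite -ltnS jl ltnW.
have ta : t0 <= a.
  by apply: le_trans (ltW ia); rewrite -tau0; apply: mono; rewrite leq0n ltnW.
have bt : b <= t1.
  by apply: le_trans (ltW bi) _; rewrite -tauN; apply: mono; rewrite iN leqnn.
(* The value a_2 is tested at the right end b alone: if it vanishes there, 2-normality already
   fails, since b belongs to the half-open interval on which a_2 must not vanish. *)
have [Bz|Bn] := eqVneq (B a b b (0, 1) (0, 1)) 0.
  left=> /(_ b); rewrite in_itv/= ab lexx Bz eqxx => /(_ isT).
  by [].
right; apply: (piece_regular Xsmooth t01 uLinfty qtraj hPhi1 hPhi2 hmonti
  ta ab bt _ (hB a b pab) Bn).
by apply: phiE; rewrite in_itv/= bt (le_trans ta (ltW ab)).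
Qed.
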